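(* Let $P_1,P_2$ be finite bounded posets with $CL$-ceds $\{\Sigma_s^{(1)}\}$ and $\{\Sigma_t^{(2)}\}$ with respect to $CL$-labelings $\lambda_1,\lambda_2$ with disjoint label sets. Let $P$ be $P_1\times P_2$, $P_1\check{\times}P_2$ or $P_1\hat{\times}P_2$, with $\lambda$ the corresponding labeling $\lambda_1\times\lambda_2$, $\lambda_1\check{\times}\lambda_2$ (where $\lambda_1,\lambda_2$ are assumed orderly) or $\lambda_1\hat{\times}\lambda_2$ (where $\lambda_1,\lambda_2$ are assumed co-orderly). Let $\Sigma_{s,t}$ be the corresponding product ($\times$, $\check{\times}$ or $\hat{\times}$) of $\Sigma_s^{(1)}$ and $\Sigma_t^{(2)}$, ordered lexicographically by $(s,t)$. Then $\{\Sigma_{s,t}\}$ is a $CL$-ced of $P$ with respect to $\lambda$.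
   Context: Products: $P_1\times P_2$ componentwise; $P_1\check{\times}P_2=((P_1\setminus\{\hat0\})\times(P_2\setminus\{\hat0\}))\cup\{\hat0\}$; $P_1\hat{\times}P_2=((P_1\setminus\{\hat1\})\times(P_2\setminus\{\hat1\}))\cup\{\hat1\}$; $p_i$ coordinate projections. Rooted cover relation: $(\mathbf r,x\lessdot y)$ with $\mathbf r$ a maximal chain of $[\hat0,x]$; a $CL$-labeling labels rooted cover relations so that every rooted interval $[x,y]_{\mathbf r}$ has a unique maximal chain with weakly increasing labels, which is lexicographically first. A chain is descending if it has no position where a label is $\le$ the next. A $CL$-labeling is orderly if its label set is totally ordered and split as $S^-<S^A<S^+$ where all labels of edges $\hat0\lessdot x$ lie in $S^A$ and all other labels lie in $S^-\cup S^+$; co-orderly is the same with edges $x\lessdot\hat1$ in place of $\hat0\lessdot x$. Product labelings: label sets are shuffled as $S_1^-<S_2^-<S_1^A<S_2^A<S_1^+<S_2^+$ (any shuffle for $\times$). $\lambda_1\times\lambda_2$ labels a rooted edge by $\lambda_i(p_i(\mathbf r),p_i(x\lessdot y))$ where $i$ is the coordinate in which the edge projects to a cover relation. $\lambda_1\check{\times}\lambda_2$ labels $\hat0\lessdot y$ by the word $\lambda_1(\hat0\lessdot p_1(y))\lambda_2(\hat0\lessdot p_2(y))\in S_1^AS_2^A$ (ordered lexicographically, placed between $S_2^-$ and $S_1^+$) and other edges as in $\lambda_1\times\lambda_2$; $\lambda_1\hat{\times}\lambda_2$ labels $(\mathbf r,x\lessdot\hat1)$ by the word $\lambda_1(p_1(\mathbf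 r),p_1(x\lessdot\hat1))\lambda_2(p_2(\mathbf r),p_2(x\lessdot\hat1))$ and other edges as in $\lambda_1\times\lambda_2$. $CL$-ced of a rank-$k$ bounded poset $Q$ w.r.t. $CL$-labeling $\mu$: an ordered collection $\Sigma_1,\dots,\Sigma_m$ of rank-$k$ subposets, with $\Delta_s$ the simplicial complex generated by maximal chains in $\Sigma_s$ but in no $\Sigma_r$, $r<s$, such that: each $\Sigma_s$ is isomorphic to the face lattice of a convex polytope; for every $s$ and rooted interval $[x,y]_{\mathbf r}$ at most one descending maximal chain of $[x,y]_{\mathbf r}$ is a face of $\Delta_s$; any chain of length $<k$ extendable to maximal chains of both $\Delta_s$ and $\Delta_r$ ($r<s$) extends to a maximal chain of $\Sigma_s$ not in $\Delta_s$; every chain of $Q$ lies in some $\Sigma_s$. *)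

(* Defs.v *)
From HB Require Import structures.
From mathcomp Require Import classical_sets reals.
From mathcomp Require Import all_boot all_order all_algebra.

Set Implicit Arguments.
Unset Strict Implicit.
Unset Printing Implicit Defensive.

Import Order.TTheory GRing.Theory.

Section Polytope.
Local Open Scope ring_scope.
Local Open Scope classical_set_scope.
Variables (R : realType) (n : nat).

Definition conv_hull (m : nat) (v : 'I_m -> 'rV[R]_n) : set 'rV[R]_n :=
  [set x | exists w : 'I_m -> R,
    [/\ forall i, 0 <= w i, \sum_i w i = 1 & x = \sum_i w i *: v i]].

(* The linear functional may be zero, so that the empty set and K itself are
   faces; the hull of no points (m = 0) has the empty set as its only face. *)
Definition is_face (K F : set 'rV[R]_n) : Prop :=
  exists (a : 'rV[R]_n) (b : R),
    (forall x, K x -> \sum_j a 0 j * x 0 j <= b) /\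
    F = [set x | K x /\ \sum_j a 0 j * x 0 j = b].

End Polytope.

Local Open Scope order_scope.

Section Posets.
Context {d : Order.disp_t} {P : finTBPOrderType d}.
Implicit Types (x y z : P) (A c r : {set P}).

Definition is_polytope_face_lattice (R : realType) A : Prop :=
  exists (n m : nat) (v : 'I_m -> 'rV[R]_n) (f : P -> set 'rV[R]_n),
    [/\ forall x, x \in A -> is_face (conv_hull v) (f x),
        forall F, is_face (conv_hull v) F -> exists2 x, x \in A & f x = F
      & {in A &, forall x y, x <= y <-> (f x `<=` f y)%classic}].

Definition covers x y : bool := (x < y) && ~~ [exists z, x < z < y].

Definition chain c : bool := [forall x in c, forall y in c, x >=< y].

Definition maxchain A c : bool := maxset (fun c' => chain c' && (c' \subset A)) c.

Definition itv x y : {set P} := [set z | x <= z <= y].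

Definition is_root x r : bool := maxchain (itv \bot x) r.

Definition has_rank A (k : nat) : Prop := forall c, maxchain A c -> #|c| = k.+1.

End Posets.

(* The label of the rooted cover relation (r, x <. y), where r, a maximal chain
   of [\bot, x], is given as a set.  Values on other arguments are junk. *)
Definition labeling {d} (P : finTBPOrderType d) (L : Type) := {set P} -> P -> P -> L.

Section Labelings.
Context {d dL : Order.disp_t} {P : finTBPOrderType d} {L : porderType dL}.
Implicit Types (lam : labeling P L) (x y : P) (c r : {set P}) (S : {pred L}).

(* For c = {x_0 < ... < x_m} a maximal chain of [x_0, x_m] and r a root of x_0,
   the edge x_i <. x_(i+1) is rooted at r together with x_0, ..., x_i. *)
Definition label_word lam r c : seq L :=
  let s := sort <=%O (enum c) in
  [seq lam (r :|: [set z in c | z <= e.1]) e.1 e.2 | e <- zip s (behead s)].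

Definition increasing lam r c : bool := sorted <=%O (label_word lam r c).

Definition descending lam r c : bool :=
  sorted (fun a b => ~~ (a <= b)) (label_word lam r c).

Definition CL_labeling lam : Prop :=
  forall x y r, x <= y -> is_root x r ->
  exists c0, [/\ maxchain (itv x y) c0, increasing lam r c0,
    forall c, maxchain (itv x y) c -> increasing lam r c -> c = c0
  & forall c, maxchain (itv x y) c -> c != c0 ->
      (label_word lam r c0 : seqlexi L) < (label_word lam r c : seqlexi L)].

Definition labels_in lam S : Prop :=
  forall r x y, is_root x r -> covers x y -> lam r x y \in S.

Fixpoint increasing_blocks (Bs : seq {pred L}) : Prop :=
  if Bs is B :: Bs' then
    {in B & [pred b | has (fun C : {pred L} => b \in C) Bs'], forall a b, a < b}
    /\ increasing_blocks Bs'
  else True.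

Definition label_split S Sm SA Sp : Prop :=
  [/\ {in S &, total <=%O}, S =i [predU Sm & [predU SA & Sp]]
    & increasing_blocks [:: Sm; SA; Sp]].

Definition orderly lam S Sm SA Sp : Prop :=
  label_split S Sm SA Sp /\
  forall r x y, is_root x r -> covers x y ->
    lam r x y \in (if x == \bot then SA else [predU Sm & Sp] : {pred L}).

Definition co_orderly lam S Sm SA Sp : Prop :=
  label_split S Sm SA Sp /\
  forall r x y, is_root x r -> covers x y ->
    lam r x y \in (if y == \top then SA else [predU Sm & Sp] : {pred L}).

End Labelings.

Section CLced.
Context {d dL dI : Order.disp_t} {P : finTBPOrderType d} {L : porderType dL}.
Context {I : finOrderType dI}.
Implicit Types (Sigma : I -> {set P}) (s t : I) (c e : {set P}).

Definition new_maxchain Sigma s c : bool :=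
  maxchain (Sigma s) c && [forall t, (t < s) ==> ~~ (c \subset Sigma t)].

Definition Delta Sigma s : {set {set P}} :=
  [set c : {set P} | [exists e, new_maxchain Sigma s e && (c \subset e)]].

Record CL_ced_of_rank (R : realType) (k : nat)
    (lam : labeling P L) Sigma : Prop := {
  ced_labeling : CL_labeling lam;
  ced_rank : has_rank [set: P] k;
  ced_subrank : forall s, has_rank (Sigma s) k;
  ced_polytope : forall s, is_polytope_face_lattice R (Sigma s);
  ced_desc : forall s x y r, x <= y -> is_root x r -> forall c c',
    maxchain (itv x y) c -> descending lam r c -> c \in Delta Sigma s ->
    maxchain (itv x y) c' -> descending lam r c' -> c' \in Delta Sigma s ->
    c = c';
  (* #|c| <= k: the length of c, which is #|c| - 1, is less than k. *)
  ced_bdry : forall s t c, t < s -> (#|c| <= k)%N ->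
    c \in Delta Sigma s -> c \in Delta Sigma t ->
    exists e, [/\ maxchain (Sigma s) e, c \subset e & e \notin Delta Sigma s];
  ced_union : forall c, chain c -> exists s, c \subset Sigma s }.

Definition CL_ced (R : realType) (lam : labeling P L) Sigma : Prop :=
  exists k, CL_ced_of_rank R k lam Sigma.

End CLced.

(* The two reduced products, as subposets of P1 *p P2: either both coordinates
   are extreme or none is.  When exactly one factor is trivial (\bot = \top),
   (\top, \top) is not in check_prod, resp. (\bot, \bot) is not in hat_prod;
   the reduced product is then a single point, its own \bot and \top. *)
Section ReducedProducts.
Context {d1 d2 : Order.disp_t} (P1 : finTBPOrderType d1) (P2 : finTBPOrderType d2).

Definition check_prod : Type :=
  {u : P1 *p P2 | (u.1 == \bot) == (u.2 == \bot)}.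
Definition hat_prod : Type :=
  {u : P1 *p P2 | (u.1 == \top) == (u.2 == \top)}.

HB.instance Definition _ := SubChoice.on check_prod.
HB.instance Definition _ := Finite.on check_prod.
HB.instance Definition _ := SubChoice.on hat_prod.
HB.instance Definition _ := Finite.on hat_prod.
HB.instance Definition _ :=
  [SubChoice_isSubPOrder of check_prod by <: with Order.prod_display d1 d2].
HB.instance Definition _ :=
  [SubChoice_isSubPOrder of hat_prod by <: with Order.prod_display d1 d2].

Lemma check_bot_subproof :
  (((\bot : P1 *p P2).1 == \bot) == ((\bot : P1 *p P2).2 == \bot)).
Proof. by rewrite !eqxx. Qed.

Lemma hat_top_subproof :
  (((\top : P1 *p P2).1 == \top) == ((\top : P1 *p P2).2 == \top)).
Proof. by rewrite !eqxx. Qed.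

Definition check_bot : check_prod := exist _ \bot check_bot_subproof.
Definition check_top : check_prod := insubd check_bot (\top : P1 *p P2).
Definition hat_top : hat_prod := exist _ \top hat_top_subproof.
Definition hat_bot : hat_prod := insubd hat_top (\bot : P1 *p P2).

Lemma check_bot_le (u : check_prod) : check_bot <= u.
Proof. exact: (le0x (val u)). Qed.

Lemma hat_le_top (u : hat_prod) : u <= hat_top.
Proof. exact: (lex1 (val u)). Qed.

Lemma check_le_top (u : check_prod) : u <= check_top.
Proof.
rewrite -[u <= _]/(val u <= val check_top) val_insubd.
case: ifPn => [_|]; first exact: lex1.
case: u => -[u1 u2] /=; rewrite leEprod /=.
have [e1|] := eqVneq \top (\bot : P1); have [e2|] //= := eqVneq \top (\bot : P2).
- have -> : u1 = \bot by apply: le_anti; rewrite le0x -e1 lex1.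
  by move=> _; rewrite eqxx => /eqP/esym/eqP -> _; rewrite !lexx.
- have -> : u2 = \bot by apply: le_anti; rewrite le0x -e2 lex1.
  by move=> _; rewrite eqxx => /eqP/eqP -> _; rewrite !lexx.
Qed.

Lemma hat_bot_le (u : hat_prod) : hat_bot <= u.
Proof.
rewrite -[_ <= u]/(val hat_bot <= val u) val_insubd.
case: ifPn => [_|]; first exact: le0x.
case: u => -[u1 u2] /=; rewrite leEprod /=.
have [e1|] := eqVneq \bot (\top : P1); have [e2|] //= := eqVneq \bot (\top : P2).
- have -> : u1 = \top by apply: le_anti; rewrite lex1 -e1 le0x.
  by move=> _; rewrite eqxx => /eqP/esym/eqP -> _; rewrite !lexx.
- have -> : u2 = \top by apply: le_anti; rewrite lex1 -e2 le0x.
  by move=> _; rewrite eqxx => /eqP/eqP -> _; rewrite !lexx.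
Qed.

HB.instance Definition _ :=
  Order.hasBottom.Build (Order.prod_display d1 d2) check_prod check_bot_le.
HB.instance Definition _ :=
  Order.hasTop.Build (Order.prod_display d1 d2) check_prod check_le_top.
HB.instance Definition _ :=
  Order.hasBottom.Build (Order.prod_display d1 d2) hat_prod hat_bot_le.
HB.instance Definition _ :=
  Order.hasTop.Build (Order.prod_display d1 d2) hat_prod hat_le_top.

Definition times_set (A1 : {set P1}) (A2 : {set P2}) : {set P1 *p P2} :=
  [set u | (u.1 \in A1) && (u.2 \in A2)].

Definition check_set (A1 : {set P1}) (A2 : {set P2}) : {set check_prod} :=
  [set u : check_prod | ((val u).1 \in A1 :\ \bot) && ((val u).2 \in A2 :\ \bot)]
  :|: [set (\bot : check_prod)].

Definition hat_set (A1 : {set P1}) (A2 : {set P2}) : {set hat_prod} :=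
  [set u : hat_prod | ((val u).1 \in A1 :\ \top) && ((val u).2 \in A2 :\ \top)]
  :|: [set (\top : hat_prod)].

End ReducedProducts.

Section ProductLabelings.
Context {d1 d2 dL : Order.disp_t} {P1 : finTBPOrderType d1} {P2 : finTBPOrderType d2}.
Context {L : porderType dL} (lam1 : labeling P1 L) (lam2 : labeling P2 L).

(* The label sets of lam1 and lam2 are disjoint subsets of a common L, whose order
   restricted to their union is the shuffle. *)
Definition times_labeling : labeling (P1 *p P2) L := fun r x y =>
  if covers x.1 y.1 then lam1 [set u.1 | u in r] x.1 y.1
  else lam2 [set u.2 | u in r] x.2 y.2.

(* The labels are words, ordered lexicographically, where a letter is identified
   with the word of length one.  If S1A lies between S2m and S1p, then so do the
   two-letter words with first letter in S1A. *)
Definition pair_word (r : {set P1 *p P2}) (x y : P1 *p P2) : seqlexi L :=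
  [:: lam1 [set u.1 | u in r] x.1 y.1; lam2 [set u.2 | u in r] x.2 y.2].

Definition check_labeling : labeling (check_prod P1 P2) (seqlexi L) := fun r x y =>
  if x == \bot then pair_word [set val u | u in r] (val x) (val y)
  else [:: times_labeling [set val u | u in r] (val x) (val y)].

Definition hat_labeling : labeling (hat_prod P1 P2) (seqlexi L) := fun r x y =>
  if y == \top then pair_word [set val u | u in r] (val x) (val y)
  else [:: times_labeling [set val u | u in r] (val x) (val y)].

End ProductLabelings.

(* Main.v *)
(* A saturated path of a product projects to a saturated path in each factor,
   and its label word is a shuffle of the two projected words.  As labels of
   different factors are distinct and comparable, two words have exactly one
   increasing and at most one descending shuffle, and the increasing shuffle of
   the lexicographically least words is lexicographically least; this gives the
   CL-property and the uniqueness of descending chains.  In the reduced products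
   the letter next to the two-letter word lies above or below both middle
   blocks, so that comparing with the two-letter word amounts to comparing with
   each of its letters.
   A chain is new for (s, t) only if its projections are new for s and for t, and
   a chain together with maximal chains of the factors containing its
   projections lifts to a maximal chain of the product; so the conditions on the
   complexes Delta reduce to those of the factors.
   On polytopes, the three products are the free join, the Cartesian product and
   the free sum. *)
Require Import Defs.
From mathcomp Require Import classical_sets reals.
From mathcomp Require boolp.
From mathcomp Require Import all_boot all_order all_algebra.

Set Implicit Arguments.
Unset Strict Implicit.
Unset Printing Implicit Defensive.

Import Order.TTheory.
Local Open Scope order_scope.

(** * Saturated paths and label words *)

Lemma mem_unzip1_zip (T : eqType) (s t : seq T) : {subset unzip1 (zip s t) <= s}.
Proof.
elim: s t => [|a s IH] [|b t] u //=; rewrite !inE => /orP[->//|/IH->].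
by rewrite orbT.
Qed.

Section SaturatedPaths.
Context {d : Order.disp_t} {P : finTBPOrderType d}.
Implicit Types (x y z w : P) (s : seq P) (A c r e : {set P}).

Definition saturated x y s : bool := path covers x s && (last x s == y).

Lemma saturated_cons x y z s :
  saturated x y (z :: s) = covers x z && saturated z y s.
Proof. by rewrite /saturated /= andbA. Qed.

Lemma saturated_rcons x y z s :
  saturated x y (rcons s z) = [&& path covers x s, covers (last x s) z & z == y].
Proof. by rewrite /saturated rcons_path last_rcons andbA. Qed.

Lemma coversP x y :
  reflect (x < y /\ forall z, x < z -> z < y -> False) (covers x y).
Proof.
apply: (iffP andP) => -[lt_xy H]; split=> //.
  by move=> z xz zy; case/existsP: H; exists z; rewrite xz zy.
by apply/existsP => -[z /andP[xz zy]]; apply: H xz zy.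
Qed.

Lemma covers_lt x y : covers x y -> x < y.
Proof. by case/andP. Qed.

Lemma covers_eq x y z : covers x y -> x <= z -> z < y -> z = x.
Proof.
case/coversP=> _ H; rewrite le_eqVlt => /orP[/eqP//|xz] zy.
by case: (H z xz zy).
Qed.

Lemma covers_eqr x y z : covers x y -> x < z -> z <= y -> z = y.
Proof.
case/coversP=> _ H xz; rewrite le_eqVlt => /orP[/eqP//|zy].
by case: (H z xz zy).
Qed.

Lemma covers_path_lt x s : path covers x s -> path <%O x s.
Proof. by apply: sub_path; exact: covers_lt. Qed.

Lemma lt_path_le_last x s : path <%O x s -> x <= last x s.
Proof.
elim: s x => //= w s IH x /andP[xw /IH]; exact: le_trans (ltW xw).
Qed.

Lemma lt_path_ge x s z : path <%O x s -> z \in x :: s -> x <= z.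
Proof.
rewrite inE => + /orP[/eqP->//|] => /(order_path_min lt_trans)/allP H /H.
exact: ltW.
Qed.

Lemma lt_path_le x s z : path <%O x s -> z \in x :: s -> z <= last x s.
Proof.
elim: s x z => [|w s IH] x z /=; first by rewrite inE => _ /eqP->.
move=> /andP[xw ps]; rewrite inE => /orP[/eqP->|/IH-> //].
exact: le_trans (ltW xw) (lt_path_le_last ps).
Qed.

Lemma saturated_le x y s : saturated x y s -> x <= y.
Proof. by case/andP=> /covers_path_lt/lt_path_le_last + /eqP <-. Qed.

Lemma chainP c :
  reflect {in c &, forall x y, x >=< y} (chain c).
Proof.
apply: (iffP forall_inP) => H x; last first.
  by move=> xc; apply/forall_inP=> y yc; exact: H.
by move=> y xc yc; have /forall_inP := H _ xc; exact.
Qed.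

Lemma chain_subset c e : c \subset e -> chain e -> chain c.
Proof.
by move=> /subsetP ce /chainP H; apply/chainP => x y /ce ? /ce ?; apply: H.
Qed.

Lemma maxchainP A c :
  reflect [/\ chain c, c \subset A &
    forall z, z \in A -> {in c, forall x, x >=< z} -> z \in c] (maxchain A c).
Proof.
apply: (iffP maxsetP) => [[/andP[cc cA] H]|[cc cA H]]; last first.
  split=> [|e /andP[/chainP ce eA] /subsetP se]; first by rewrite cc.
  apply/eqP; rewrite eqEsubset; apply/andP; split; apply/subsetP=> // z ze.
  by apply: H => [|x /se xe]; [exact: (subsetP eA)|exact: ce].
split=> // z zA zc; suff <- : z |: c = c by rewrite setU11.
apply: H; last exact: subsetUr.
rewrite subUset sub1set zA cA !andbT; apply/chainP => x y.
move/chainP: cc => cc.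
rewrite !inE => /orP[/eqP->|xc] /orP[/eqP->|yc]; last exact: cc.
- exact: comparablexx.
- by rewrite comparable_sym zc.
- exact: zc.
Qed.

Lemma chain_maxchain A c : chain c -> c \subset A ->
  exists2 e, maxchain A e & c \subset e.
Proof.
move=> cc cA.
have H : (fun e => chain e && (e \subset A)) c by rewrite cc cA.
by have [e] := @maxset_exists _ (fun e => chain e && (e \subset A)) c H; exists e.
Qed.

Lemma saturated_mem x s z : path covers x s -> x <= z -> z <= last x s ->
  {in x :: s, forall w, w >=< z} -> z \in x :: s.
Proof.
elim: s x => [|w s IH] x /=.
  by move=> _ xz zx _; rewrite inE eq_le xz zx.
move=> /andP[xw ps] xz zl H.
have := H w; rewrite !inE eqxx orbT => /(_ isT).
case/orP => [wz|zw].
  have := IH w ps wz zl; rewrite inE => -> //; first by rewrite orbT.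
  by move=> u us; apply: H; rewrite inE us orbT.
have [->|nzw] := eqVneq z w; first by rewrite orbT.
by rewrite (covers_eq xw xz) ?eqxx // lt_neqAle nzw.
Qed.

Lemma path_saturated x s : path <%O x s ->
  (forall z, x <= z -> z <= last x s -> {in x :: s, forall w, w >=< z} ->
    z \in x :: s) -> path covers x s.
Proof.
elim: s x => [|w s IH] x //= /andP[xw ps] H.
have wP z : z \in w :: s -> w <= z by exact: lt_path_ge.
apply/andP; split.
  apply/coversP; split=> // z xz zw.
  have : z \in x :: w :: s.
    apply: H; first exact: ltW.
      exact: le_trans (ltW zw) (lt_path_le_last ps).
    move=> u; rewrite inE => /orP[/eqP->|/wP wu].
      by rewrite /Order.comparable (ltW xz).
    by rewrite /Order.comparable (le_trans (ltW zw) wu) orbT.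
  rewrite inE => /orP[/eqP zx|/wP wz]; first by rewrite zx ltxx in xz.
  by have := lt_le_trans zw wz; rewrite ltxx.
apply: IH => // z wz zl zc.
have xz := lt_le_trans xw wz.
have : z \in x :: w :: s.
  apply: H => //; first exact: ltW.
  by move=> u; rewrite inE => /orP[/eqP->|/zc//]; rewrite /Order.comparable (ltW xz).
by rewrite inE => /orP[/eqP zx|//]; rewrite zx ltxx in xz.
Qed.

Lemma saturated_maxchain x y s :
  saturated x y s -> maxchain (itv x y) [set z in x :: s].
Proof.
case/andP=> ps /eqP <-; have lps := covers_path_lt ps.
have srt : sorted <%O (x :: s) by [].
apply/maxchainP; split.
- apply/chainP => z w; rewrite !in_set => zs ws.
  have := sub_sorted (fun a b => @ltW _ _ a b) srt; rewrite sorted_pairwise; last exact: le_trans.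
  move: zs ws; elim: (x :: s) => // u t IH; rewrite /= !inE.
  move=> /orP[/eqP->|zt] /orP[/eqP->|wt] /andP[/allP ut pt].
  + exact: comparablexx.
  + by rewrite /Order.comparable ut.
  + by rewrite /Order.comparable ut ?orbT.
  + exact: IH.
- apply/subsetP=> z; rewrite in_set => zs; rewrite inE.
  by rewrite (lt_path_ge lps) // (lt_path_le lps).
- move=> z; rewrite inE in_set => /andP[xz zy] H.
  by apply: saturated_mem => // w ws; apply: H; rewrite in_set.
Qed.

Lemma maxchain_saturated x y c : x <= y -> maxchain (itv x y) c ->
  exists2 s, saturated x y s & c = [set z in x :: s].
Proof.
move=> xy /maxchainP[/chainP cc /subsetP cI cm].
have ci z : z \in c -> x <= z <= y by move=> /cI; rewrite inE.
have xc : x \in c.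
  apply: cm; first by rewrite inE lexx xy.
  by move=> z /ci /andP[xz _]; rewrite /Order.comparable xz orbT.
have yc : y \in c.
  apply: cm; first by rewrite inE lexx xy.
  by move=> z /ci /andP[_ zy]; rewrite /Order.comparable zy.
have : sorted <%O (sort <=%O (enum c)).
  rewrite lt_sorted_uniq_le sort_uniq enum_uniq /=.
  apply: (@sort_sorted_in _ (mem c)) => //; last by apply/allP=> z; rewrite mem_enum.
have memc : sort <=%O (enum c) =i c by move=> z; rewrite mem_sort mem_enum.
case: (sort _ _) memc => [/(_ x)|x' s]; first by rewrite xc in_nil.
move=> memc lps; rewrite /sorted in lps.
have xx : x' = x.
  apply/eqP; rewrite eq_le; have /ci/andP[-> _] : x' \in c by rewrite -memc mem_head.
  by rewrite andbT; apply: lt_path_ge lps _; rewrite memc.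
rewrite {x'}xx in lps memc *.
have ly : last x s = y.
  apply/eqP; rewrite eq_le (lt_path_le lps) ?memc // andbT.
  by have /ci/andP[_ ->] : last x s \in c by rewrite -memc mem_last.
exists s; last by apply/setP=> z; rewrite in_set memc.
apply/andP; split; last by rewrite ly.
apply: path_saturated => // z xz; rewrite ly => zy H.
by rewrite memc; apply: cm; [rewrite inE xz|move=> w; rewrite -memc => /H].
Qed.

Lemma saturated_set_inj x y s s' : saturated x y s -> saturated x y s' ->
  [set z in x :: s] = [set z in x :: s'] -> s = s'.
Proof.
move=> /andP[/covers_path_lt ps _] /andP[/covers_path_lt ps' _] /setP E.
suff [] : x :: s = x :: s' by [].
by apply: lt_sorted_eq => // z; have := E z; rewrite !in_set.
Qed.

Lemma exists_saturated x y : x <= y -> exists s, saturated x y s.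
Proof.
move=> xy.
have c0 : chain (set0 : {set P}) by apply/chainP=> z; rewrite inE.
have [c mc _] := chain_maxchain c0 (sub0set (itv x y)).
by have [s ss _] := maxchain_saturated xy mc; exists s.
Qed.

Lemma card_saturated x y s : saturated x y s -> #|[set z in x :: s]| = (size s).+1.
Proof.
case/andP=> /covers_path_lt ps _; rewrite cardsE; apply/card_uniqP.
by have : sorted <%O (x :: s) by []; rewrite lt_sorted_uniq_le => /andP[].
Qed.

Lemma itv_bot_top : itv \bot \top = [set: P].
Proof. by apply/setP=> z; rewrite !inE le0x lex1. Qed.

Lemma saturated_cat x y z s t : saturated x y s -> saturated y z t ->
  saturated x z (s ++ t).
Proof.
rewrite /saturated cat_path last_cat.
by move=> /andP[-> /eqP->] /andP[-> ->].
Qed.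

Lemma graded k x y s s' : has_rank [set: P] k ->
  saturated x y s -> saturated x y s' -> size s = size s'.
Proof.
move=> rk ss ss'.
have [s0 ss0] := exists_saturated (le0x x).
have [s1 ss1] := exists_saturated (lex1 y).
suff H t : saturated x y t -> size (s0 ++ t ++ s1) = k.
  by apply/eqP; rewrite -(eqn_add2l (size s0)) -(eqn_add2r (size s1)) -!addnA;
     rewrite -!size_cat !H.
move=> st; have sc := saturated_cat ss0 (saturated_cat st ss1).
by apply: succn_inj; rewrite -(card_saturated sc) rk // -itv_bot_top;
   exact: saturated_maxchain.
Qed.

Lemma root_path x r : is_root x r ->
  exists2 p, saturated \bot x p & r = [set z in \bot :: p].
Proof. exact: maxchain_saturated (le0x x). Qed.

Lemma root_mem x r : is_root x r -> x \in r.
Proof. by case/root_path=> p /andP[_ /eqP<-] ->; rewrite in_set mem_last. Qed.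

Lemma root_covers x z r : covers x z -> is_root x r -> is_root z (z |: r).
Proof.
move=> xz /root_path[p sp ->].
have -> : z |: [set u in \bot :: p] = [set u in \bot :: p ++ [:: z]].
  by apply/setP=> u; rewrite !inE mem_cat inE orbC -orbA.
apply: saturated_maxchain; apply: saturated_cat sp _.
by rewrite /saturated /= xz eqxx.
Qed.

Section Words.
Context {L : Type}.
Implicit Type lam : labeling P L.

Fixpoint word lam r x s : seq L :=
  if s is z :: s' then lam r x z :: word lam (z |: r) z s' else [::].

Lemma size_word lam r x s : size (word lam r x s) = size s.
Proof. by elim: s r x => //= z s IH r x; rewrite IH. Qed.

Lemma word_cat lam r x s t : word lam r x (s ++ t) =
  word lam r x s ++ word lam (r :|: [set z in s]) (last x s) t.
Proof.
elim: s r x => [|z s IH] r x /=.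
  by congr word; apply/setP=> u; rewrite !inE orbF.
rewrite IH; congr (_ :: (_ ++ word _ _ _ _)).
by apply/setP=> u; rewrite !inE -orbA orbCA.
Qed.

End Words.

Lemma root_saturated x y r s : saturated x y s -> is_root x r ->
  is_root y (r :|: [set z in s]).
Proof.
elim: s x r => [|z s IH] x r /andP[/= ps ly] xr.
  rewrite -(eqP ly) (_ : _ :|: _ = r) //; apply/setP=> u.
  by rewrite !inE orbF.
case/andP: ps => xz ps.
have := IH z (z |: r); rewrite /saturated ps ly => /(_ isT (root_covers xz xr)).
by rewrite (_ : (z |: r) :|: _ = r :|: [set u in z :: s]) //;
   apply/setP=> u; rewrite !inE orbCA -orbA.
Qed.

Section LabelWords.
Context {dL : Order.disp_t} {L : porderType dL}.
Implicit Type lam : labeling P L.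

Lemma label_wordE lam x y s r : saturated x y s -> x \in r ->
  label_word lam r [set z in x :: s] = word lam r x s.
Proof.
move=> /andP[/covers_path_lt ps _] xr.
have srt : sorted <%O (x :: s) by [].
rewrite /label_word.
have -> : sort <=%O (enum [set z in x :: s]) = x :: s.
  apply: (sorted_eq le_trans le_anti).
  - apply: (@sort_sorted_in _ (mem [set z in x :: s])); last first.
      by apply/allP=> z; rewrite mem_enum.
    move=> z w; rewrite !in_set.
    elim: (x :: s) srt => // u t IH put.
    have Ht v : v \in t -> u <= v.
      by move=> vt; apply: lt_path_ge put _; rewrite inE vt orbT.
    rewrite !inE => /orP[/eqP->|zt] /orP[/eqP->|wt].
    + by rewrite lexx.
    + by rewrite Ht.
    + by rewrite Ht ?orbT.
    + exact: IH (path_sorted put) _ _.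
  - exact: sub_sorted (fun a b => @ltW _ _ a b) _ srt.
  - rewrite perm_sort; apply: uniq_perm; first exact: enum_uniq.
      by move: srt; rewrite lt_sorted_uniq_le => /andP[].
    by move=> z; rewrite mem_enum in_set.
rewrite [behead _]/=.
have Hc : forall z, z \in [set z in x :: s] -> z \in r \/ z \in s.
  by move=> z; rewrite !inE => /orP[/eqP->|]; [left|right].
have Hs : {subset s <= [set z in x :: s]}.
  by move=> z zs; rewrite !inE zs orbT.
move: [set z in x :: s] Hc Hs => c Hc Hs {srt}.
elim: s x r ps xr Hc Hs => //= z s IH x r /andP[xz ps] xr Hc Hs.
congr (_ :: _).
  congr lam; apply/setP=> u; rewrite !inE.
  apply/idP/idP=> [/orP[//|/andP[/Hc[//|us] ux]]|->//].
  have zu : z <= u by exact: lt_path_ge ps us.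
  by have := lt_le_trans xz (le_trans zu ux); rewrite ltxx.
rewrite -(IH z (z |: r)) ?setU11 //; last 2 first.
- move=> u /Hc; rewrite !inE => -[->|/orP[->|->]]; by [left; rewrite ?orbT|left|right].
- by move=> u us; apply: Hs; rewrite inE us orbT.
apply/eq_in_map => -[u v] uv /=.
have us : u \in z :: s.
  by move: uv => /(map_f fst)/mem_unzip1_zip.
congr lam; apply/setP=> w; rewrite !inE.
have [->|//] := eqVneq w z.
by rewrite Hs ?mem_head //= (lt_path_ge ps us) !orbT.
Qed.

Definition CL_path lam r x y s0 : Prop :=
  [/\ saturated x y s0, sorted <=%O (word lam r x s0),
      forall s, saturated x y s -> sorted <=%O (word lam r x s) -> s = s0
    & forall s, saturated x y s -> s != s0 ->
      (word lam r x s0 : seqlexi L) < (word lam r x s : seqlexi L)].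

Lemma CL_labelingP lam : CL_labeling lam <->
  forall x y r, x <= y -> is_root x r -> exists s0, CL_path lam r x y s0.
Proof.
split=> H x y r xy xr; have xr' := root_mem xr.
  have [c [cm ci cu cl]] := H x y r xy xr.
  have [s ss Ec] := maxchain_saturated xy cm.
  exists s; split=> // [|s' ss' is'|s' ss' ns].
  - by rewrite -(label_wordE lam ss) // -Ec.
  - apply: (saturated_set_inj ss' ss); rewrite -Ec; apply: cu.
      exact: saturated_maxchain.
    by rewrite /increasing (label_wordE lam ss').
  - rewrite -(label_wordE lam ss) // -(label_wordE lam ss') // -Ec; apply: cl.
      exact: saturated_maxchain.
    apply: contraNneq ns => E; apply/eqP; apply: (saturated_set_inj ss' ss).
    by rewrite E.
have [s [ss is_ us ls]] := H x y r xy xr.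
exists [set z in x :: s]; split; first exact: saturated_maxchain.
- by rewrite /increasing (label_wordE lam ss).
- move=> c /(maxchain_saturated xy)[s' ss' ->].
  by rewrite /increasing (label_wordE lam ss') // => /(us _ ss') ->.
- move=> c /(maxchain_saturated xy)[s' ss' ->] n.
  rewrite (label_wordE lam ss) // (label_wordE lam ss') //; apply: ls => //.
  by apply: contraNneq n => ->.
Qed.

End LabelWords.
End SaturatedPaths.

(** * Shuffles of two words *)

Section Shuffles.
Context {dL : Order.disp_t} {L : porderType dL} (S : bool -> {pred L}).
Hypothesis Sdisj : forall i a, a \in S i -> a \in S (~~ i) -> False.
Implicit Types (t : seq (bool * L)) (i j : bool) (a b : L).

Definition tagged_in t := all (fun p : bool * L => p.2 \in S p.1) t.

Definition part i t : seq L := [seq p.2 | p <- t & p.1 == i].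

Lemma part_cons i j a t :
  part i ((j, a) :: t) = if j == i then a :: part i t else part i t.
Proof. by rewrite /part /=; case: ifP. Qed.

Lemma part_in i t : tagged_in t -> all (mem (S i)) (part i t).
Proof.
elim: t => [|[k x] t IH] //= /andP[/= xk /IH H].
by rewrite part_cons; case: eqP => // kE; rewrite kE in xk; rewrite /= H andbT.
Qed.

Lemma tag_inj t t' : tagged_in t -> tagged_in t' ->
  map snd t = map snd t' -> t = t'.
Proof.
elim: t t' => [|[i a] t IH] [|[j b] t'] //= /andP[/= ai ot] /andP[/= bj ot'].
case=> E /(IH _ ot ot') ->; congr ((_, _) :: _) => //; rewrite -{}E in bj.
case: i j ai bj => -[] // x y; by [case: (@Sdisj true a)|case: (@Sdisj false a)].
Qed.

(* Both [<=] and its negation are transitive on triples that meet both label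
   sets, although the negation need not be transitive on either of them. *)
Section CrossTransitive.
Variable R : rel L.
Hypothesis Rtrans : forall i j k a b c, ~~ ((i == j) && (j == k)) ->
  a \in S i -> b \in S j -> c \in S k -> R a b -> R b c -> R a c.

Lemma part_path i a t : a \in S i -> tagged_in t ->
  path R a (map snd t) -> path R a (part i t).
Proof.
elim: t a => [|[j b] t IH] a //= ai /andP[/= bj ot] /andP[ab pt].
rewrite part_cons; case: eqP => [E|/eqP nij] /=.
  by rewrite ab IH // -E.
apply: IH => //; case: t ot pt => [|[k c] t] //= /andP[/= ck _] /andP[bc ->].
rewrite andbT; apply: (Rtrans _ ai bj ck ab bc).
by rewrite eq_sym (negPf nij).
Qed.

Lemma part_sorted i t : tagged_in t -> sorted R (map snd t) -> sorted R (part i t).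
Proof.
elim: t => [|[j a] t IH] //= /andP[/= aj ot] pt; rewrite part_cons.
case: eqP => [E|_]; last exact: IH ot (path_sorted pt).
by rewrite E in aj; exact: part_path.
Qed.

Lemma path_part_head i a t b w : a \in S i -> tagged_in t ->
  path R a (map snd t) -> part (~~ i) t = b :: w -> R a b.
Proof.
elim: t a => [|[j c] t IH] a //= ai /andP[/= cj ot] /andP[ac pt].
rewrite part_cons; case: eqP => [E [<- _]//|/eqP nji E].
have ji : j = i by case: i j nji {ai cj IH E} => -[].
rewrite ji in cj; have := IH c cj ot pt E.
have : b \in S (~~ i).
  by have := part_in (~~ i) ot; rewrite E => /andP[].
by move=> bi; apply: (Rtrans _ ai cj bi ac); case: (i).
Qed.

Lemma shuffle_inj t t' :
    (forall i a b, a \in S i -> b \in S (~~ i) -> R a b -> R b a -> False) ->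
    tagged_in t -> tagged_in t' -> sorted R (map snd t) -> sorted R (map snd t') ->
  (forall i, part i t = part i t') -> t = t'.
Proof.
move=> Rasym; elim: t t' => [|[i a] t IH] [|[j b] t'].
- by [].
- by move=> _ _ _ _ /(_ j); rewrite part_cons eqxx.
- by move=> _ _ _ _ /(_ i); rewrite part_cons eqxx.
move=> /= /andP[/= ai ot] /andP[/= bj ot'] pt pt' E.
have [ij|nij] := eqVneq i j.
  rewrite {}ij in ai E *; have := E j; rewrite !part_cons eqxx => -[ab Ej].
  rewrite -{}ab in bj pt' E *; congr (_ :: _).
  apply: IH => //; try exact: path_sorted; first exact: path_sorted pt.
    exact: path_sorted pt'.
  move=> k; have := E k; rewrite !part_cons; case: ifP => [/eqP <- _|//].
  exact: Ej.
have ji : j = ~~ i by case: i j nij {ai bj E} => -[].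
have := E i; have := E j; rewrite !part_cons !eqxx (negPf nij) eq_sym (negPf nij) ji.
move=> Ej Ei; rewrite ji in bj; case: (Rasym i a b ai bj).
  exact: path_part_head ai ot pt Ej.
by apply: path_part_head bj ot' pt' _; rewrite negbK -Ei.
Qed.

Lemma sorted_part_head i j a t b w : tagged_in ((j, a) :: t) ->
  sorted R (a :: map snd t) -> part i ((j, a) :: t) = b :: w -> b = a \/ R a b.
Proof.
move=> /= /andP[/= aj ot] pt; rewrite part_cons.
case: eqP => [_ [->]|/eqP nji E]; [by left|right].
have ij : i = ~~ j by case: i j nji {aj E} => -[].
by rewrite ij in E; exact: path_part_head aj ot pt E.
Qed.

End CrossTransitive.

Lemma part_rev i t : part i (rev t) = rev (part i t).
Proof. by rewrite /part filter_rev map_rev. Qed.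

Lemma sorted_part_last (R : rel L) i j a t b w :
    (forall i j k a b c, ~~ ((i == j) && (j == k)) ->
       a \in S i -> b \in S j -> c \in S k -> R a b -> R b c -> R a c) ->
  tagged_in (rcons t (j, a)) -> sorted R (rcons (map snd t) a) ->
  part i (rcons t (j, a)) = rcons w b -> b = a \/ R b a.
Proof.
move=> Rtrans ot st E.
apply: (@sorted_part_head (fun x y => R y x) _ i j a (rev t) b (rev w)).
- move=> i' j' k' x y z n xi yj zk xy yz; apply: (Rtrans k' j' i' z y x) => //.
  by case: i' j' k' n {xi yj zk} => -[] [].
- by rewrite /tagged_in -rev_rcons all_rev.
- by rewrite map_rev -rev_rcons rev_sorted.
- by rewrite -!rev_rcons part_rev E.
Qed.

Hypothesis Scmp : forall i, {in S i & S (~~ i), forall a b, a >=< b}.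

Lemma shuffle_le_trans i j k a b c : ~~ ((i == j) && (j == k)) ->
  a \in S i -> b \in S j -> c \in S k -> a <= b -> b <= c -> a <= c.
Proof. by move=> _ _ _ _; exact: le_trans. Qed.

Lemma shuffle_nle_trans i j k a b c : ~~ ((i == j) && (j == k)) ->
  a \in S i -> b \in S j -> c \in S k -> ~~ (a <= b) -> ~~ (b <= c) -> ~~ (a <= c).
Proof.
move=> nijk ai bj ck nab nbc; apply/negP=> ac.
have [ij|nij] := eqVneq i j; last first.
  have ji : j = ~~ i by case: i j nij {ai bj nijk} => -[].
  rewrite ji in bj; have /orP[ab|ba] := Scmp ai bj; first by rewrite ab in nab.
  by rewrite (le_trans ba ac) in nbc.
have nik : k = ~~ j by case: i j k ij nijk {ai bj ck} => -[] [].
rewrite nik in ck.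
have /orP[bc|cb] := Scmp bj ck; first by rewrite bc in nbc.
by rewrite (le_trans ac cb) in nab.
Qed.

Lemma shuffle_le_asym i a b : a \in S i -> b \in S (~~ i) -> a <= b -> b <= a -> False.
Proof.
move=> ai bi ab ba; have E : a = b by apply: le_anti; rewrite ab.
by rewrite -E in bi; apply: Sdisj ai bi.
Qed.

Lemma shuffle_nle_asym i a b : a \in S i -> b \in S (~~ i) ->
  ~~ (a <= b) -> ~~ (b <= a) -> False.
Proof. by move=> ai bi /negPf nab /negPf nba; have := Scmp ai bi; rewrite /Order.comparable nab nba. Qed.

Lemma merge_exists (w : bool -> seq L) :
    (forall i, all (mem (S i)) (w i)) -> (forall i, sorted <=%O (w i)) ->
  exists t, [/\ tagged_in t, sorted <=%O (map snd t) & forall i, part i t = w i].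
Proof.
have [n] := ubnP (size (w true) + size (w false)).
elim: n w => // n IH w; rewrite ltnS => Hn wS ws.
have step i a u b v : w i = a :: u -> w (~~ i) = b :: v -> a <= b ->
    exists t, [/\ tagged_in t, sorted <=%O (map snd t) & forall i, part i t = w i].
  move=> Ei Ej ab.
  have wi := wS i; have si := ws i; rewrite Ei /= in wi si.
  case/andP: wi => ai ui; have su := path_sorted si.
  pose w' j := if j == i then u else w j.
  have [||j|t [ot st pt]] := IH w'.
  - apply: leq_trans Hn; rewrite /w'.
    by case: (i) Ei => /= ->; rewrite /= ?addSn ?addnS.
  - by move=> k; rewrite /w'; case: eqP => [->|].
  - by rewrite /w'; case: eqP.
  exists ((i, a) :: t); split.
  - by rewrite /= ai.
  - rewrite /=; case: t ot st pt => [//|[j c] t] _ st /(_ j).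
    rewrite part_cons eqxx /w' /= in st * => H; rewrite st andbT.
    case: (eqVneq j i) H => [_ H|nij H]; first by move: si; rewrite -H => /andP[].
    have ji : j = ~~ i by case: i j nij {ai ui Ei Ej w' H} => -[].
    by move: H; rewrite ji Ej => -[->].
  - move=> j; rewrite part_cons pt /w' eq_sym.
    by case: eqP => [->|//]; rewrite Ei.
case E1: (w true) => [|a u].
  exists [seq (false, x) | x <- w false]; split.
  - by rewrite /tagged_in all_map; apply: wS.
  - by rewrite -map_comp map_id ws.
  - case; rewrite /part filter_map -map_comp.
      by rewrite (@eq_filter _ _ pred0) ?filter_pred0 ?E1.
    by rewrite (@eq_filter _ _ predT) ?filter_predT ?map_id.
case E2: (w false) => [|b v].
  exists [seq (true, x) | x <- w true]; split.
  - by rewrite /tagged_in all_map; apply: wS.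
  - by rewrite -map_comp map_id ws.
  - case; rewrite /part filter_map -map_comp; last first.
      by rewrite (@eq_filter _ _ pred0) ?filter_pred0 ?E2.
    by rewrite (@eq_filter _ _ predT) ?filter_predT ?map_id.
have /andP[aT _] : all (mem (S true)) (a :: u) by rewrite -E1.
have /andP[bF _] : all (mem (S false)) (b :: v) by rewrite -E2.
have /orP[ab|ba] := @Scmp true a b aT bF.
  exact: step E1 E2 ab.
exact: step E2 E1 ba.
Qed.

Lemma merge_lexi_le t t' : tagged_in t -> tagged_in t' -> sorted <=%O (map snd t) ->
    (forall i, size (part i t) = size (part i t')) ->
    (forall i, (part i t : seqlexi L) <= (part i t' : seqlexi L)) ->
  (map snd t : seqlexi L) <= (map snd t' : seqlexi L).
Proof.
elim: t t' => [|[i a] t IH] [|[j b] t'].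
- by [].
- by [].
- by move=> _ _ _ /(_ i); rewrite part_cons eqxx.
move=> /= /andP[/= ai ot] /andP[/= bj ot'] pt sz H.
have [ij|nij] := eqVneq i j.
  rewrite {}ij in ai sz H *.
  have := H j; rewrite !part_cons eqxx !lexi_cons => /andP[ab Hj].
  rewrite ab; apply/implyP=> ba; apply: IH => //; first exact: path_sorted pt.
    move=> k; have := sz k; rewrite !part_cons.
    by case: ifP => [/eqP <- []|].
  move=> k; have := H k; rewrite !part_cons; case: ifP => [/eqP <- _|//].
  exact: implyP Hj ba.
have ji : j = ~~ i by case: i j nij {ai bj sz H} => -[].
have := H j; have := sz j; rewrite !part_cons eqxx (negPf nij).
case E: (part j t) => [//|c w] _; rewrite lexi_cons => /andP[cb _].
rewrite ji in E bj.
have ac := path_part_head shuffle_le_trans ai ot pt E.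
rewrite lexi_cons (le_trans ac cb); apply/implyP => ba.
by case: (shuffle_le_asym ai bj (le_trans ac cb) ba).
Qed.

End Shuffles.

(** * Subposets of a product and the complexes Delta *)

Section FullChains.
Context {d : Order.disp_t} {P : finTBPOrderType d}.
Implicit Types (A c e : {set P}).

Lemma maxchain_eq A c e : maxchain A c -> c \subset e -> chain e -> e \subset A ->
  e = c.
Proof. by case/maxsetP=> _ H ce ee eA; apply: H => //; rewrite ee. Qed.

Lemma full_maxchain A k c : has_rank [set: P] k -> has_rank A k ->
  maxchain A c -> maxchain [set: P] c.
Proof.
move=> rP rA mc; have [cc _ _] := maxchainP _ _ mc.
have [e me ce] := chain_maxchain cc (subsetT c).
by rewrite (_ : c = e) //; apply/eqP; rewrite eqEcard ce (rA c mc) (rP e me) /=.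
Qed.

Lemma maxchain_sub A c : maxchain [set: P] c -> c \subset A -> maxchain A c.
Proof.
case/maxchainP=> cc _ H cA; apply/maxchainP; split=> // z _; exact: H.
Qed.

Lemma maxchain_bot_top c : maxchain [set: P] c -> (\bot \in c) && (\top \in c).
Proof.
case/maxchainP=> _ _ H; rewrite !H // => x _.
  by rewrite /Order.comparable lex1.
by rewrite /Order.comparable le0x orbT.
Qed.

Lemma maxchain_gap c x y : maxchain [set: P] c -> x \in c -> y \in c ->
  x < y -> ~~ covers x y -> exists z, [/\ z \in c, x < z & z < y].
Proof.
move=> /maxchainP[/chainP cc _ H] xc yc xy ncov.
have [/exists_inP[z zc /andP[xz zy]]|] := boolP [exists z in c, x < z < y].
  by exists z.
move=> /exists_inPn none; case/negP: ncov; apply/coversP; split=> // z xz zy.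
have /none : z \in c; last by rewrite xz zy.
apply: H => // w wc; rewrite /Order.comparable.
have /orP[wx|xw] := cc w x wc xc; first by rewrite (le_trans wx (ltW xz)).
have /orP[wy|yw] := cc w y wc yc; last by rewrite (le_trans (ltW zy) yw) orbT.
have [<-|nx] := eqVneq x w; first by rewrite (ltW xz).
have [->|ny] := eqVneq w y; first by rewrite (ltW zy) orbT.
by have := none w wc; rewrite !lt_neqAle nx xw ny wy.
Qed.

End FullChains.

Section ProjectedPaths.
Context {d dQ : Order.disp_t} {P : finTBPOrderType d} {Q : finTBPOrderType dQ}.
Variable f : Q -> P.
Implicit Types (u v : Q) (s : seq Q) (c r : {set Q}).

Fixpoint proj u s : seq P :=
  if s is v :: s' then
    if f u == f v then proj v s' else f v :: proj v s'
  else [::].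

Lemma last_proj u s : last (f u) (proj u s) = f (last u s).
Proof. by elim: s u => //= v s IH u; case: eqP => [->|_] /=. Qed.

Lemma proj_cat u s t : proj u (s ++ t) = proj u s ++ proj (last u s) t.
Proof. by elim: s u => //= v s IH u; case: eqP => _; rewrite IH. Qed.

Lemma imset_proj u s : f @: [set z in u :: s] = [set z in f u :: proj u s].
Proof.
elim: s u => [|v s IH] u.
  have -> : [set z in [:: u]] = [set u] by apply/setP=> z; rewrite !inE.
  by rewrite imset_set1; apply/setP=> z; rewrite !inE.
have -> : [set z in u :: v :: s] = u |: [set z in v :: s].
  by apply/setP=> z; rewrite !inE.
rewrite imsetU1 IH; apply/setP=> z /=; rewrite !inE.
by case: (f u =P f v) => [->|_]; rewrite ?inE // orbA orbb.
Qed.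

Hypothesis f_covers : forall u v, covers u v -> f u = f v \/ covers (f u) (f v).

Lemma proj_saturated u v s : saturated u v s -> saturated (f u) (f v) (proj u s).
Proof.
move=> /andP[ps /eqP <-]; rewrite /saturated last_proj eqxx andbT.
elim: s u ps => //= w s IH u /andP[uw /IH ps].
case: eqP => [->//|n] /=; rewrite ps andbT.
by have [] := f_covers uw.
Qed.

Lemma maxchain_imset u v c : u <= v -> maxchain (itv u v) c ->
  maxchain (itv (f u) (f v)) (f @: c).
Proof.
move=> uv /(maxchain_saturated uv)[s ss ->]; rewrite imset_proj.
exact: saturated_maxchain (proj_saturated ss).
Qed.

Hypotheses (f_bot : f \bot = \bot) (f_top : f \top = \top).

Lemma root_imset u r : is_root u r -> is_root (f u) (f @: r).
Proof. by move=> /(maxchain_imset (le0x u)); rewrite f_bot. Qed.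

Lemma maxchain_imsetT c : maxchain [set: Q] c -> maxchain [set: P] (f @: c).
Proof. by rewrite -!itv_bot_top => /(maxchain_imset (le0x _)); rewrite f_bot f_top. Qed.

End ProjectedPaths.

Section Delta.
Context {d dI : Order.disp_t} {P : finTBPOrderType d} {I : finOrderType dI}.
Variables (k : nat) (Sigma : I -> {set P}).
Hypotheses (rkP : has_rank [set: P] k) (rkS : forall s, has_rank (Sigma s) k).

Lemma card_Delta2 s t c : t < s -> c \in Delta Sigma s -> c \in Delta Sigma t ->
  (#|c| <= k)%N.
Proof.
rewrite !inE => ts /exists_inP[e /andP[me /forallP nw] ce].
move=> /exists_inP[e' /andP[me' _] ce'].
have := subset_leq_card ce; rewrite (rkS me) leq_eqVlt => /orP[/eqP E|//].
have ec : c = e by apply/eqP; rewrite eqEcard ce (rkS me) E leqnn.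
have /implyP/(_ ts)/negP[] := nw t; rewrite -ec.
by apply: subset_trans ce' _; case/maxchainP: me'.
Qed.

End Delta.

Section AbstractProduct.
Context {d1 d2 dQ e1 e2 : Order.disp_t} {P1 : finTBPOrderType d1}
  {P2 : finTBPOrderType d2} {Q : finTBPOrderType dQ}
  {I1 : finOrderType e1} {I2 : finOrderType e2}.
Variables (f1 : Q -> P1) (f2 : Q -> P2).
Hypothesis f_le : forall u v, (u <= v) = (f1 u <= f1 v) && (f2 u <= f2 v).
Hypotheses (f1_bot : f1 \bot = \bot) (f2_bot : f2 \bot = \bot).
Hypotheses (f1_top : f1 \top = \top) (f2_top : f2 \top = \top).
Hypothesis f1_cov : forall u v, covers u v -> f1 u = f1 v \/ covers (f1 u) (f1 v).
Hypothesis f2_cov : forall u v, covers u v -> f2 u = f2 v \/ covers (f2 u) (f2 v).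
Hypothesis f_dense : forall c1 c2 u v,
  maxchain [set: P1] c1 -> maxchain [set: P2] c2 ->
  f1 u \in c1 -> f2 u \in c2 -> f1 v \in c1 -> f2 v \in c2 ->
  u < v -> ~~ covers u v -> exists z, [/\ u < z, z < v, f1 z \in c1 & f2 z \in c2].

Lemma lift_maxchains c1 c2 c :
    maxchain [set: P1] c1 -> maxchain [set: P2] c2 -> chain c ->
    f1 @: c \subset c1 -> f2 @: c \subset c2 ->
  exists e, [/\ maxchain [set: Q] e, c \subset e, f1 @: e = c1 & f2 @: e = c2].
Proof.
move=> m1 m2 cc s1 s2; pose A := [set u : Q | (f1 u \in c1) && (f2 u \in c2)].
have cA : c \subset A.
  apply/subsetP=> u uc; rewrite inE (subsetP s1) ?imset_f //.
  by rewrite (subsetP s2) ?imset_f.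
have [e me ce] := chain_maxchain cc cA.
have /maxchainP[/chainP ec /subsetP eA em] := me.
have eP u : u \in e -> (f1 u \in c1) /\ (f2 u \in c2).
  by move=> /eA; rewrite inE => /andP.
have /andP[b1 t1] := maxchain_bot_top m1; have /andP[b2 t2] := maxchain_bot_top m2.
have be : \bot \in e.
  apply: em; first by rewrite inE f1_bot f2_bot b1 b2.
  by move=> x _; rewrite /Order.comparable le0x orbT.
have te : \top \in e.
  apply: em; first by rewrite inE f1_top f2_top t1 t2.
  by move=> x _; rewrite /Order.comparable lex1.
have mT : maxchain [set: Q] e.
  apply/maxchainP; split=> //; first exact/chainP.
  move=> z _ zc; apply/negPn/negP => ze.
  have cmp w : w \in e -> w < z \/ z < w.
    move=> we; have nwz : w != z by apply: contraNneq ze => <-.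
    have := zc w we; rewrite /Order.comparable !le_eqVlt (negPf nwz) eq_sym.
    by rewrite (negPf nwz) => /orP.
  pose ok (p : Q * Q) := [&& p.1 \in e, p.2 \in e & p.1 < z < p.2].
  have ok0 : ok (\bot, \top).
    rewrite /ok /= be te /=; have [->|] := cmp _ be; last by rewrite ltx0.
    by have [|->] := cmp _ te; first by rewrite lt1x.
  case: (@arg_minnP _ (\bot, \top) ok (fun p => #|itv p.1 p.2|) ok0) => -[u v].
  rewrite /ok /= => /and3P[ue ve /andP[uz zv]] min.
  have [u1 u2] := eP u ue; have [v1 v2] := eP v ve.
  have none w : w \in e -> u < w -> w < v -> False.
    move=> we uw wv; have [wz|zw] := cmp w we.
      have := min (w, v); rewrite /= we ve wz zv => /(_ isT).
      rewrite leqNgt => /negP[]; apply: proper_card; apply/properP; split.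
        apply/subsetP=> y; rewrite !inE => /andP[wy ->].
        by rewrite (le_trans (ltW uw)).
      exists u; rewrite !inE ?lexx ?(ltW (lt_trans uw wv)) //.
      by rewrite lt_geF.
    have := min (u, w); rewrite /= we ue zw uz => /(_ isT).
    rewrite leqNgt => /negP[]; apply: proper_card; apply/properP; split.
      apply/subsetP=> y; rewrite !inE => /andP[-> yw].
      by rewrite (le_trans yw (ltW wv)).
    exists v; rewrite !inE ?lexx ?(ltW (lt_trans uw wv)) //.
    by rewrite lt_geF // andbF.
  have ncov : ~~ covers u v.
    by apply/negP => /coversP[_ /(_ z uz zv)].
  have [w [uw wv w1 w2]] := f_dense m1 m2 u1 u2 v1 v2 (lt_trans uz zv) ncov.
  apply: (none w _ uw wv); apply: em => [|y ye]; first by rewrite inE w1 w2.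
  rewrite /Order.comparable.
  have /orP[yu|uy] := ec y u ye ue; first by rewrite (le_trans yu (ltW uw)).
  have /orP[yv|vy] := ec y v ye ve; last by rewrite (le_trans (ltW wv) vy) orbT.
  have [<-|nu] := eqVneq u y; first by rewrite (ltW uw).
  have [->|nv] := eqVneq y v; first by rewrite (ltW wv) orbT.
  by case: (none y ye); rewrite lt_neqAle ?nu ?nv.
exists e; split=> //; apply/esym.
  apply: maxchain_eq (maxchain_imsetT f1_cov f1_bot f1_top mT) _ _ (subsetT _).
    by apply/subsetP=> _ /imsetP[u /eP[? ?] ->].
  by case/maxchainP: m1.
apply: maxchain_eq (maxchain_imsetT f2_cov f2_bot f2_top mT) _ _ (subsetT _).
  by apply/subsetP=> _ /imsetP[u /eP[? ?] ->].
by case/maxchainP: m2.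
Qed.

Lemma chain_imset1 c : chain c -> chain (f1 @: c).
Proof.
move=> /chainP cc; apply/chainP => _ _ /imsetP[u uc ->] /imsetP[v vc ->].
by have := cc u v uc vc; rewrite /Order.comparable !f_le => /orP[] /andP[-> _];
  rewrite ?orbT.
Qed.

Lemma chain_imset2 c : chain c -> chain (f2 @: c).
Proof.
move=> /chainP cc; apply/chainP => _ _ /imsetP[u uc ->] /imsetP[v vc ->].
by have := cc u v uc vc; rewrite /Order.comparable !f_le => /orP[] /andP[_ ->];
  rewrite ?orbT.
Qed.

Variables (k1 k2 k : nat) (Sigma1 : I1 -> {set P1}) (Sigma2 : I2 -> {set P2}).
Hypotheses (rk1 : has_rank [set: P1] k1) (rk2 : has_rank [set: P2] k2).
Hypotheses (rkS1 : forall s, has_rank (Sigma1 s) k1)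
           (rkS2 : forall s, has_rank (Sigma2 s) k2).
Hypothesis rkQ : has_rank [set: Q] k.
Variable Sigma : I1 *l I2 -> {set Q}.
Hypothesis SigmaE : forall st u,
  (u \in Sigma st) = (f1 u \in Sigma1 st.1) && (f2 u \in Sigma2 st.2).

Implicit Types (st : I1 *l I2) (c : {set Q}).

Lemma sub_Sigma st c :
  (c \subset Sigma st) = (f1 @: c \subset Sigma1 st.1) && (f2 @: c \subset Sigma2 st.2).
Proof.
apply/subsetP/andP => [H|[/subsetP H1 /subsetP H2] u uc].
  by split; apply/subsetP=> _ /imsetP[u /H + ->]; rewrite SigmaE => /andP[].
by rewrite SigmaE H1 ?H2 ?imset_f.
Qed.

Lemma maxchain_SigmaT st c : maxchain (Sigma st) c -> maxchain [set: Q] c.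
Proof.
move=> mc; have [cc + _] := maxchainP _ _ mc; rewrite sub_Sigma => /andP[s1 s2].
have [c1 m1 cs1] := chain_maxchain (chain_imset1 cc) s1.
have [c2 m2 cs2] := chain_maxchain (chain_imset2 cc) s2.
have [e [me ce E1 E2]] := lift_maxchains (full_maxchain rk1 (@rkS1 st.1) m1)
  (full_maxchain rk2 (@rkS2 st.2) m2) cc cs1 cs2.
rewrite -(maxchain_eq mc ce) //; first by case/maxchainP: me.
by rewrite sub_Sigma E1 E2; case/maxchainP: m1 => _ -> _; case/maxchainP: m2.
Qed.

Lemma rank_Sigma st : has_rank (Sigma st) k.
Proof. by move=> c /maxchain_SigmaT/rkQ. Qed.

Lemma Delta_imset st c : c \in Delta Sigma st ->
  (f1 @: c \in Delta Sigma1 st.1) /\ (f2 @: c \in Delta Sigma2 st.2).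
Proof.
rewrite inE => /exists_inP[e /andP[me /forallP new] ce].
have mT := maxchain_SigmaT me.
have [_ + _] := maxchainP _ _ me; rewrite sub_Sigma => /andP[s1 s2].
split; rewrite inE; apply/exists_inP.
  exists (f1 @: e); last exact: imsetS.
  rewrite /new_maxchain maxchain_sub //=; last exact: maxchain_imsetT.
  apply/forallP => t; apply/implyP => ts; apply/negP => H.
  have := new (t, st.2); rewrite sub_Sigma H s2 /= implybF => /negP[].
  by rewrite ltEprodlexi /= (ltW ts) lt_geF.
exists (f2 @: e); last exact: imsetS.
rewrite /new_maxchain maxchain_sub //=; last exact: maxchain_imsetT.
apply/forallP => t; apply/implyP => ts; apply/negP => H.
have := new (st.1, t); rewrite sub_Sigma H s1 /= implybF => /negP[].
by rewrite ltEprodlexi /= lexx.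
Qed.

Hypothesis bdry1 : forall s t (c : {set P1}), t < s -> (#|c| <= k1)%N ->
  c \in Delta Sigma1 s -> c \in Delta Sigma1 t ->
  exists e, [/\ maxchain (Sigma1 s) e, c \subset e & e \notin Delta Sigma1 s].
Hypothesis bdry2 : forall s t (c : {set P2}), t < s -> (#|c| <= k2)%N ->
  c \in Delta Sigma2 s -> c \in Delta Sigma2 t ->
  exists e, [/\ maxchain (Sigma2 s) e, c \subset e & e \notin Delta Sigma2 s].

Lemma bdry_product st st' c : st' < st ->
  c \in Delta Sigma st -> c \in Delta Sigma st' ->
  exists e, [/\ maxchain (Sigma st) e, c \subset e & e \notin Delta Sigma st].
Proof.
move=> lt_st Dc Dc'.
have [D1 D2] := Delta_imset Dc; have [D1' D2'] := Delta_imset Dc'.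
have cc : chain c.
  move: Dc; rewrite inE => /exists_inP[e /andP[/maxchainP[ee _ _] _] ce].
  exact: chain_subset ce ee.
suff [c1 [c2 [[m1 m2 s1 s2] nD]]] : exists (c1 : {set P1}) (c2 : {set P2}),
    [/\ maxchain (Sigma1 st.1) c1, maxchain (Sigma2 st.2) c2,
        f1 @: c \subset c1 & f2 @: c \subset c2]
    /\ ~~ ((c1 \in Delta Sigma1 st.1) && (c2 \in Delta Sigma2 st.2)).
  have [e [me ce E1 E2]] := lift_maxchains (full_maxchain rk1 (@rkS1 st.1) m1)
    (full_maxchain rk2 (@rkS2 st.2) m2) cc s1 s2.
  exists e; split=> //.
    apply: maxchain_sub me _; rewrite sub_Sigma E1 E2.
    by case/maxchainP: m1 => _ -> _; case/maxchainP: m2.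
  by apply: contra nD => /Delta_imset; rewrite E1 E2 => -[-> ->].
have ext (d : Order.disp_t) (I : finOrderType d) (dP : Order.disp_t)
    (P : finTBPOrderType dP) (S : I -> {set P}) s a : a \in Delta S s ->
    exists2 e, maxchain (S s) e & a \subset e.
  by rewrite inE => /exists_inP[e /andP[me _] ae]; exists e.
move: lt_st; rewrite ltEprodlexi => /andP[le1 lt2].
have [lt1|nlt1] := boolP (st'.1 < st.1).
  have [c1 [m1 s1 n1]] := bdry1 lt1 (card_Delta2 (@rkS1) lt1 D1 D1') D1 D1'.
  have [c2 m2 s2] := ext _ _ _ _ _ _ _ D2; exists c1, c2; split=> //.
  by rewrite (negPf n1).
have E1 : st.1 <= st'.1 by rewrite leNgt.
have {}lt2 := implyP lt2 E1.
have [c2 [m2 s2 n2]] := bdry2 lt2 (card_Delta2 (@rkS2) lt2 D2 D2') D2 D2'.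
have [c1 m1 s1] := ext _ _ _ _ _ _ _ D1.
by exists c1, c2; split=> //; rewrite (negPf n2) andbF.
Qed.

Hypothesis union1 : forall c : {set P1}, chain c -> exists s, c \subset Sigma1 s.
Hypothesis union2 : forall c : {set P2}, chain c -> exists s, c \subset Sigma2 s.

Lemma union_product c : chain c -> exists st, c \subset Sigma st.
Proof.
move=> cc; have [s Hs] := union1 (chain_imset1 cc).
have [t Ht] := union2 (chain_imset2 cc).
by exists (s, t); rewrite sub_Sigma Hs Ht.
Qed.

End AbstractProduct.

(** * Face lattices of polytopes *)

Section Exposed.
Import boolp GRing.Theory Num.Theory.
Local Open Scope ring_scope.
Variable R : realType.

Definition dot n (a x : 'rV[R]_n) : R := \sum_j a 0 j * x 0 j.

Lemma dotDr n (a x y : 'rV[R]_n) : dot a (x + y) = dot a x + dot a y.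
Proof. by rewrite -big_split; apply: eq_bigr => j _; rewrite mxE mulrDr. Qed.

Lemma dotZr n (a x : 'rV[R]_n) c : dot a (c *: x) = c * dot a x.
Proof. by rewrite mulr_sumr; apply: eq_bigr => j _; rewrite mxE mulrCA. Qed.

Lemma dotZl n (a x : 'rV[R]_n) c : dot (c *: a) x = c * dot a x.
Proof. by rewrite mulr_sumr; apply: eq_bigr => j _; rewrite mxE mulrA. Qed.

Lemma dot0r n (a : 'rV[R]_n) : dot a 0 = 0.
Proof. by rewrite /dot big1 // => j _; rewrite mxE mulr0. Qed.

Lemma dot0l n (x : 'rV[R]_n) : dot 0 x = 0.
Proof. by rewrite /dot big1 // => j _; rewrite mxE mul0r. Qed.

Lemma dot_sumr n (a : 'rV[R]_n) (T : finType) (F : T -> 'rV[R]_n) :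
  dot a (\sum_i F i) = \sum_i dot a (F i).
Proof.
by elim/big_rec2: _ => [|i y x _ <-]; rewrite ?dot0r ?dotDr.
Qed.

Lemma dot_row_mx n1 n2 (a : 'rV[R]_n1) (b : 'rV[R]_n2) x y :
  dot (row_mx a b) (row_mx x y) = dot a x + dot b y.
Proof.
rewrite /dot big_split_ord /=.
by congr (_ + _); apply: eq_bigr => j _; rewrite ?row_mxEl ?row_mxEr.
Qed.

Section Points.
Variables (n : nat) (T : finType) (v : T -> 'rV[R]_n).
Implicit Type J : {set T}.

Definition exposed J : Prop :=
  exists a b, (forall i, dot a (v i) <= b) /\ J = [set i | dot a (v i) == b].

Lemma exposed0 : exposed set0.
Proof.
exists 0, 1; split=> [i|]; first by rewrite dot0l ler01.
by apply/setP=> i; rewrite !inE dot0l eq_sym oner_eq0.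
Qed.

Lemma exposedT : exposed setT.
Proof.
exists 0, 0; split=> [i|]; first by rewrite dot0l.
by apply/setP=> i; rewrite !inE dot0l eqxx.
Qed.

Definition hull_on J : set 'rV[R]_n := [set x | exists w : T -> R,
  [/\ forall i, 0 <= w i, \sum_i w i = 1, x = \sum_i w i *: v i
    & forall i, i \notin J -> w i = 0]]%classic.

Lemma hull_on_sub J J' : J \subset J' -> (hull_on J `<=` hull_on J')%classic.
Proof.
move=> /subsetP sJ x [w [w0 w1 -> wJ]]; exists w; split=> // i nJ.
by apply: wJ; apply: contra nJ => /sJ.
Qed.

Lemma hull_on_vertex i J : i \in J -> hull_on J (v i).
Proof.
move=> iJ; exists (fun j => (j == i)%:R); split.
- by move=> j; rewrite ler0n.
- by rewrite (bigD1 i) //= eqxx big1 ?addr0 // => j /negPf->.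
- rewrite (bigD1 i) //= eqxx scale1r big1 ?addr0 // => j /negPf->.
  by rewrite scale0r.
- by move=> j; have [->|] := eqVneq j i; rewrite ?iJ.
Qed.

Lemma hull_dot_le a b x : (forall i, dot a (v i) <= b) -> hull_on setT x ->
  dot a x <= b.
Proof.
move=> H [w [w0 w1 -> _]]; rewrite dot_sumr -[b]mul1r -w1 mulr_suml.
by apply: ler_sum => i _; rewrite dotZr ler_wpM2l.
Qed.

Lemma hull_onE a b : (forall i, dot a (v i) <= b) ->
  hull_on [set i | dot a (v i) == b] = [set x | hull_on setT x /\ dot a x = b]%classic.
Proof.
move=> H; apply/seteqP; split=> x; last first.
  move=> [[w [w0 w1 -> _]] E]; exists w; split=> // i; rewrite inE => ni.
  have : \sum_i w i * (b - dot a (v i)) = 0.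
    under eq_bigr do rewrite mulrBr -dotZr.
    by rewrite sumrB -mulr_suml w1 mul1r -dot_sumr E subrr.
  have sb j : true -> 0 <= w j * (b - dot a (v j)) by rewrite mulr_ge0 ?subr_ge0.
  move=> /(psumr_eq0P sb)/(_ i isT)/eqP; rewrite mulf_eq0 subr_eq0 [b == _]eq_sym (negPf ni) orbF.
  by move/eqP.
move=> [w [w0 w1 -> wJ]]; split; first by exists w; split=> // i; rewrite inE.
rewrite dot_sumr -[b]mul1r -w1 mulr_suml; apply: eq_bigr => i _; rewrite dotZr.
have [|/wJ->] := boolP (i \in [set i | dot a (v i) == b]); last by rewrite !mul0r.
by rewrite inE => /eqP->.
Qed.

End Points.

Lemma conv_hullE n m (v : 'I_m -> 'rV[R]_n) : conv_hull v = hull_on v setT.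
Proof.
apply/seteqP; split=> x.
  by move=> [w [w0 w1 ->]]; exists w; split=> // i; rewrite inE.
by move=> [w [w0 w1 -> _]]; exists w.
Qed.

Lemma is_faceP n m (v : 'I_m -> 'rV[R]_n) F :
  is_face (conv_hull v) F <-> exists2 J, exposed v J & F = hull_on v J.
Proof.
rewrite conv_hullE; split.
  move=> [a [b [H ->]]]; have Hv i : dot a (v i) <= b.
    by apply: H; apply: hull_on_vertex; rewrite inE.
  exists [set i | dot a (v i) == b]; first by exists a, b.
  by rewrite hull_onE.
move=> [J [a [b [H ->]]] ->]; exists a, b; split; last by rewrite hull_onE.
by move=> x; apply: hull_dot_le.
Qed.

Lemma hull_on_vertexP n (T : finType) (v : T -> 'rV[R]_n) J i :
  exposed v J -> hull_on v J (v i) -> i \in J.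
Proof. by move=> [a [b [H ->]]]; rewrite hull_onE // inE => -[_ ->]. Qed.

Lemma exposed_reindex n (T U : finType) (v : T -> 'rV[R]_n) (h : U -> T) J :
  exposed v J -> exposed (v \o h) (h @^-1: J).
Proof.
move=> [a [b [H ->]]]; exists a, b; split=> [i|]; first exact: H.
by apply/setP=> i; rewrite !inE.
Qed.

End Exposed.

(* A face is determined by the set of the given points that it contains. *)
Section PolytopeLattices.
Import boolp GRing.Theory Num.Theory.
Local Open Scope order_scope.
Context {d : Order.disp_t} {P : finTBPOrderType d} (R : realType).
Implicit Types (A : {set P}).

Definition exposed_lattice A n (T : finType) (v : T -> 'rV[R]_n) (J : P -> {set T}) :=
  [/\ forall x, x \in A -> exposed v (J x),
      forall K, exposed v K -> exists2 x, x \in A & J x = K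
    & {in A &, forall x y, (x <= y) = (J x \subset J y)}].

Lemma polytope_exposed A : is_polytope_face_lattice R A ->
  exists n m (v : 'I_m -> 'rV[R]_n) J, exposed_lattice A v J.
Proof.
move=> [n [m [v [f [fA Af fle]]]]].
pose J x := [set i | `[< f x (v i) >]].
have fJ x : x \in A -> exposed v (J x) /\ f x = hull_on v (J x).
  move=> /fA /is_faceP[K eK E]; suff -> : J x = K by [].
  apply/setP=> i; rewrite inE E; apply/asboolP/idP; first exact: hull_on_vertexP.
  exact: hull_on_vertex.
exists n, m, v, J; split.
- by move=> x /fJ[].
- move=> K eK; have /Af[x xA E] : is_face (conv_hull v) (hull_on v K) by apply/is_faceP; exists K.
  exists x => //; apply/setP=> i; rewrite inE E; apply/asboolP/idP.
    exact: hull_on_vertexP.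
  exact: hull_on_vertex.
- move=> x y xA yA; have [ex Ex] := fJ x xA; have [ey Ey] := fJ y yA.
  apply/idP/idP=> [/fle H|H].
    apply/subsetP=> i ix; apply: (hull_on_vertexP ey); rewrite -Ey; apply: H => //.
    by rewrite Ex; apply: hull_on_vertex.
  by apply/fle => //; rewrite Ex Ey; apply: hull_on_sub.
Qed.

Lemma exposed_polytope A n (T : finType) (v : T -> 'rV[R]_n) J :
  exposed_lattice A v J -> is_polytope_face_lattice R A.
Proof.
move=> [H1 H2 H3].
pose w (i : 'I_#|T|) := v (enum_val i); pose K x := enum_val @^-1: J x : {set 'I_#|T|}.
have wK x : x \in A -> exposed w (K x) by move=> /H1; exact: exposed_reindex.
have Kle : {in A &, forall x y, (x <= y) = (K x \subset K y)}.
  move=> x y xA yA; rewrite H3 //; apply/subsetP/subsetP => H i.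
    by rewrite !inE; apply: H.
  by move=> ix; have := H (enum_rank i); rewrite !inE enum_rankK => ->.
exists n, #|T|, w, (fun x => hull_on w (K x)); split.
- by move=> x xA; apply/is_faceP; exists (K x) => //; apply: wK.
- move=> F /is_faceP[J' /(exposed_reindex enum_rank) eJ ->].
  have /H2[x xA E] : exposed v (enum_rank @^-1: J').
    by move: eJ; congr exposed; apply/funext=> i; rewrite /w /= enum_rankK.
  exists x => //; congr hull_on; apply/setP=> i; rewrite /K E !inE.
  by rewrite enum_valK.
- move=> x y xA yA; rewrite Kle //; split=> [|H]; first exact: hull_on_sub.
  apply/subsetP=> i ix; apply: (hull_on_vertexP (wK y yA)).
  by apply: H; apply: hull_on_vertex.
Qed.

End PolytopeLattices.

Section Centering.
Import boolp GRing.Theory Num.Theory.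
Local Open Scope ring_scope.
Variables (R : realType) (n : nat) (T : finType).

Lemma centered (v : T -> 'rV[R]_n) : exists v' : T -> 'rV[R]_n,
  \sum_i v' i = 0 /\ forall J, exposed v' J <-> exposed v J.
Proof.
pose o : 'rV[R]_n := (#|T|%:R)^-1 *: \sum_i v i.
have shift (w : T -> 'rV[R]_n) (c : 'rV[R]_n) J : exposed w J -> exposed (fun i => w i + c) J.
  move=> [a [b [H ->]]]; exists a, (b + dot a c); split=> [i|].
    by rewrite dotDr lerD2r.
  by apply/setP=> i; rewrite !inE dotDr (inj_eq (addIr _)).
exists (fun i => v i + - o); split=> [|J]; last first.
  split=> [/(shift _ o)|/(shift _ (- o))//]; congr exposed.
  by apply/funext=> i; rewrite subrK.
rewrite big_split /= sumr_const.
have [T0|T0] := eqVneq #|T| 0%N.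
  have E i : i \in T -> False by move=> iT; move: (card0_eq T0 i); rewrite iT.
  by rewrite T0 mulr0n addr0 big1 // => i _; case: (E i).
rewrite -scaler_nat scalerN /o scalerA divff ?scale1r ?subrr //.
by rewrite pnatr_eq0.
Qed.

End Centering.

Section ProductLattices.
Import boolp GRing.Theory Num.Theory.
Local Open Scope order_scope.
Context {R : realType} {d1 d2 dQ : Order.disp_t} {P1 : finTBPOrderType d1}
  {P2 : finTBPOrderType d2} {Q : finTBPOrderType dQ}.
Variables (f1 : Q -> P1) (f2 : Q -> P2).
Hypothesis f_le : forall u v, (u <= v) = (f1 u <= f1 v) && (f2 u <= f2 v).
Variables (A1 : {set P1}) (A2 : {set P2}) (A : {set Q}).
Hypothesis f_A : forall u, (u \in A) -> (f1 u \in A1) && (f2 u \in A2).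

Lemma exposed_bot (d : Order.disp_t) (P : finTBPOrderType d) (B : {set P})
  n (T : finType) (v : T -> 'rV[R]_n) J : exposed_lattice B v J ->
  forall x, x \in B -> \bot \in B -> (J x == set0) = (x == \bot).
Proof.
move=> [_ H2 H3] x xB bB; have [y yB E] := H2 _ (exposed0 v).
have b0 : J \bot = set0.
  by apply/eqP; rewrite -subset0 -E -H3 // le0x.
by rewrite -subset0 -b0 -H3 // lex0.
Qed.

Lemma exposed_top (d : Order.disp_t) (P : finTBPOrderType d) (B : {set P})
  n (T : finType) (v : T -> 'rV[R]_n) J : exposed_lattice B v J ->
  forall x, x \in B -> \top \in B -> (J x == setT) = (x == \top).
Proof.
move=> [_ H2 H3] x xB bB; have [y yB E] := H2 _ (exposedT v).
have b0 : J \top = setT.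
  by apply/eqP; rewrite -subTset -E -H3 // lex1.
by rewrite -subTset -b0 -H3 // le1x.
Qed.

Definition sum_set (T1 T2 : finType) (J1 : {set T1}) (J2 : {set T2}) : {set T1 + T2} :=
  [set t | match t with inl i => i \in J1 | inr j => j \in J2 end].

Lemma sum_set_sub (T1 T2 : finType) (J1 K1 : {set T1}) (J2 K2 : {set T2}) :
  (sum_set J1 J2 \subset sum_set K1 K2) = (J1 \subset K1) && (J2 \subset K2).
Proof.
apply/subsetP/andP => [H|[/subsetP H1 /subsetP H2] [i|j]].
- split; apply/subsetP=> i iJ; first by have := H (inl i); rewrite !inE; exact.
  by have := H (inr i); rewrite !inE; exact.
- by rewrite !inE => /H1.
- by rewrite !inE => /H2.
Qed.

Local Open Scope ring_scope.

(* The free join: the two polytopes are placed in skew affine subspaces. *)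
Lemma join_polytope :
  (forall x1 x2, x1 \in A1 -> x2 \in A2 ->
     exists2 u, u \in A & f1 u = x1 /\ f2 u = x2) ->
  is_polytope_face_lattice R A1 -> is_polytope_face_lattice R A2 ->
  is_polytope_face_lattice R A.
Proof.
move=> surj /polytope_exposed[n1 [m1 [v1 [J1 [a1 b1 c1]]]]].
move=> /polytope_exposed[n2 [m2 [v2 [J2 [a2 b2 c2]]]]].
pose v (t : 'I_m1 + 'I_m2) : 'rV[R]_(n1 + n2 + 1) := match t with
  inl i => row_mx (row_mx (v1 i) 0) 0
| inr j => row_mx (row_mx 0 (v2 j)) (const_mx 1) end.
apply: (@exposed_polytope _ _ _ _ _ _ v (fun u => sum_set (J1 (f1 u)) (J2 (f2 u)))).
split.
- move=> u /f_A /andP[/a1 [p1 [q1 [H1 E1]]] /a2 [p2 [q2 [H2 E2]]]].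
  exists (row_mx (row_mx p1 p2) (const_mx (q1 - q2))), q1.
  have dc : dot (const_mx (q1 - q2) : 'rV_1) (const_mx 1) = q1 - q2.
    by rewrite /dot big_ord1 !mxE mulr1.
  split=> [[i|j]|].
  + by rewrite /= !dot_row_mx !dot0r !addr0.
  + by rewrite /= !dot_row_mx !dot0r !add0r dc -lerBrDr opprB addrC subrK.
  + apply/setP=> -[i|j]; rewrite !inE /=.
      by rewrite !dot_row_mx !dot0r !addr0 E1 inE.
    rewrite !dot_row_mx !dot0r !add0r dc E2 inE.
    by rewrite -(inj_eq (addIr (q1 - q2))) [q2 + _]addrC subrK.
- move=> K [p [q [H E]]].
  pose p1 := lsubmx (lsubmx p); pose p2 := rsubmx (lsubmx p); pose p3 := rsubmx p.
  have Ep : p = row_mx (row_mx p1 p2) p3 by rewrite !hsubmxK.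
  pose c := dot p3 (const_mx 1).
  have dl i : dot p (v (inl i)) = dot p1 (v1 i).
    by rewrite Ep /= !dot_row_mx !dot0r !addr0.
  have dr j : dot p (v (inr j)) = dot p2 (v2 j) + c.
    by rewrite Ep /= !dot_row_mx !dot0r !add0r.
  have /b1[x1 x1A E1] : exposed v1 [set i | inl i \in K].
    exists p1, q; split=> [i|]; first by rewrite -dl.
    by apply/setP=> i; rewrite E !inE dl.
  have /b2[x2 x2A E2] : exposed v2 [set i | inr i \in K].
    exists p2, (q - c); split=> [i|]; first by rewrite lerBrDr -dr.
    by apply/setP=> i; rewrite E !inE dr eq_sym -subr_eq eq_sym.
  have [u uA [u1 u2]] := surj x1 x2 x1A x2A; exists u => //.
  by apply/setP=> -[i|j]; rewrite !inE ?u1 ?E1 ?u2 ?E2 inE.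
- move=> x y /f_A /andP[x1 x2] /f_A /andP[y1 y2].
  by rewrite sum_set_sub f_le c1 // c2.
Qed.

Lemma cartesian_polytope : \bot \in A1 -> \bot \in A2 ->
  (forall u, (f1 u == \bot) = (f2 u == \bot)) ->
  (forall x1 x2, x1 \in A1 -> x2 \in A2 -> (x1 == \bot) = (x2 == \bot) ->
     exists2 u, u \in A & f1 u = x1 /\ f2 u = x2) ->
  is_polytope_face_lattice R A1 -> is_polytope_face_lattice R A2 ->
  is_polytope_face_lattice R A.
Proof.
move=> bA1 bA2 fb surj /polytope_exposed[n1 [m1 [v1 [J1 L1]]]].
move=> /polytope_exposed[n2 [m2 [v2 [J2 L2]]]].
have [a1 b1 c1] := L1; have [a2 b2 c2] := L2.
pose v (t : 'I_m1 * 'I_m2) : 'rV[R]_(n1 + n2) := row_mx (v1 t.1) (v2 t.2).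
apply: (@exposed_polytope _ _ _ _ _ _ v (fun u => setX (J1 (f1 u)) (J2 (f2 u)))).
split.
- move=> u /f_A /andP[/a1 [p1 [q1 [H1 E1]]] /a2 [p2 [q2 [H2 E2]]]].
  exists (row_mx p1 p2), (q1 + q2); split=> [[i j]|].
    by rewrite /= dot_row_mx lerD.
  apply/setP=> -[i j]; rewrite !inE /= dot_row_mx E1 E2 !inE.
  apply/andP/eqP=> [[/eqP-> /eqP->]//|E].
  have := H1 i; rewrite le_eqVlt => /orP[/eqP Ei|lt]; last first.
    by have := ltr_leD lt (H2 j); rewrite E ltxx.
  by rewrite Ei eqxx; move: E; rewrite Ei => /addrI->.
- move=> K [p [q [H E]]]; have [->|/set0Pn[[i0 j0]]] := eqVneq K set0.
    have [u uA [u1 u2]] := surj \bot \bot bA1 bA2 (etrans (eqxx _) (esym (eqxx _))).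
    exists u => //; apply/setP=> -[i j]; rewrite !inE u1.
    have /eqP-> : J1 \bot == set0 by rewrite (exposed_bot L1).
    by rewrite inE.
  pose p1 := lsubmx p; pose p2 := rsubmx p.
  have dp i j : dot p (v (i, j)) = dot p1 (v1 i) + dot p2 (v2 j).
    by rewrite -[p]hsubmxK dot_row_mx.
  rewrite {1}E inE dp => /eqP E0.
  have H1 i : dot p1 (v1 i) <= dot p1 (v1 i0).
    by rewrite -(lerD2r (dot p2 (v2 j0))) E0 -dp.
  have H2 j : dot p2 (v2 j) <= dot p2 (v2 j0).
    by rewrite -(lerD2l (dot p1 (v1 i0))) E0 -dp.
  have /b1[x1 x1A E1] : exposed v1 [set i | dot p1 (v1 i) == dot p1 (v1 i0)].
    by exists p1, (dot p1 (v1 i0)).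
  have /b2[x2 x2A E2] : exposed v2 [set i | dot p2 (v2 i) == dot p2 (v2 j0)].
    by exists p2, (dot p2 (v2 j0)).
  have [|u uA [u1 u2]] := surj x1 x2 x1A x2A.
    rewrite -(exposed_bot L1) // -(exposed_bot L2) // E1 E2.
    have /set0Pn/negPf-> : exists i, i \in [set i | dot p1 (v1 i) == dot p1 (v1 i0)].
      by exists i0; rewrite inE.
    apply/esym/negbTE/set0Pn; by exists j0; rewrite inE.
  exists u => //; apply/setP=> -[i j]; rewrite u1 u2 E1 E2 E !inE dp /= -E0.
  apply/andP/eqP=> [[/eqP-> /eqP->]//|Ei].
  have := H1 i; rewrite le_eqVlt => /orP[/eqP Ei'|lt]; last first.
    by have := ltr_leD lt (H2 j); rewrite Ei ltxx.
  by rewrite Ei' eqxx; move: Ei; rewrite Ei' => /addrI->.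
- move=> x y xA yA; have /andP[x1 x2] := f_A xA; have /andP[y1 y2] := f_A yA.
  rewrite f_le c1 // c2 //; apply/andP/subsetP=> [[/subsetP s1 /subsetP s2] [i j]|H].
    by rewrite !inE => /andP[/s1-> /s2->].
  have [E1|/set0Pn[i0 Hi0]] := eqVneq (J1 (f1 x)) set0.
    rewrite E1 sub0set; split=> //.
    move/eqP: E1; rewrite (exposed_bot L1) // fb -(exposed_bot L2) // => /eqP->.
    exact: sub0set.
  have [E2|/set0Pn[j0 Hj0]] := eqVneq (J2 (f2 x)) set0.
    rewrite E2 sub0set; split=> //.
    move/eqP: E2; rewrite (exposed_bot L2) // -fb -(exposed_bot L1) // => /eqP->.
    exact: sub0set.
  split; apply/subsetP=> i iJ.
    by have := H (i, j0); rewrite !inE iJ Hj0 => /(_ isT)/andP[].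
  by have := H (i0, i); rewrite !inE iJ Hi0 => /(_ isT)/andP[].
Qed.

(* The free sum, with both polytopes translated so that the barycentre of
   their vertices, a relative interior point, is the origin. *)
Lemma free_sum_polytope : \top \in A1 -> \top \in A2 ->
  \bot \in A1 -> \bot \in A2 -> \bot != \top :> P1 -> \bot != \top :> P2 ->
  (forall u, (f1 u == \top) = (f2 u == \top)) ->
  (forall x1 x2, x1 \in A1 -> x2 \in A2 -> (x1 == \top) = (x2 == \top) ->
     exists2 u, u \in A & f1 u = x1 /\ f2 u = x2) ->
  is_polytope_face_lattice R A1 -> is_polytope_face_lattice R A2 ->
  is_polytope_face_lattice R A.
Proof.
move=> tA1 tA2 bA1 bA2 bt1 bt2 ft surj /polytope_exposed[n1 [m1 [w1 [J1 L1']]]].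
move=> /polytope_exposed[n2 [m2 [w2 [J2 L2']]]].
have [v1 [s1 e1]] := centered w1; have [v2 [s2 e2]] := centered w2.
have L1 : exposed_lattice A1 v1 J1.
  by case: L1' => a b c; split=> // [x /a /e1//|K /e1 /b].
have L2 : exposed_lattice A2 v2 J2.
  by case: L2' => a b c; split=> // [x /a /e2//|K /e2 /b].
have [a1 b1 c1] := L1; have [a2 b2 c2] := L2.
have dots (n m : nat) (w : 'I_m -> 'rV[R]_n) p : \sum_i w i = 0 ->
    \sum_i dot p (w i) = 0 by move=> E; rewrite -dot_sumr E dot0r.
have cpos (n m : nat) (w : 'I_m -> 'rV[R]_n) p q : \sum_i w i = 0 ->
    (forall i, dot p (w i) <= q) -> [set i | dot p (w i) == q] != setT -> 0 < q.
  move=> /(dots _ _ _ p) sw H; apply: contraR; rewrite -leNgt => q0.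
  rewrite -subTset; apply/subsetP=> i _; rewrite inE eq_le H /=.
  have pos j : true -> 0 <= - dot p (w j) by rewrite oppr_ge0 (le_trans (H j)).
  have /(psumr_eq0P pos)/(_ i isT) : \sum_j - dot p (w j) = 0 by rewrite sumrN sw oppr0.
  by move/eqP; rewrite oppr_eq0 => /eqP->.
have T1 : [set: 'I_m1] != set0.
  have := exposed_bot L1 tA1 bA1; have /eqP-> : J1 \top == setT by rewrite (exposed_top L1).
  by move=> ->; rewrite eq_sym.
have T2 : [set: 'I_m2] != set0.
  have := exposed_bot L2 tA2 bA2; have /eqP-> : J2 \top == setT by rewrite (exposed_top L2).
  by move=> ->; rewrite eq_sym.
pose v (t : 'I_m1 + 'I_m2) : 'rV[R]_(n1 + n2) := match t with
  inl i => row_mx (v1 i) 0 | inr j => row_mx 0 (v2 j) end.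
apply: (@exposed_polytope _ _ _ _ _ _ v (fun u => sum_set (J1 (f1 u)) (J2 (f2 u)))).
split.
- move=> u uA; have /andP[u1 u2] := f_A uA.
  have [E1|n1t] := eqVneq (f1 u) \top.
    have /eqP E2 : f2 u == \top by rewrite -ft E1.
    suff -> : sum_set (J1 (f1 u)) (J2 (f2 u)) = setT by apply: exposedT.
    apply/eqP; rewrite -subTset; apply/subsetP => -[i|j] _; rewrite inE.
      have /eqP-> : J1 (f1 u) == setT by rewrite (exposed_top L1) // E1.
      by rewrite inE.
    have /eqP-> : J2 (f2 u) == setT by rewrite (exposed_top L2) // E2.
    by rewrite inE.
  have n2t : f2 u != \top by rewrite -ft.
  rewrite -(exposed_top L1) // in n1t; rewrite -(exposed_top L2) // in n2t.
  have [p1 [q1 [H1 E1]]] := a1 _ u1; have [p2 [q2 [H2 E2]]] := a2 _ u2.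
  rewrite E1 in n1t; rewrite E2 in n2t.
  have q1p := cpos _ _ _ _ _ s1 H1 n1t; have q2p := cpos _ _ _ _ _ s2 H2 n2t.
  exists (row_mx (q1^-1 *: p1) (q2^-1 *: p2)), 1; split=> [[i|j]|].
  + by rewrite /= !dot_row_mx !dot0r !addr0 dotZl ler_pdivrMl // mulr1.
  + by rewrite /= !dot_row_mx !dot0r !add0r dotZl ler_pdivrMl // mulr1.
  + have eqd (q x : R) : 0 < q -> (q^-1 * x == 1) = (x == q).
      move=> q0; rewrite -(inj_eq (mulfI (lt0r_neq0 q0))) mulrA mulr1 divff ?mul1r //.
      exact: lt0r_neq0.
    apply/setP=> -[i|j]; rewrite !inE /= !dot_row_mx !dot0r ?addr0 ?add0r dotZl eqd //.
      by rewrite E1 inE.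
    by rewrite E2 inE.
- move=> K [p [q [H E]]]; pose p1 := lsubmx p; pose p2 := rsubmx p.
  have dl i : dot p (v (inl i)) = dot p1 (v1 i).
    by rewrite -[p]hsubmxK /= dot_row_mx dot0r addr0.
  have dr j : dot p (v (inr j)) = dot p2 (v2 j).
    by rewrite -[p]hsubmxK /= dot_row_mx dot0r add0r.
  pose K1 := [set i | dot p1 (v1 i) == q]; pose K2 := [set i | dot p2 (v2 i) == q].
  have H1 i : dot p1 (v1 i) <= q by rewrite -dl.
  have H2 i : dot p2 (v2 i) <= q by rewrite -dr.
  have EK : K = sum_set K1 K2.
    by apply/setP=> -[i|j]; rewrite E !inE ?dl ?dr.
  have /b1[x1 x1A E1] : exposed v1 K1 by exists p1, q.
  have /b2[x2 x2A E2] : exposed v2 K2 by exists p2, q.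
  have full (n m : nat) (w : 'I_m -> 'rV[R]_n) r : \sum_i w i = 0 ->
      [set: 'I_m] != set0 -> (forall i, dot r (w i) <= q) ->
      ([set i | dot r (w i) == q] == setT) = (q == 0).
    move=> /[dup] sw /(dots _ _ _ r) s0 /set0Pn[i0 _] Hr; apply/eqP/eqP=> [Eq|q0].
      have : \sum_i dot r (w i) = q *+ m.
        rewrite -[m in RHS]card_ord -sumr_const; apply: eq_bigr => i _.
        by have := in_setT i; rewrite -Eq inE => /eqP.
      rewrite s0 => /esym/eqP; rewrite mulrn_eq0 => /orP[/eqP m0|/eqP//].
      by move: i0; rewrite m0 => -[].
    apply/eqP/negPn/negP => nT; have := cpos _ _ _ _ _ sw Hr nT.
    by rewrite q0 ltxx.
  have [|u uA [u1 u2]] := surj x1 x2 x1A x2A.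
    by rewrite -(exposed_top L1) // -(exposed_top L2) // E1 E2 !full.
  by exists u => //; rewrite u1 u2 E1 E2.
- move=> x y /f_A /andP[x1 x2] /f_A /andP[y1 y2].
  by rewrite sum_set_sub f_le c1 // c2.
Qed.

Lemma point_polytope : (forall u w : Q, u = w) -> \bot \in A ->
  is_polytope_face_lattice R A.
Proof.
move=> Qpt bA.
apply: (@exposed_polytope _ _ _ A 0 'I_0 (fun=> 0) (fun=> set0)); split.
- by move=> x _; apply: exposed0.
- by move=> K _; exists \bot => //; apply/setP=> -[].
- by move=> x y _ _; rewrite (Qpt x y) lexx subxx.
Qed.

End ProductLattices.

(** * Paths in a product *)

Lemma word_in (d dL : Order.disp_t) (P : finTBPOrderType d) (L : porderType dL)
    (lam : labeling P L) (T : {pred L}) r x s :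
  labels_in lam T -> is_root x r -> path covers x s -> all (mem T) (word lam r x s).
Proof.
move=> lT; elim: s x r => //= y s IH x r xr /andP[xy ps].
by rewrite lT //= IH //; apply: root_covers xr.
Qed.

Section ProductPaths.
Context {d1 d2 : Order.disp_t} {P1 : finTBPOrderType d1} {P2 : finTBPOrderType d2}.
Implicit Types (u v : P1 *p P2) (s : seq (P1 *p P2)) (r : {set P1 *p P2}).

Definition pr1 u : P1 := u.1.
Definition pr2 u : P2 := u.2.

Lemma prod_lt u v : (u < v) = (u <= v) && ((pr1 u != pr1 v) || (pr2 u != pr2 v)).
Proof.
by rewrite lt_neqAle andbC -negb_and; case: u v => [u1 u2] [v1 v2].
Qed.

Lemma covers_prodP u v : covers u v <->
  covers (pr1 u) (pr1 v) /\ pr2 u = pr2 v \/ pr1 u = pr1 v /\ covers (pr2 u) (pr2 v).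
Proof.
case: u v => [u1 u2] [v1 v2]; rewrite /pr1 /pr2 /=; split.
  move=> /coversP[]; rewrite prod_lt leEprod /= => /andP[/andP[l1 l2] n] H.
  have [E2|n2] := eqVneq u2 v2.
    rewrite E2 eqxx orbF in n H *; left; split=> //; apply/coversP.
    split=> [|z z1 z2]; first by rewrite lt_neqAle n.
    apply: (H (z, v2)); rewrite prod_lt leEprod /pr1 /pr2 /= lexx ltW //=.
      by rewrite lt_eqF.
    by rewrite (lt_eqF z2).
  have [E1|n1] := eqVneq u1 v1.
    rewrite E1 in n H *; right; split=> //; apply/coversP.
    split=> [|z z1 z2]; first by rewrite lt_neqAle n2.
    apply: (H (v1, z)); rewrite prod_lt leEprod /pr1 /pr2 /= lexx ltW //=.
      by rewrite (lt_eqF z1) orbT.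
    by rewrite (lt_eqF z2) orbT.
  case: (H (u1, v2)); rewrite prod_lt leEprod /pr1 /pr2 /= lexx.
    by rewrite l2 n2 orbT.
  by rewrite l1 n1.
case=> -[].
  move=> /coversP[l1 H] E; rewrite {}E; apply/coversP; split.
    by rewrite prod_lt leEprod /pr1 /pr2 /= lexx (ltW l1) lt_eqF.
  move=> [z1 z2]; rewrite !prod_lt !leEprod /pr1 /pr2 /= => /andP[/andP[a1 a2] n].
  move=> /andP[/andP[b1 b2] m].
  have E : v2 = z2 by apply: le_anti; rewrite a2 b2.
  rewrite E eqxx !orbF in n m.
  by apply: (H z1); rewrite lt_neqAle ?n ?m.
move=> E /coversP[l1 H]; rewrite {}E; apply/coversP; split.
  by rewrite prod_lt leEprod /pr1 /pr2 /= lexx (ltW l1) (lt_eqF l1) orbT.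
move=> [z1 z2]; rewrite !prod_lt !leEprod /pr1 /pr2 /= => /andP[/andP[a1 a2] n].
move=> /andP[/andP[b1 b2] m].
have E : v1 = z1 by apply: le_anti; rewrite a1 b1.
rewrite E eqxx /= in n m.
by apply: (H z2); rewrite lt_neqAle ?n ?m.
Qed.

Lemma covers_pr1 u v : covers u v -> pr1 u = pr1 v \/ covers (pr1 u) (pr1 v).
Proof. by move=> /covers_prodP[[? _]|[? _]]; [right|left]. Qed.

Lemma covers_pr2 u v : covers u v -> pr2 u = pr2 v \/ covers (pr2 u) (pr2 v).
Proof. by move=> /covers_prodP[[_ ?]|[_ ?]]; [left|right]. Qed.

Lemma covers_neq (d : Order.disp_t) (P : finTBPOrderType d) (x y : P) :
  covers x y -> (x == y) = false.
Proof. by move=> /covers_lt/lt_eqF. Qed.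

Lemma covers_irr (d : Order.disp_t) (P : finTBPOrderType d) (x : P) :
  covers x x = false.
Proof. by rewrite /covers ltxx. Qed.

Lemma size_projs u s : path covers u s ->
  size s = (size (proj pr1 u s) + size (proj pr2 u s))%N.
Proof.
elim: s u => //= v s IH u /andP[/covers_prodP H /IH ->].
case: H => -[]; last first.
  by move=> -> /covers_neq->; rewrite eqxx /= addnS.
by move=> /covers_neq-> ->; rewrite eqxx /= addSn.
Qed.

Lemma setU1_root (d : Order.disp_t) (P : finTBPOrderType d) (x : P) (r0 : {set P}) :
  is_root x r0 -> x |: r0 = r0.
Proof. by move=> /root_mem xr; apply/setUidPr; rewrite sub1set. Qed.

Definition rooted u r := is_root (pr1 u) (pr1 @: r) /\ is_root (pr2 u) (pr2 @: r).

Lemma rooted_covers u v r : covers u v -> rooted u r -> rooted v (v |: r).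
Proof.
move=> /covers_prodP H [r1 r2]; rewrite /rooted !imsetU1.
case: H => -[H1 H2].
  by rewrite -H2 (setU1_root r2); split=> //; exact: root_covers H1 r1.
by rewrite -H1 (setU1_root r1); split=> //; exact: root_covers H2 r2.
Qed.

Section Labels.
Context {dL : Order.disp_t} {L : porderType dL}.
Variables (lam1 : labeling P1 L) (lam2 : labeling P2 L) (S : bool -> {pred L}).
Hypothesis Sdisj : forall i a, a \in S i -> a \in S (~~ i) -> False.
Hypothesis Scmp : forall i, {in S i & S (~~ i), forall a b, a >=< b}.
Hypotheses (lamS1 : labels_in lam1 (S true)) (lamS2 : labels_in lam2 (S false)).

Let lam := times_labeling lam1 lam2.

Fixpoint tword r u s : seq (bool * L) :=
  if s is v :: s' then
    (covers (pr1 u) (pr1 v), lam r u v) :: tword (v |: r) v s'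
  else [::].

Lemma map_tword r u s : map snd (tword r u s) = word lam r u s.
Proof. by elim: s r u => //= v s IH r u; rewrite IH. Qed.

Lemma tword_in r u s : path covers u s -> rooted u r -> tagged_in S (tword r u s).
Proof.
elim: s r u => //= v s IH r u /andP[uv ps] ru; have rv := rooted_covers uv ru.
rewrite (IH _ _ ps rv) andbT /lam /times_labeling; case: ru => r1 r2.
case/covers_prodP: uv => -[H1 H2]; first by rewrite H1; apply: lamS1.
by rewrite H1 covers_irr -/(pr1 u) -/(pr1 v) H1 covers_irr; apply: lamS2.
Qed.

Lemma part_tword1 r u s : path covers u s -> rooted u r ->
  part true (tword r u s) = word lam1 (pr1 @: r) (pr1 u) (proj pr1 u s).
Proof.
elim: s r u => //= v s IH r u /andP[uv ps] ru; have rv := rooted_covers uv ru.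
rewrite part_cons IH // /lam /times_labeling -/(pr1 u) -/(pr1 v) imsetU1.
case/covers_prodP: uv => -[H1 H2]; first by rewrite H1 covers_neq.
rewrite -H1 covers_irr eqxx setU1_root //; by case: ru.
Qed.

Lemma part_tword2 r u s : path covers u s -> rooted u r ->
  part false (tword r u s) = word lam2 (pr2 @: r) (pr2 u) (proj pr2 u s).
Proof.
elim: s r u => //= v s IH r u /andP[uv ps] ru; have rv := rooted_covers uv ru.
rewrite part_cons IH // /lam /times_labeling -/(pr1 u) -/(pr1 v) -/(pr2 u) -/(pr2 v) imsetU1.
case/covers_prodP: uv => -[H1 H2]; last by rewrite H1 covers_irr covers_neq.
rewrite -H2 H1 eqxx setU1_root //; by case: ru.
Qed.

Lemma tword_inj r u s s' : path covers u s -> path covers u s' ->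
  tword r u s = tword r u s' -> proj pr1 u s = proj pr1 u s' ->
  proj pr2 u s = proj pr2 u s' -> s = s'.
Proof.
elim: s s' r u => [|v s IH] [|v' s'] r u //= /andP[uv ps] /andP[uv' ps'] [Ec _ Et].
suff H : proj pr1 u (v :: s) = proj pr1 u (v' :: s') ->
    proj pr2 u (v :: s) = proj pr2 u (v' :: s') ->
    [/\ v = v', proj pr1 v s = proj pr1 v' s' & proj pr2 v s = proj pr2 v' s'].
  by move=> E1 E2; have [Ev F1 F2] := H E1 E2; subst v'; rewrite (IH s' (v |: r) v).
have ext (w w' : P1 *p P2) : pr1 w = pr1 w' -> pr2 w = pr2 w' -> w = w'.
  by case: w w' => [? ?] [? ?]; rewrite /pr1 /pr2 /= => -> ->.
rewrite /=; case/covers_prodP: uv Ec => -[H1 H2]; case/covers_prodP: uv' => -[H1' H2'].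
- rewrite (covers_neq H1) (covers_neq H1') -H2 -H2' !eqxx => _ [E1 E1'] E2.
  by split=> //; apply: ext => //; rewrite -H2.
- by rewrite H1 -H1' covers_irr.
- by rewrite H1' -H1 covers_irr.
- rewrite -H1 -H1' !eqxx (covers_neq H2) (covers_neq H2') => _ E1 [E2 E2'].
  by split=> //; apply: ext => //; rewrite -H1.
Qed.

Lemma tword_lift t r u (s1 : seq P1) (s2 : seq P2) : rooted u r ->
  path covers (pr1 u) s1 -> path covers (pr2 u) s2 ->
  part true t = word lam1 (pr1 @: r) (pr1 u) s1 ->
  part false t = word lam2 (pr2 @: r) (pr2 u) s2 ->
  exists s, [/\ path covers u s, proj pr1 u s = s1, proj pr2 u s = s2
    & tword r u s = t].
Proof.
elim: t r u s1 s2 => [|[[] a] t IH] r u s1 s2 ru.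
- by case: s1 s2 => [|? ?] [|? ?] // _ _ _ _; exists [::].
- case: s1 => [|z s1] //= /andP[uz p1] p2; rewrite !part_cons /= => -[-> E1] E2.
  pose v : P1 *p P2 := (z, pr2 u).
  have uv : covers u v by apply/covers_prodP; left.
  have rv := rooted_covers uv ru.
  have [||s [ps q1 q2 q3]] := IH (v |: r) v s1 s2 rv p1 p2.
  + by rewrite imsetU1.
  + by rewrite imsetU1 setU1_root //; case: ru.
  exists (v :: s); split=> /=; rewrite ?uv ?q3 //.
  + by rewrite covers_neq ?q1.
  + by rewrite eqxx.
  + by rewrite uz /lam /times_labeling -/(pr1 u) -/(pr1 v) uz.
- case: s2 => [|z s2] //= p1 /andP[uz p2]; rewrite !part_cons /= => E1 -[-> E2].
  pose v : P1 *p P2 := (pr1 u, z).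
  have uv : covers u v by apply/covers_prodP; right.
  have rv := rooted_covers uv ru.
  have [||s [ps q1 q2 q3]] := IH (v |: r) v s1 s2 rv p1 p2.
  + by rewrite imsetU1 setU1_root //; case: ru.
  + by rewrite imsetU1.
  exists (v :: s); split=> /=; rewrite ?uv ?q3 //.
  + by rewrite eqxx.
  + by rewrite covers_neq ?q2.
  + by rewrite covers_irr /lam /times_labeling -/(pr1 u) -/(pr1 v) covers_irr.
Qed.

Lemma times_merge r u (s1 : seq P1) (s2 : seq P2) : rooted u r ->
  path covers (pr1 u) s1 -> path covers (pr2 u) s2 ->
  sorted <=%O (word lam1 (pr1 @: r) (pr1 u) s1) ->
  sorted <=%O (word lam2 (pr2 @: r) (pr2 u) s2) ->
  exists s, [/\ path covers u s, proj pr1 u s = s1, proj pr2 u s = s2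
    & sorted <=%O (word lam r u s)].
Proof.
move=> ru p1 p2 o1 o2; have [r1 r2] := ru.
pose w (i : bool) := if i then word lam1 (pr1 @: r) (pr1 u) s1
                     else word lam2 (pr2 @: r) (pr2 u) s2.
have [||t [ot st pt]] := merge_exists Scmp (w := w).
- by case; apply: word_in.
- by case.
have [s [ps E1 E2 Et]] := tword_lift ru p1 p2 (pt true) (pt false).
by exists s; split=> //; rewrite -map_tword Et.
Qed.

Section Relation.
Variable R : rel L.
Hypothesis Rtrans : forall i j k a b c, ~~ ((i == j) && (j == k)) ->
  a \in S i -> b \in S j -> c \in S k -> R a b -> R b c -> R a c.

Lemma times_sorted r u s : rooted u r -> path covers u s -> sorted R (word lam r u s) ->
  sorted R (word lam1 (pr1 @: r) (pr1 u) (proj pr1 u s)) /\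
  sorted R (word lam2 (pr2 @: r) (pr2 u) (proj pr2 u s)).
Proof.
move=> ru ps; rewrite -map_tword => ss.
have ot := tword_in ps ru.
by rewrite -part_tword1 // -part_tword2 //; split;
  exact: (part_sorted Rtrans _ ot ss).
Qed.

Lemma times_sorted_inj r u s s' :
    (forall i a b, a \in S i -> b \in S (~~ i) -> R a b -> R b a -> False) ->
    rooted u r -> path covers u s -> path covers u s' ->
    sorted R (word lam r u s) -> sorted R (word lam r u s') ->
  proj pr1 u s = proj pr1 u s' -> proj pr2 u s = proj pr2 u s' -> s = s'.
Proof.
move=> Rasym ru ps ps'; rewrite -!map_tword => ss ss' E1 E2.
apply: (tword_inj ps ps' _ E1 E2).
apply: (shuffle_inj Rtrans Rasym (tword_in ps ru) (tword_in ps' ru) ss ss').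
by case; rewrite ?part_tword1 ?part_tword2 // ?E1 ?E2.
Qed.

Lemma times_head r u s a w : rooted u r -> path covers u s ->
    sorted R (word lam r u s) -> word lam r u s = a :: w ->
  (forall b w', word lam1 (pr1 @: r) (pr1 u) (proj pr1 u s) = b :: w' -> b = a \/ R a b) /\
  (forall b w', word lam2 (pr2 @: r) (pr2 u) (proj pr2 u s) = b :: w' -> b = a \/ R a b).
Proof.
move=> ru ps; rewrite -part_tword1 // -part_tword2 // -map_tword.
case: (tword r u s) (tword_in ps ru) => [|[j c] t] // ot st [<- _].
by split=> b w' E; apply: (sorted_part_head Rtrans ot st E).
Qed.

Lemma times_last r u s a w : rooted u r -> path covers u s ->
    sorted R (word lam r u s) -> word lam r u s = rcons w a ->
  (forall b w', word lam1 (pr1 @: r) (pr1 u) (proj pr1 u s) = rcons w' b -> b = a \/ R b a) /\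
  (forall b w', word lam2 (pr2 @: r) (pr2 u) (proj pr2 u s) = rcons w' b -> b = a \/ R b a).
Proof.
move=> ru ps; rewrite -part_tword1 // -part_tword2 // -map_tword.
case/lastP: (tword r u s) (tword_in ps ru) => [|t [j c]].
  by case: w.
rewrite map_rcons => ot st /rcons_inj[_ Ec]; rewrite -{}Ec.
by split=> b w' E; apply: (sorted_part_last Rtrans ot st E).
Qed.

End Relation.

(* The roots and endpoints of the two paths may differ: for the reduced
   products the comparison starts above distinct atoms. *)
Lemma times_lexi_le r r' u u' s s' : rooted u r -> rooted u' r' ->
    path covers u s -> path covers u' s' -> sorted <=%O (word lam r u s) ->
    size (proj pr1 u s) = size (proj pr1 u' s') ->
    size (proj pr2 u s) = size (proj pr2 u' s') ->
    (word lam1 (pr1 @: r) (pr1 u) (proj pr1 u s) : seqlexi L)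
      <= word lam1 (pr1 @: r') (pr1 u') (proj pr1 u' s') ->
    (word lam2 (pr2 @: r) (pr2 u) (proj pr2 u s) : seqlexi L)
      <= word lam2 (pr2 @: r') (pr2 u') (proj pr2 u' s') ->
  (word lam r u s : seqlexi L) <= word lam r' u' s'.
Proof.
move=> ru ru' ps ps'; rewrite -!map_tword => ss z1 z2 H1 H2.
apply: (merge_lexi_le Sdisj (tword_in ps ru) (tword_in ps' ru') ss).
  by case; rewrite ?part_tword1 ?part_tword2 // !size_word.
by case; rewrite ?part_tword1 ?part_tword2.
Qed.

Lemma times_word_inj r r' u u' s s' : rooted u r -> rooted u' r' ->
    path covers u s -> path covers u' s' -> word lam r u s = word lam r' u' s' ->
  [/\ tword r u s = tword r' u' s',
      word lam1 (pr1 @: r) (pr1 u) (proj pr1 u s) =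
        word lam1 (pr1 @: r') (pr1 u') (proj pr1 u' s')
    & word lam2 (pr2 @: r) (pr2 u) (proj pr2 u s) =
        word lam2 (pr2 @: r') (pr2 u') (proj pr2 u' s')].
Proof.
move=> ru ru' ps ps'; rewrite -!map_tword => E.
have Et : tword r u s = tword r' u' s' by exact: (tag_inj Sdisj (tword_in ps ru) (tword_in ps' ru') E).
by rewrite -!part_tword1 // -!part_tword2 // Et.
Qed.

End Labels.
End ProductPaths.

(** * Intervals that embed in the product *)

Section LexMap.
Context {d d' : Order.disp_t} {L : porderType d} {L' : porderType d'} (sg : L -> L').
Hypothesis sg_le : forall a b, (sg a <= sg b) = (a <= b).

Lemma map_lexi (w w' : seq L) :
  (map sg w <= map sg w' :> seqlexi L') = (w <= w' :> seqlexi L).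
Proof.
by elim: w w' => [|a w IH] [|b w'] //; rewrite !map_cons !lexi_cons !sg_le IH.
Qed.

Lemma map_ltxi (w w' : seq L) :
  (map sg w < map sg w' :> seqlexi L') = (w < w' :> seqlexi L).
Proof. by rewrite !lt_leAnge !map_lexi. Qed.

Lemma sorted_map_le (w : seq L) : sorted <=%O (map sg w) = sorted <=%O w.
Proof. by rewrite sorted_map; apply: eq_sorted => a b /=; rewrite sg_le. Qed.

Lemma sorted_map_nle (w : seq L) :
  sorted (fun a b => ~~ (a <= b)) (map sg w) = sorted (fun a b => ~~ (a <= b)) w.
Proof. by rewrite sorted_map; apply: eq_sorted => a b /=; rewrite sg_le. Qed.

End LexMap.

Lemma proj_map (d d' dQ : Order.disp_t) (P : finTBPOrderType d) (X : finTBPOrderType d')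
    (Q : finTBPOrderType dQ) (f : X -> P) (g : Q -> X) u s :
  proj f (g u) (map g s) = proj (f \o g) u s.
Proof. by elim: s u => //= v s IH u; rewrite IH. Qed.

(* The region D is everything for the full product, and the complement of
   \bot, resp. \top, for the reduced products. *)
Section Embedded.
Context {d1 d2 dQ dL dL' : Order.disp_t} {P1 : finTBPOrderType d1}
  {P2 : finTBPOrderType d2} {Q : finTBPOrderType dQ}
  {L : porderType dL} {L' : porderType dL'}.
Variables (g : Q -> P1 *p P2) (D : pred Q).
Hypothesis g_le : forall u v, (u <= v) = (g u <= g v).
Hypothesis D_conv : forall u v w, D u -> D v -> u <= w -> w <= v -> D w.
Hypothesis D_surj : forall u v x, D u -> D v -> g u <= x -> x <= g v ->
  exists2 w, D w & g w = x.
Implicit Types (u v : Q) (s : seq Q) (r : {set Q}).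

Lemma emb_inj : injective g.
Proof. by move=> u v E; apply: le_anti; rewrite !g_le E lexx. Qed.

Lemma emb_lt u v : (u < v) = (g u < g v).
Proof. by rewrite !lt_leAnge !g_le. Qed.

Lemma emb_covers u v : D u -> D v -> covers u v = covers (g u) (g v).
Proof.
move=> Du Dv; apply/coversP/coversP; rewrite emb_lt => -[lt H]; split=> // x xz zy.
  have [w Dw E] := D_surj Du Dv (ltW xz) (ltW zy).
  by apply: (H w); rewrite emb_lt E.
by apply: (H (g x)); rewrite -emb_lt.
Qed.

Lemma emb_path u v s : D u -> D v -> saturated u v s ->
  saturated (g u) (g v) (map g s) /\ all D (u :: s).
Proof.
move=> Du Dv /andP[ps /eqP ly].
have aD : all D (u :: s).
  have lps := covers_path_lt ps.
  apply/allP => w ws; apply: (D_conv Du Dv); first exact: lt_path_ge ws.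
  by rewrite -ly; apply: lt_path_le ws.
split=> //; rewrite /saturated last_map ly eqxx andbT {ly Dv}.
elim: s u Du ps aD => //= w s IH u Du /andP[uw ps] /and3P[_ Dw aD].
by rewrite -emb_covers // uw IH //= Dw.
Qed.

Lemma emb_path_lift u v t : D u -> D v -> saturated (g u) (g v) t ->
  exists2 s, saturated u v s & map g s = t.
Proof.
elim: t u => [|x t IH] u Du Dv /=.
  by move=> /andP[_ /eqP/emb_inj->]; exists [::] => //; rewrite /saturated /= eqxx.
move=> /andP[/= /andP[ux pt] ly].
have [w Dw E] : exists2 w, D w & g w = x.
  apply: D_surj Du Dv (ltW (covers_lt ux)) _.
  by rewrite -(eqP ly); apply: lt_path_le_last; apply: covers_path_lt.
rewrite -{}E in ux pt ly *; have [|s /andP[ps ls] <-] := IH w Dw Dv.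
  by rewrite /saturated pt.
by exists (w :: s) => //; rewrite /saturated /= emb_covers // ux ps.
Qed.

Variable sg : L -> L'.
Hypothesis sg_le : forall a b, (sg a <= sg b) = (a <= b).
Variables (lam1 : labeling P1 L) (lam2 : labeling P2 L) (S : bool -> {pred L}).
Hypothesis Sdisj : forall i a, a \in S i -> a \in S (~~ i) -> False.
Hypothesis Scmp : forall i, {in S i & S (~~ i), forall a b, a >=< b}.
Hypotheses (lamS1 : labels_in lam1 (S true)) (lamS2 : labels_in lam2 (S false)).
Variable lamQ : labeling Q L'.
Let lam := times_labeling lam1 lam2.
Hypothesis lamQE : forall r u v, D u -> D v -> lamQ r u v = sg (lam (g @: r) (g u) (g v)).

Lemma emb_word r u s : all D (u :: s) ->
  word lamQ r u s = map sg (word lam (g @: r) (g u) (map g s)).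
Proof.
elim: s r u => //= v s IH r u /and3P[Du Dv Ds].
by rewrite lamQE // IH /= ?Dv // imsetU1.
Qed.

Lemma emb_descending r u v s : D u -> D v -> rooted (g u) (g @: r) ->
    saturated u v s -> sorted (fun a b => ~~ (a <= b)) (word lamQ r u s) ->
  sorted (fun a b => ~~ (a <= b))
    (word lam1 (pr1 @: (g @: r)) (pr1 (g u)) (proj pr1 (g u) (map g s))) /\
  sorted (fun a b => ~~ (a <= b))
    (word lam2 (pr2 @: (g @: r)) (pr2 (g u)) (proj pr2 (g u) (map g s))).
Proof.
move=> Du Dv ru ss; have [/andP[gs _] aD] := emb_path Du Dv ss.
rewrite emb_word // sorted_map_nle //.
by apply: (times_sorted lamS1 lamS2 (shuffle_nle_trans Scmp)).
Qed.

Lemma emb_descending_inj r u v s s' : D u -> D v -> rooted (g u) (g @: r) ->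
    saturated u v s -> saturated u v s' ->
    sorted (fun a b => ~~ (a <= b)) (word lamQ r u s) ->
    sorted (fun a b => ~~ (a <= b)) (word lamQ r u s') ->
    proj pr1 (g u) (map g s) = proj pr1 (g u) (map g s') ->
    proj pr2 (g u) (map g s) = proj pr2 (g u) (map g s') ->
  s = s'.
Proof.
move=> Du Dv ru ss ss'.
have [/andP[gs _] aD] := emb_path Du Dv ss.
have [/andP[gs' _] aD'] := emb_path Du Dv ss'.
rewrite !emb_word // !sorted_map_nle // => o o' E1 E2.
apply: (inj_map emb_inj).
apply: (times_sorted_inj lamS1 lamS2 (shuffle_nle_trans Scmp) _ ru gs gs' o o') => //.
exact: shuffle_nle_asym.
Qed.

Variables (k1 k2 : nat).
Hypotheses (rk1 : has_rank [set: P1] k1) (rk2 : has_rank [set: P2] k2).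

Lemma emb_CL_path r u v (s1 : seq P1) (s2 : seq P2) : D u -> D v -> rooted (g u) (g @: r) ->
    CL_path lam1 (pr1 @: (g @: r)) (pr1 (g u)) (pr1 (g v)) s1 ->
    CL_path lam2 (pr2 @: (g @: r)) (pr2 (g u)) (pr2 (g v)) s2 ->
  exists s, [/\ CL_path lamQ r u v s,
    proj pr1 (g u) (map g s) = s1 & proj pr2 (g u) (map g s) = s2].
Proof.
move=> Du Dv ru [ss1 o1 un1 lx1] [ss2 o2 un2 lx2].
have [ps1 /eqP l1] := andP ss1; have [ps2 /eqP l2] := andP ss2.
have [t [pt E1 E2 ot]] := times_merge Scmp lamS1 lamS2 ru ps1 ps2 o1 o2.
have st : saturated (g u) (g v) t.
  rewrite /saturated pt; apply/eqP.
  have F1 := last_proj pr1 (g u) t; have F2 := last_proj pr2 (g u) t.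
  rewrite E1 l1 in F1; rewrite E2 l2 in F2.
  by case: (last _ _) (g v) F1 F2 => [? ?] [? ?]; rewrite /pr1 /pr2 /= => -> ->.
have [s ss Est] := emb_path_lift Du Dv st; exists s; rewrite Est; split=> //.
have aD := (emb_path Du Dv ss).2.
have ps s' : saturated u v s' ->
    saturated (pr1 (g u)) (pr1 (g v)) (proj pr1 (g u) (map g s')) /\
    saturated (pr2 (g u)) (pr2 (g v)) (proj pr2 (g u) (map g s')).
  move=> ss'; have [gs' _] := emb_path Du Dv ss'.
  split; [apply: proj_saturated gs' => //|apply: proj_saturated gs' => //].
    exact: covers_pr1.
  exact: covers_pr2.
split=> // [|s' ss' os'|s' ss' ns].
- by rewrite emb_word // sorted_map_le // Est.
- have [gs' aD'] := emb_path Du Dv ss'; have [q1 q2] := ps s' ss'.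
  move: os'; rewrite emb_word // sorted_map_le // => os'.
  have [/andP[pg _]] := gs'.
  have [z1 z2] := times_sorted lamS1 lamS2 (shuffle_le_trans (S := S)) ru pg os'.
  apply: (inj_map emb_inj); rewrite Est.
  apply: (times_sorted_inj lamS1 lamS2 (shuffle_le_trans (S := S)) _ ru pg pt os' ot).
  + exact: shuffle_le_asym.
  + by rewrite E1; apply: un1.
  + by rewrite E2; apply: un2.
- have [gs' aD'] := emb_path Du Dv ss'; have [q1 q2] := ps s' ss'.
  rewrite !emb_word // map_ltxi // Est.
  have /andP[pg _] := gs'.
  have le1 : (word lam1 (pr1 @: (g @: r)) (pr1 (g u)) s1 : seqlexi L) <=
     word lam1 (pr1 @: (g @: r)) (pr1 (g u)) (proj pr1 (g u) (map g s')).
    have [->|n1] := eqVneq (proj pr1 (g u) (map g s')) s1; first exact: lexx.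
    by apply: ltW; apply: lx1.
  have le2 : (word lam2 (pr2 @: (g @: r)) (pr2 (g u)) s2 : seqlexi L) <=
     word lam2 (pr2 @: (g @: r)) (pr2 (g u)) (proj pr2 (g u) (map g s')).
    have [->|n2] := eqVneq (proj pr2 (g u) (map g s')) s2; first exact: lexx.
    by apply: ltW; apply: lx2.
  rewrite lt_neqAle; apply/andP; split; last first.
    apply: (times_lexi_le Sdisj lamS1 lamS2 ru ru pt pg ot); rewrite ?E1 ?E2 //.
      exact: graded rk1 ss1 q1.
    exact: graded rk2 ss2 q2.
  apply/eqP=> Ew.
  have [Et W1 W2] := times_word_inj Sdisj lamS1 lamS2 ru ru pt pg Ew.
  rewrite E1 in W1; rewrite E2 in W2.
  have F1 : proj pr1 (g u) (map g s') = s1.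
    by apply/eqP; apply/negPn/negP => /(lx1 _ q1); rewrite -W1 ltxx.
  have F2 : proj pr2 (g u) (map g s') = s2.
    by apply/eqP; apply/negPn/negP => /(lx2 _ q2); rewrite -W2 ltxx.
  case/eqP: ns; apply: (inj_map emb_inj); rewrite Est.
  by apply: (tword_inj pg pt (esym Et)); rewrite ?F1 ?F2 ?E1 ?E2.
Qed.

End Embedded.

Section Rank.
Context {d : Order.disp_t} {P : finTBPOrderType d}.

Lemma rank_path k s : has_rank [set: P] k -> saturated \bot (\top : P) s -> size s = k.
Proof.
move=> rk ss; apply: succn_inj; rewrite -(card_saturated ss); apply: rk.
by rewrite -itv_bot_top; apply: saturated_maxchain.
Qed.

Lemma path_rank k : (forall s : seq P, saturated \bot (\top : P) s -> size s = k) ->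
  has_rank [set: P] k.
Proof.
move=> H c; rewrite -itv_bot_top => /(maxchain_saturated (le0x _))[s ss ->].
by rewrite (card_saturated ss) H.
Qed.

Lemma maxchain_atom c v : maxchain [set: P] c -> v \in c -> v != \bot ->
  exists z, [/\ z \in c, covers \bot z & z <= v].
Proof.
rewrite -itv_bot_top => /(maxchain_saturated (le0x _))[s /andP[ps _] ->].
rewrite inE in_cons => /orP[/eqP->|]; first by rewrite eqxx.
case: s ps => // z s /= /andP[bz ps] vs _; exists z; split=> //.
  by rewrite !inE eqxx orbT.
by apply: lt_path_ge vs; exact: covers_path_lt.
Qed.

Lemma maxchain_coatom c v : maxchain [set: P] c -> v \in c -> v != \top ->
  exists z, [/\ z \in c, covers z \top & v <= z].
Proof.
rewrite -itv_bot_top => /(maxchain_saturated (le0x _))[s /andP[ps /eqP ls] ->].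
case/lastP: s ps ls => [|s t] /=.
  by move=> _ <-; rewrite !inE => /eqP->; rewrite eqxx.
rewrite last_rcons rcons_path => /andP[ps lt] E; rewrite {}E in lt *.
rewrite in_set -rcons_cons mem_rcons in_cons => /orP[/eqP->|vs]; first by rewrite eqxx.
move=> _; exists (last \bot s); split=> //; last first.
  by apply: lt_path_le vs; exact: covers_path_lt.
by rewrite in_set mem_rcons in_cons mem_last orbT.
Qed.

Lemma rank_bot_top k (A : {set P}) : has_rank [set: P] k -> has_rank A k ->
  (\bot \in A) && (\top \in A).
Proof.
move=> rk rA.
have c0 : chain (set0 : {set P}) by apply/chainP=> z; rewrite inE.
have [c mc _] := chain_maxchain c0 (sub0set A).
have /andP[bc tc] := maxchain_bot_top (full_maxchain rk rA mc).
by case/maxchainP: mc => _ /subsetP H _; rewrite !H.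
Qed.

Lemma saturated_refl (x : P) s : saturated x x s -> s = [::].
Proof.
case: s => // z s /andP[/= /andP[/covers_lt xz /covers_path_lt/lt_path_le_last zl]].
by move=> /eqP E; have := lt_le_trans xz zl; rewrite E ltxx.
Qed.

Lemma CL_path_nil (dL : Order.disp_t) (L : porderType dL) (lam : labeling P L) r x :
  CL_path lam r x x [::].
Proof.
split=> //; first by rewrite /saturated /= eqxx.
- by move=> s /saturated_refl.
- by move=> s /saturated_refl ->; rewrite eqxx.
Qed.

End Rank.

(* The case of a reduced product with a trivial factor. *)
Lemma ced_point (R : realType) (d dL dI : Order.disp_t) (Q : finTBPOrderType d)
    (L : porderType dL) (I : finOrderType dI) (lam : labeling Q L)
    (Sigma : I -> {set Q}) (i0 : I) :
  (forall u v : Q, u = v) -> (forall i, \bot \in Sigma i) -> CL_ced R lam Sigma.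
Proof.
move=> Qpt bS; have ST i : Sigma i = setT.
  by apply/setP=> u; rewrite inE (Qpt u \bot) bS.
have rk : has_rank [set: Q] 0.
  apply: path_rank => -[//|z s] /andP[/= /andP[/covers_lt + _] _].
  by rewrite (Qpt z \bot) ltxx.
exists 0; split.
- apply/CL_labelingP => x y r _ _; exists [::]; rewrite (Qpt y x).
  exact: CL_path_nil.
- exact: rk.
- by move=> i; rewrite ST.
- by move=> i; apply: point_polytope.
- move=> i x y r xy _ c c' /(maxchain_saturated xy)[s ss ->] _ _.
  move=> /(maxchain_saturated xy)[s' ss' ->] _ _.
  rewrite (Qpt y x) in ss ss'.
  by rewrite (saturated_refl ss) (saturated_refl ss').
- move=> s t c ts _; rewrite inE => /exists_inP[e /andP[_ /forallP/(_ t)]].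
  by rewrite ts ST subsetT.
- by move=> c _; exists i0; rewrite ST subsetT.
Qed.

Section CedProduct.
Context {R : realType} {d1 d2 dQ e1 e2 dL dL' : Order.disp_t} {P1 : finTBPOrderType d1}
  {P2 : finTBPOrderType d2} {Q : finTBPOrderType dQ}
  {I1 : finOrderType e1} {I2 : finOrderType e2}
  {L : porderType dL} {L' : porderType dL'}.
Variables (f1 : Q -> P1) (f2 : Q -> P2).
Hypothesis f_le : forall u v, (u <= v) = (f1 u <= f1 v) && (f2 u <= f2 v).
Hypotheses (f1_bot : f1 \bot = \bot) (f2_bot : f2 \bot = \bot).
Hypotheses (f1_top : f1 \top = \top) (f2_top : f2 \top = \top).
Hypothesis f1_cov : forall u v, covers u v -> f1 u = f1 v \/ covers (f1 u) (f1 v).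
Hypothesis f2_cov : forall u v, covers u v -> f2 u = f2 v \/ covers (f2 u) (f2 v).
Hypothesis f_dense : forall c1 c2 u v,
  maxchain [set: P1] c1 -> maxchain [set: P2] c2 ->
  f1 u \in c1 -> f2 u \in c2 -> f1 v \in c1 -> f2 v \in c2 ->
  u < v -> ~~ covers u v -> exists z, [/\ u < z, z < v, f1 z \in c1 & f2 z \in c2].
Variables (k1 k2 k : nat) (Sigma1 : I1 -> {set P1}) (Sigma2 : I2 -> {set P2}).
Variables (lam1 : labeling P1 L) (lam2 : labeling P2 L) (lamQ : labeling Q L').
Hypotheses (ced1 : CL_ced_of_rank R k1 lam1 Sigma1)
           (ced2 : CL_ced_of_rank R k2 lam2 Sigma2).
Hypothesis rkQ : has_rank [set: Q] k.
Variable Sigma : I1 *l I2 -> {set Q}.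
Hypothesis SigmaE : forall st u,
  (u \in Sigma st) = (f1 u \in Sigma1 st.1) && (f2 u \in Sigma2 st.2).
Let nle {d} {T : porderType d} : rel T := fun a b => ~~ (a <= b).
Hypothesis lamQ_CL : CL_labeling lamQ.
Hypothesis Sigma_polytope : forall st, is_polytope_face_lattice R (Sigma st).
Hypothesis lamQ_desc : forall u v r s, is_root u r -> saturated u v s ->
  sorted nle (word lamQ r u s) ->
  sorted nle (word lam1 (f1 @: r) (f1 u) (proj f1 u s)) /\
  sorted nle (word lam2 (f2 @: r) (f2 u) (proj f2 u s)).
Hypothesis lamQ_desc_inj : forall u v r s s', is_root u r ->
  saturated u v s -> saturated u v s' ->
  sorted nle (word lamQ r u s) -> sorted nle (word lamQ r u s') ->
  proj f1 u s = proj f1 u s' -> proj f2 u s = proj f2 u s' -> s = s'.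

Lemma ced_product : CL_ced_of_rank R k lamQ Sigma.
Proof.
have [_ rk1 rkS1 _ D1 B1 U1] := ced1; have [_ rk2 rkS2 _ D2 B2 U2] := ced2.
have Dim := Delta_imset f_le f1_bot f2_bot f1_top f2_top f1_cov f2_cov f_dense
  rk1 rk2 rkS1 rkS2 SigmaE.
split=> //.
- move=> st; exact: (rank_Sigma f_le f1_bot f2_bot f1_top f2_top f1_cov f2_cov f_dense
    rk1 rk2 rkS1 rkS2 rkQ SigmaE).
- move=> st u v r uv ur c c' /(maxchain_saturated uv)[s ss ->].
  rewrite /descending (label_wordE _ ss) ?root_mem // => ds /Dim[].
  rewrite !imset_proj => E1 E2 /(maxchain_saturated uv)[s' ss' ->].
  rewrite (label_wordE _ ss') ?root_mem // => ds' /Dim[].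
  rewrite !imset_proj => E1' E2'.
  have [o1 o2] := lamQ_desc ur ss ds; have [o1' o2'] := lamQ_desc ur ss' ds'.
  have p1 := proj_saturated f1_cov ss; have p2 := proj_saturated f2_cov ss.
  have p1' := proj_saturated f1_cov ss'; have p2' := proj_saturated f2_cov ss'.
  have ur1 := root_imset f1_cov f1_bot ur; have ur2 := root_imset f2_cov f2_bot ur.
  suff -> : s = s' by []; apply: (lamQ_desc_inj ur ss ss' ds ds').
    apply: (saturated_set_inj p1 p1').
    apply: (D1 _ _ _ _ (saturated_le p1) ur1); try exact: saturated_maxchain; try eassumption.
      by rewrite /descending (label_wordE _ p1) ?root_mem.
    by rewrite /descending (label_wordE _ p1') ?root_mem.
  apply: (saturated_set_inj p2 p2').
  apply: (D2 _ _ _ _ (saturated_le p2) ur2); try exact: saturated_maxchain; try eassumption.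
    by rewrite /descending (label_wordE _ p2) ?root_mem.
  by rewrite /descending (label_wordE _ p2') ?root_mem.
- move=> st st' c lt _; exact: (bdry_product f_le f1_bot f2_bot f1_top f2_top f1_cov
    f2_cov f_dense rk1 rk2 rkS1 rkS2 SigmaE B1 B2 lt).
- exact: (union_product f_le SigmaE U1 U2).
Qed.

End CedProduct.

Section Times.
Context {d1 d2 : Order.disp_t} {P1 : finTBPOrderType d1} {P2 : finTBPOrderType d2}.
Implicit Types u v : P1 *p P2.

Lemma prod_dense c1 c2 u v : maxchain [set: P1] c1 -> maxchain [set: P2] c2 ->
  pr1 u \in c1 -> pr2 u \in c2 -> pr1 v \in c1 -> pr2 v \in c2 ->
  u < v -> ~~ covers u v ->
  exists z : P1 *p P2, [/\ u < z, z < v, pr1 z \in c1 & pr2 z \in c2].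
Proof.
case: u v => [u1 u2] [v1 v2] m1 m2; rewrite /pr1 /pr2 /= => a1 a2 b1 b2.
rewrite prod_lt leEprod /= => /andP[/andP[l1 l2] n] ncov.
have [E1|n1] := eqVneq u1 v1.
  rewrite E1 /pr1 /pr2 /= eqxx /= in n ncov *.
  have lt2 : u2 < v2 by rewrite lt_neqAle n.
  have nc : ~~ covers u2 v2.
    by apply: contra ncov => H; apply/covers_prodP; right.
  have [z [zc z1 z2]] := maxchain_gap m2 a2 b2 lt2 nc.
  exists (v1, z); rewrite !prod_lt !leEprod /pr1 /pr2 /= !lexx !ltW // b1 zc.
  by rewrite (lt_eqF z1) (lt_eqF z2) !orbT.
have [E2|n2] := eqVneq u2 v2.
  rewrite E2 in ncov *.
  have lt1 : u1 < v1 by rewrite lt_neqAle n1.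
  have nc : ~~ covers u1 v1.
    by apply: contra ncov => H; apply/covers_prodP; left.
  have [z [zc z1 z2]] := maxchain_gap m1 a1 b1 lt1 nc.
  exists (z, v2); rewrite !prod_lt !leEprod /pr1 /pr2 /= !lexx !ltW // b2 zc.
  by rewrite (lt_eqF z1) (lt_eqF z2).
exists (u1, v2); rewrite !prod_lt !leEprod /pr1 /pr2 /= !lexx l1 l2 n1 n2 orbT.
by split.
Qed.

End Times.

(** * The three products *)

Section TimesCed.
Context {R : realType} {d1 d2 e1 e2 dL : Order.disp_t} {P1 : finTBPOrderType d1}
  {P2 : finTBPOrderType d2} {I1 : finOrderType e1} {I2 : finOrderType e2}
  {L : porderType dL}.
Variables (k1 k2 : nat) (Sigma1 : I1 -> {set P1}) (Sigma2 : I2 -> {set P2}).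
Variables (lam1 : labeling P1 L) (lam2 : labeling P2 L) (S : bool -> {pred L}).
Hypotheses (ced1 : CL_ced_of_rank R k1 lam1 Sigma1)
           (ced2 : CL_ced_of_rank R k2 lam2 Sigma2).
Hypothesis Sdisj : forall i a, a \in S i -> a \in S (~~ i) -> False.
Hypothesis Scmp : forall i, {in S i & S (~~ i), forall a b, a >=< b}.
Hypotheses (lamS1 : labels_in lam1 (S true)) (lamS2 : labels_in lam2 (S false)).

Local Notation X := (P1 *p P2).

Lemma prod_rooted (u : X) r : is_root u r -> rooted u r.
Proof.
by move=> ur; split; [apply: (root_imset (@covers_pr1 _ _ _ _)) ur
                     |apply: (root_imset (@covers_pr2 _ _ _ _)) ur].
Qed.

Let g : X -> X := id.
Let D : pred X := predT.
Let g_le (u v : X) : (u <= v) = (g u <= g v). Proof. by []. Qed.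
Let D_conv (u v w : X) : D u -> D v -> u <= w -> w <= v -> D w. Proof. by []. Qed.
Let D_surj (u v x : X) : D u -> D v -> g u <= x -> x <= g v -> exists2 w, D w & g w = x.
Proof. by exists x. Qed.
Let sg_le (a b : L) : (id a <= id b) = (a <= b). Proof. by []. Qed.
Let lamQE r (u v : X) : D u -> D v ->
  times_labeling lam1 lam2 r u v = id (times_labeling lam1 lam2 (g @: r) (g u) (g v)).
Proof. by move=> _ _; rewrite imset_id. Qed.

Lemma times_ced : CL_ced R (times_labeling lam1 lam2)
  (fun st : I1 *l I2 => times_set (Sigma1 st.1) (Sigma2 st.2)).
Proof.
have [C1 rk1 rkS1 T1 _ _ _] := ced1; have [C2 rk2 rkS2 T2 _ _ _] := ced2.
exists (k1 + k2)%N.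
have SE st (u : X) : (u \in times_set (Sigma1 st.1) (Sigma2 st.2)) =
    (pr1 u \in Sigma1 st.1) && (pr2 u \in Sigma2 st.2).
  by rewrite inE.
have f_le (u v : X) : (u <= v) = (pr1 u <= pr1 v) && (pr2 u <= pr2 v).
  exact: leEprod.
apply: (ced_product (f1 := pr1) (f2 := pr2) f_le _ _ _ _ (@covers_pr1 _ _ _ _)
  (@covers_pr2 _ _ _ _) (@prod_dense _ _ _ _) ced1 ced2 _ SE) => //.
- apply: path_rank => s ss; have /andP[ps _] := ss; rewrite (size_projs ps).
  have q1 := proj_saturated (@covers_pr1 _ _ _ _) ss.
  have q2 := proj_saturated (@covers_pr2 _ _ _ _) ss.
  by rewrite (rank_path rk1 q1) (rank_path rk2 q2).
- apply/CL_labelingP => u v r uv /prod_rooted ur; have [r1 r2] := ur.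
  move: uv; rewrite f_le => /andP[uv1 uv2].
  have [s1 H1] := (CL_labelingP lam1).1 C1 _ _ _ uv1 r1.
  have [s2 H2] := (CL_labelingP lam2).1 C2 _ _ _ uv2 r2.
  have H1' : CL_path lam1 (pr1 @: (g @: r)) (pr1 (g u)) (pr1 (g v)) s1 by rewrite imset_id.
  have H2' : CL_path lam2 (pr2 @: (g @: r)) (pr2 (g u)) (pr2 (g v)) s2 by rewrite imset_id.
  have ur' : rooted (g u) (g @: r) by rewrite imset_id.
  have [s [Hs _ _]] := emb_CL_path g_le D_conv D_surj sg_le Sdisj Scmp lamS1 lamS2
    lamQE rk1 rk2 (u := u) (v := v) isT isT ur' H1' H2'.
  by exists s.
- move=> st; apply: (join_polytope (f1 := pr1) (f2 := pr2) f_le _ _ (T1 st.1) (T2 st.2)).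
    by move=> u; rewrite SE.
  by move=> x1 x2 H1 H2; exists (x1, x2); rewrite ?SE ?H1.
- move=> u v r s /prod_rooted ur ss ds.
  have ur' : rooted (g u) (g @: r) by rewrite imset_id.
  have := emb_descending g_le D_conv D_surj sg_le Scmp lamS1 lamS2 lamQE
    (u := u) (v := v) isT isT ur' ss ds.
  by rewrite imset_id map_id.
- move=> u v r s s' /prod_rooted ur ss ss' ds ds' E1 E2.
  have ur' : rooted (g u) (g @: r) by rewrite imset_id.
  by apply: (emb_descending_inj g_le D_conv D_surj sg_le Scmp lamS1 lamS2 lamQE
    (u := u) (v := v) isT isT ur' ss ss' ds ds'); rewrite !map_id.
Qed.

End TimesCed.

Section Blocks.
Context {dL : Order.disp_t} {L : porderType dL}.
Implicit Types (a b c : L).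
Local Notation block := (nth (xpred0 : {pred L})).

Lemma increasing_blocks_lt (Bs : seq {pred L}) i j a b : increasing_blocks Bs ->
  (i < j)%N -> (j < size Bs)%N -> a \in block Bs i -> b \in block Bs j -> a < b.
Proof.
elim: Bs i j => // B Bs IH [|i] [|j] //= [H HB].
  rewrite ltnS => _ jB aB bB; apply: H => //.
  rewrite inE; apply/(has_nthP (xpred0 : {pred L})); by exists j.
by rewrite !ltnS; apply: IH.
Qed.

Variables S1m S2m S1A S2A S1p S2p : {pred L}.
Hypothesis incB : increasing_blocks [:: S1m; S2m; S1A; S2A; S1p; S2p].
Let lt_ij i j a b := @increasing_blocks_lt [:: S1m; S2m; S1A; S2A; S1p; S2p] i j a b incB.

Lemma block_cmp a b c : a \in S1A -> b \in S2A ->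
  (c \in [predU S1m & S1p]) || (c \in [predU S2m & S2p]) ->
  a < c /\ b < c \/ c < a /\ c < b.
Proof.
move=> a2 b3; rewrite !inE => /orP[]/orP[] H.
- by right; split; [apply: (lt_ij (i := 0) (j := 2))|apply: (lt_ij (i := 0) (j := 3))].
- by left; split; [apply: (lt_ij (i := 2) (j := 4))|apply: (lt_ij (i := 3) (j := 4))].
- by right; split; [apply: (lt_ij (i := 1) (j := 2))|apply: (lt_ij (i := 1) (j := 3))].
- by left; split; [apply: (lt_ij (i := 2) (j := 5))|apply: (lt_ij (i := 3) (j := 5))].
Qed.

Lemma block_total a b : a \in [predU S1m & [predU S1A & S1p]] ->
  b \in [predU S2m & [predU S2A & S2p]] -> a >=< b.
Proof.
have lt i j : (i < j)%N -> (j < 6)%N ->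
    a \in block [:: S1m; S2m; S1A; S2A; S1p; S2p] i ->
    b \in block [:: S1m; S2m; S1A; S2A; S1p; S2p] j -> a >=< b.
  by move=> ij j6 ai bj; rewrite /Order.comparable (ltW (lt_ij ij j6 ai bj)).
have gt i j : (j < i)%N -> (i < 6)%N ->
    a \in block [:: S1m; S2m; S1A; S2A; S1p; S2p] i ->
    b \in block [:: S1m; S2m; S1A; S2A; S1p; S2p] j -> a >=< b.
  by move=> ij j6 ai bj; rewrite /Order.comparable (ltW (lt_ij ij j6 bj ai)) orbT.
rewrite !inE => /or3P[] Ha /or3P[] Hb.
- exact: (lt 0 1).
- exact: (lt 0 3).
- exact: (lt 0 5).
- exact: (gt 2 1).
- exact: (lt 2 3).
- exact: (lt 2 5).
- exact: (gt 4 1).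
- exact: (gt 4 3).
- exact: (lt 4 5).
Qed.

End Blocks.

Section ProductEdges.
Context {d1 d2 dL : Order.disp_t} {P1 : finTBPOrderType d1} {P2 : finTBPOrderType d2}.
Context {L : porderType dL} (lam1 : labeling P1 L) (lam2 : labeling P2 L).
Implicit Types (u v : P1 *p P2) (s : seq (P1 *p P2)) (r : {set P1 *p P2}).

Lemma times_label_in (T1 T2 : {pred L}) r u v : covers u v -> rooted u r ->
  (forall x, is_root (pr1 u) x -> covers (pr1 u) (pr1 v) -> lam1 x (pr1 u) (pr1 v) \in T1) ->
  (forall x, is_root (pr2 u) x -> covers (pr2 u) (pr2 v) -> lam2 x (pr2 u) (pr2 v) \in T2) ->
  (times_labeling lam1 lam2 r u v \in T1) || (times_labeling lam1 lam2 r u v \in T2).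
Proof.
move=> /covers_prodP H [r1 r2] H1 H2; rewrite /times_labeling -/(pr1 u) -/(pr1 v).
case: H => -[a b]; first by rewrite a H1.
by rewrite a covers_irr H2 // orbT.
Qed.

Lemma times_head_part r u v s : covers u v -> path covers v s -> rooted u r ->
  (exists w, word lam1 (pr1 @: r) (pr1 u) (proj pr1 u (v :: s)) =
     times_labeling lam1 lam2 r u v :: w) \/
  (exists w, word lam2 (pr2 @: r) (pr2 u) (proj pr2 u (v :: s)) =
     times_labeling lam1 lam2 r u v :: w).
Proof.
move=> uv ps ru; have pus : path covers u (v :: s) by rewrite /= uv.
rewrite -(part_tword1 lam1 lam2 pus ru) -(part_tword2 lam1 lam2 pus ru) [tword _ _ _ _ _]/= !part_cons.
by case: covers; [left|right]; eexists.
Qed.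

Lemma times_last_part r u v s : path covers u (rcons s v) -> rooted u r ->
  let c := times_labeling lam1 lam2 (r :|: [set z in s]) (last u s) v in
  (exists w, word lam1 (pr1 @: r) (pr1 u) (proj pr1 u (rcons s v)) = rcons w c) \/
  (exists w, word lam2 (pr2 @: r) (pr2 u) (proj pr2 u (rcons s v)) = rcons w c).
Proof.
move=> pus ru c; rewrite -(part_tword1 lam1 lam2 pus ru) -(part_tword2 lam1 lam2 pus ru).
have -> : tword lam1 lam2 r u (rcons s v) =
    rcons (tword lam1 lam2 r u s) (covers (pr1 (last u s)) (pr1 v), c).
  rewrite /c; elim: s r u {pus ru c} => [|z s IH] r u /=.
    by congr [:: (_, times_labeling _ _ _ _ _)]; apply/setP=> x; rewrite !inE orbF.
  rewrite IH; congr (_ :: rcons _ (_, times_labeling _ _ _ _ _)).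
  by apply/setP=> x; rewrite !inE -orbA orbCA.
rewrite /part !filter_rcons /=.
by case: covers; [left|right]; rewrite map_rcons; eexists.
Qed.

End ProductEdges.

Section CheckProd.
Context {d1 d2 : Order.disp_t} {P1 : finTBPOrderType d1} {P2 : finTBPOrderType d2}.
Local Notation X := (P1 *p P2).
Local Notation Q := (check_prod P1 P2).
Implicit Types (u v w : Q) (x : X).

Definition check_pr1 u : P1 := pr1 (val u).
Definition check_pr2 u : P2 := pr2 (val u).

Lemma check_leE u v : (u <= v) = (val u <= val v). Proof. by []. Qed.

Lemma check_le u v : (u <= v) = (check_pr1 u <= check_pr1 v) && (check_pr2 u <= check_pr2 v).
Proof. by rewrite check_leE leEprod. Qed.

Lemma check_ext u v : check_pr1 u = check_pr1 v -> check_pr2 u = check_pr2 v -> u = v.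
Proof. by move=> E1 E2; apply: le_anti; rewrite !check_le E1 E2 !lexx. Qed.

Lemma check_bot12 u : (check_pr1 u == \bot) = (check_pr2 u == \bot).
Proof. case: u => x Hx. exact: (eqP Hx). Qed.

Lemma check_eq_bot u : (u == \bot) = (check_pr1 u == \bot).
Proof.
apply/eqP/idP => [->|E1]; first by rewrite /check_pr1 eqxx.
have := E1; rewrite check_bot12 => /eqP E2; move/eqP: E1 => E1.
by apply: le_anti; rewrite check_le E1 E2 !le0x.
Qed.

Lemma check_of x : (pr1 x == \bot) = (pr2 x == \bot) -> exists u, val u = x.
Proof. by move=> Hx; exists (exist _ x (introT eqP Hx)). Qed.

Lemma check_conv u v w : u != \bot -> v != \bot -> u <= w -> w <= v -> w != \bot.
Proof.
by move=> u0 _ uw _; apply: contra u0 => /eqP E; rewrite E lex0 in uw.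
Qed.

Lemma check_surj u v x : u != \bot -> v != \bot -> val u <= x -> x <= val v ->
  exists2 w : Q, w != \bot & val w = x.
Proof.
move=> u0 _ ux _; have := ux; rewrite leEprod => /andP[l1 l2].
have x1 : pr1 x != \bot.
  rewrite check_eq_bot in u0; apply: contra u0 => /eqP E.
  by rewrite -lex0 -E.
have x2 : pr2 x != \bot.
  rewrite check_eq_bot check_bot12 in u0; apply: contra u0 => /eqP E.
  by rewrite -lex0 -E.
have /check_of[w Ew] : (pr1 x == \bot) = (pr2 x == \bot).
  by rewrite (negPf x1) (negPf x2).
by exists w => //; rewrite check_eq_bot /check_pr1 Ew.
Qed.

Lemma check_cov_bot v : covers \bot v <->
  covers \bot (check_pr1 v) /\ covers \bot (check_pr2 v).
Proof.
have p10 : check_pr1 \bot = \bot by [].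
have p20 : check_pr2 \bot = \bot by [].
split=> [/coversP[lt H]|[/coversP[lt1 H1] /coversP[lt2 H2]]].
  have v0 : v != \bot by rewrite eq_sym lt_eqF.
  have v1 : check_pr1 v != \bot by rewrite -check_eq_bot.
  have v2 : check_pr2 v != \bot by rewrite -check_bot12.
  split; apply/coversP; rewrite lt0x; split=> // z z0 zv.
    have /check_of[w Ew] : (pr1 ((z, check_pr2 v) : X) == \bot) = (pr2 ((z, check_pr2 v) : X) == \bot).
      by rewrite /pr1 /pr2 /= (negPf v2) gt_eqF.
    apply: (H w); first by rewrite lt0x check_eq_bot /check_pr1 Ew /pr1 gt_eqF.
    rewrite lt_neqAle check_le /check_pr1 /check_pr2 Ew /pr1 /pr2 /= ltW // lexx !andbT.
    by apply: contraTneq zv => <-; rewrite /check_pr1 Ew ltxx.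
  have /check_of[w Ew] : (pr1 ((check_pr1 v, z) : X) == \bot) = (pr2 ((check_pr1 v, z) : X) == \bot).
    by rewrite /pr1 /pr2 /= (negPf v1) gt_eqF.
  apply: (H w); first by rewrite lt0x check_eq_bot check_bot12 /check_pr2 Ew /pr2 gt_eqF.
  rewrite lt_neqAle check_le /check_pr1 /check_pr2 Ew /pr1 /pr2 /= lexx ltW // !andbT.
  by apply: contraTneq zv => <-; rewrite /check_pr2 Ew ltxx.
apply/coversP; split; first by rewrite lt0x check_eq_bot gt_eqF.
move=> w w0 wv; have := ltW wv; rewrite check_le => /andP[l1 l2].
have w1 : check_pr1 w != \bot by rewrite -check_eq_bot gt_eqF.
have w2 : check_pr2 w != \bot by rewrite -check_bot12.
have E1 : check_pr1 w = check_pr1 v.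
  by apply: (@covers_eqr _ _ \bot); [apply/coversP|rewrite lt0x|].
have E2 : check_pr2 w = check_pr2 v.
  by apply: (@covers_eqr _ _ \bot); [apply/coversP|rewrite lt0x|].
by move: wv; rewrite lt_leAnge !check_le E1 E2 !lexx.
Qed.

Lemma check_covers u v : u != \bot -> v != \bot -> covers u v = covers (val u) (val v).
Proof. exact: (emb_covers check_leE check_surj). Qed.

Lemma check_cov1 u v : covers u v ->
  check_pr1 u = check_pr1 v \/ covers (check_pr1 u) (check_pr1 v).
Proof.
have [->|u0 uv] := eqVneq u \bot; first by move=> /check_cov_bot[]; right.
have v0 : v != \bot by rewrite gt_eqF // (le_lt_trans (le0x u)) // covers_lt.
by apply: covers_pr1; rewrite -check_covers.
Qed.

Lemma check_cov2 u v : covers u v ->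
  check_pr2 u = check_pr2 v \/ covers (check_pr2 u) (check_pr2 v).
Proof.
have [->|u0 uv] := eqVneq u \bot; first by move=> /check_cov_bot[]; right.
have v0 : v != \bot by rewrite gt_eqF // (le_lt_trans (le0x u)) // covers_lt.
by apply: covers_pr2; rewrite -check_covers.
Qed.

Lemma check_dense c1 c2 u v :
  maxchain [set: P1] c1 -> maxchain [set: P2] c2 ->
  check_pr1 u \in c1 -> check_pr2 u \in c2 ->
  check_pr1 v \in c1 -> check_pr2 v \in c2 ->
  u < v -> ~~ covers u v ->
  exists z, [/\ u < z, z < v, check_pr1 z \in c1 & check_pr2 z \in c2].
Proof.
move=> m1 m2 u1 u2 v1 v2 uv nc.
have v0 : v != \bot by rewrite gt_eqF // (le_lt_trans (le0x u)).
have v10 : check_pr1 v != \bot by rewrite -check_eq_bot.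
have v20 : check_pr2 v != \bot by rewrite -check_bot12.
have [E|u0] := eqVneq u \bot; last first.
  have [|x [ux xv x1 x2]] := prod_dense m1 m2 u1 u2 v1 v2 uv.
    by rewrite -check_covers.
  have [w _ Ew] := check_surj u0 v0 (ltW ux) (ltW xv).
  exists w; rewrite /check_pr1 /check_pr2 Ew; split=> //.
    by rewrite (emb_lt check_leE) Ew.
  by rewrite (emb_lt check_leE) Ew.
have [z1 [z1c bz1 zv1]] := maxchain_atom m1 v1 v10.
have [z2 [z2c bz2 zv2]] := maxchain_atom m2 v2 v20.
have /check_of[w Ew] : (pr1 ((z1, z2) : X) == \bot) = (pr2 ((z1, z2) : X) == \bot).
  by rewrite /pr1 /pr2 /= !gt_eqF // covers_lt.
have w1 : check_pr1 w = z1 by rewrite /check_pr1 Ew.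
have w2 : check_pr2 w = z2 by rewrite /check_pr2 Ew.
rewrite E in nc *; exists w; split; rewrite ?w1 ?w2 //.
  by rewrite lt0x check_eq_bot w1 gt_eqF // covers_lt.
rewrite lt_neqAle check_le w1 w2 zv1 zv2 !andbT; apply: contra nc => /eqP <-.
by apply/check_cov_bot; rewrite w1 w2.
Qed.

Lemma check_top12 : \bot != \top :> P1 -> \bot != \top :> P2 ->
  check_pr1 \top = \top /\ check_pr2 \top = \top.
Proof.
move=> n1 n2; rewrite /check_pr1 /check_pr2.
have -> : val (\top : Q) = \top.
  rewrite -[\top in LHS]/(check_top P1 P2) val_insubd ifT //=.
  by rewrite !(eq_sym \top) (negPf n1) (negPf n2).
by [].
Qed.

Lemma check_point : \bot = \top :> P1 \/ \bot = \top :> P2 -> forall u v, u = v.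
Proof.
move=> H; suff E w : w = \bot by move=> u v; rewrite (E u) (E v).
apply/eqP; rewrite check_eq_bot.
by case: H => H; [|rewrite check_bot12]; rewrite -lex0 H lex1.
Qed.

Lemma in_check_set (A1 : {set P1}) (A2 : {set P2}) u : \bot \in A1 -> \bot \in A2 ->
  (u \in check_set A1 A2) = (check_pr1 u \in A1) && (check_pr2 u \in A2).
Proof.
move=> b1 b2; rewrite !inE -/(pr1 _) -/(pr2 _) -/(check_pr1 u) -/(check_pr2 u).
rewrite -check_bot12 -check_eq_bot; case: eqVneq => [->|_]; last by rewrite orbF.
by rewrite /= [check_pr1 _]/= b1 b2.
Qed.

End CheckProd.

Section SingletonWords.
Context {d : Order.disp_t} {L : porderType d}.
Implicit Types (a b c : L).

Definition letter a : seqlexi L := [:: a].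

Lemma letter_le a b : (letter a <= letter b) = (a <= b).
Proof. by rewrite /letter lexi_cons lexi0s implybT andbT. Qed.

Lemma letter_inj : injective letter.
Proof. by move=> a b []. Qed.

Lemma pair_le_letter a b c : ([:: a; b] <= letter c :> seqlexi L) = (a < c).
Proof. by rewrite lexi_cons lexis0 implybF -lt_leAnge. Qed.

Lemma letter_le_pair a b c : (letter c <= [:: a; b] :> seqlexi L) = (c <= a).
Proof. by rewrite lexi_cons lexi0s implybT andbT. Qed.

Lemma pair_le a b a' b' : a <= a' -> b <= b' -> ([:: a; b] <= [:: a'; b'] :> seqlexi L).
Proof. by move=> Ha Hb; rewrite !lexi_cons Ha Hb lexi0s !implybT. Qed.

Lemma sorted_cons (R : rel L) a w : sorted R w ->
  (forall h w', w = h :: w' -> R a h) -> sorted R (a :: w).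
Proof. by case: w => //= h w -> /(_ h w erefl) ->. Qed.

End SingletonWords.

Section CheckCed.
Context {R : realType} {d1 d2 e1 e2 dL : Order.disp_t} {P1 : finTBPOrderType d1}
  {P2 : finTBPOrderType d2} {I1 : finOrderType e1} {I2 : finOrderType e2}
  {L : porderType dL}.
Variables (k1 k2 : nat) (Sigma1 : I1 -> {set P1}) (Sigma2 : I2 -> {set P2}).
Variables (lam1 : labeling P1 L) (lam2 : labeling P2 L) (S : bool -> {pred L}).
Hypotheses (ced1 : CL_ced_of_rank R k1 lam1 Sigma1)
           (ced2 : CL_ced_of_rank R k2 lam2 Sigma2).
Hypothesis Sdisj : forall i a, a \in S i -> a \in S (~~ i) -> False.
Hypothesis Scmp : forall i, {in S i & S (~~ i), forall a b, a >=< b}.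
Hypotheses (lamS1 : labels_in lam1 (S true)) (lamS2 : labels_in lam2 (S false)).
Variables SA N : bool -> {pred L}.
Hypothesis AN_cmp : forall a b c, a \in SA true -> b \in SA false ->
  (c \in N true) || (c \in N false) -> a < c /\ b < c \/ c < a /\ c < b.
Hypothesis lamA1 : forall r x, is_root \bot r -> covers \bot x -> lam1 r \bot x \in SA true.
Hypothesis lamA2 : forall r x, is_root \bot r -> covers \bot x -> lam2 r \bot x \in SA false.
Hypothesis lamN1 : forall r x y, is_root x r -> covers x y -> x != \bot ->
  lam1 r x y \in N true.
Hypothesis lamN2 : forall r x y, is_root x r -> covers x y -> x != \bot ->
  lam2 r x y \in N false.
Hypotheses (nd1 : \bot != \top :> P1) (nd2 : \bot != \top :> P2).

Local Notation Q := (check_prod P1 P2).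
Let g : Q -> P1 *p P2 := val.
Let D : pred Q := fun u => u != \bot.
Let lamQ : labeling Q (seqlexi L) := check_labeling lam1 lam2.
Let lam := times_labeling lam1 lam2.
Let f1 := @check_pr1 _ _ P1 P2.
Let f2 := @check_pr2 _ _ P1 P2.
Let nle {d} {T : porderType d} : rel T := fun a b => ~~ (a <= b).

Let lamQE r u v : D u -> D v -> lamQ r u v = letter (lam (g @: r) (g u) (g v)).
Proof. by move=> Du _; rewrite /lamQ /check_labeling ifN. Qed.

Let imset1 (r : {set Q}) : f1 @: r = pr1 @: (g @: r).
Proof. by rewrite -imset_comp. Qed.

Let imset2 (r : {set Q}) : f2 @: r = pr2 @: (g @: r).
Proof. by rewrite -imset_comp. Qed.

Let proj1E u s : proj f1 u s = proj pr1 (g u) (map g s).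
Proof. by rewrite proj_map. Qed.

Let proj2E u s : proj f2 u s = proj pr2 (g u) (map g s).
Proof. by rewrite proj_map. Qed.

Let rootedQ u (r : {set Q}) : is_root u r -> rooted (g u) (g @: r).
Proof.
move=> ur; rewrite /rooted -imset1 -imset2; split.
  exact: (root_imset (@check_cov1 _ _ _ _)).
exact: (root_imset (@check_cov2 _ _ _ _)).
Qed.

Let bot_path v z t : saturated \bot v (z :: t) ->
  [/\ D z, D v, covers \bot z, saturated z v t & saturated (g z) (g v) (map g t)].
Proof.
rewrite saturated_cons => /andP[bz ss].
have Dz : D z by rewrite /D gt_eqF // covers_lt.
have Dv : D v.
  by rewrite /D gt_eqF // (lt_le_trans (covers_lt bz)) // (saturated_le ss).
split=> //; exact: (emb_path (@check_leE _ _ _ _) (@check_conv _ _ _ _)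
  (@check_surj _ _ _ _) Dz Dv ss).1.
Qed.

Let bot_word v z t r : saturated \bot v (z :: t) -> is_root \bot r ->
  word lamQ r \bot (z :: t) =
  [:: lam1 (f1 @: r) \bot (f1 z); lam2 (f2 @: r) \bot (f2 z)] ::
  map letter (word lam (g @: (z |: r)) (g z) (map g t)).
Proof.
move=> ss rr; have [Dz Dv bz st _] := bot_path ss.
have aD := (emb_path (@check_leE _ _ _ _) (@check_conv _ _ _ _)
  (@check_surj _ _ _ _) Dz Dv st).2.
rewrite [word _ _ _ _]/= (emb_word lamQE) //; congr (_ :: _).
by rewrite /lamQ /check_labeling eqxx /pair_word imset1 imset2.
Qed.

Let bot_word1 v z t r : saturated \bot v (z :: t) -> is_root \bot r ->
  word lam1 (f1 @: r) \bot (proj f1 \bot (z :: t)) = lam1 (f1 @: r) \bot (f1 z) ::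
    word lam1 (pr1 @: (g @: (z |: r))) (pr1 (g z)) (proj pr1 (g z) (map g t)).
Proof.
move=> ss rr; have [Dz Dv bz st _] := bot_path ss.
have [bz1 _] := (check_cov_bot z).1 bz.
rewrite [proj _ _ _]/= ifN; last first.
  by rewrite -[f1 \bot]/(\bot : P1) lt_eqF // covers_lt.
by rewrite [LHS]/= proj1E !imsetU1 imset1.
Qed.

Let bot_word2 v z t r : saturated \bot v (z :: t) -> is_root \bot r ->
  word lam2 (f2 @: r) \bot (proj f2 \bot (z :: t)) = lam2 (f2 @: r) \bot (f2 z) ::
    word lam2 (pr2 @: (g @: (z |: r))) (pr2 (g z)) (proj pr2 (g z) (map g t)).
Proof.
move=> ss rr; have [Dz Dv bz st _] := bot_path ss.
have [_ bz2] := (check_cov_bot z).1 bz.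
rewrite [proj _ _ _]/= ifN; last first.
  by rewrite -[f2 \bot]/(\bot : P2) lt_eqF // covers_lt.
by rewrite [LHS]/= proj2E !imsetU1 imset2.
Qed.

(* The second letter of the word lies entirely above or entirely below both
   middle blocks, since its edge does not start at the bottom. *)
Let second_letter v z x t r c w : saturated \bot v (z :: x :: t) -> is_root \bot r ->
  word lam (g @: (z |: r)) (g z) (map g (x :: t)) = c :: w ->
  let a := lam1 (f1 @: r) \bot (f1 z) in let b := lam2 (f2 @: r) \bot (f2 z) in
  a < c /\ b < c \/ c < a /\ c < b.
Proof.
move=> ss rr [<- _]; have [Dz Dv bz st /andP[/= /andP[zx _] _]] := bot_path ss.
have [bz1 bz2] := (check_cov_bot z).1 bz.
have rz := rootedQ (root_covers bz rr).
have r1 := root_imset (@check_cov1 _ _ _ _) erefl rr.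
have r2 := root_imset (@check_cov2 _ _ _ _) erefl rr.
apply: AN_cmp; [exact: lamA1|exact: lamA2|].
apply: times_label_in => // y yr yx; [apply: lamN1|apply: lamN2] => //.
  by rewrite -[pr1 _]/(check_pr1 z) -check_eq_bot.
by rewrite -[pr2 _]/(check_pr2 z) -check_bot12 -check_eq_bot.
Qed.

Let bot_increasing v z t r : saturated \bot v (z :: t) -> is_root \bot r ->
  sorted <=%O (word lamQ r \bot (z :: t)) ->
  [/\ sorted <=%O (word lam (g @: (z |: r)) (g z) (map g t)),
      sorted <=%O (word lam1 (f1 @: r) \bot (proj f1 \bot (z :: t)))
    & sorted <=%O (word lam2 (f2 @: r) \bot (proj f2 \bot (z :: t)))].
Proof.
move=> ss rr; have [Dz Dv bz st /andP[gt _]] := bot_path ss.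
have rz := rootedQ (root_covers bz rr).
rewrite (bot_word ss rr) (bot_word1 ss rr) (bot_word2 ss rr) => H.
have oW : sorted <=%O (word lam (g @: (z |: r)) (g z) (map g t)).
  by rewrite -(sorted_map_le letter_le) (path_sorted H).
have [o1 o2] := times_sorted lamS1 lamS2 (shuffle_le_trans (S := S)) rz gt oW.
split=> //.
  case: t ss H gt oW o1 {o2 st} => [|x t] // ss H gt oW o1.
  have [c [w EW]] : exists c w,
      word lam (g @: (z |: r)) (g z) (map g (x :: t)) = c :: w by do 2!eexists.
  rewrite EW in H.
  apply: sorted_cons => // h w' Eh.
  have [/(_ h w' Eh) hc _] := times_head lamS1 lamS2 (shuffle_le_trans (S := S)) rz gt oW EW.
  move: H; rewrite /= pair_le_letter => /andP[ac _].
  by case: hc => [->|]; [exact: ltW|exact: le_trans (ltW ac)].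
case: t ss H gt oW o2 {o1 st} => [|x t] // ss H gt oW o2.
have [c [w EW]] : exists c w,
      word lam (g @: (z |: r)) (g z) (map g (x :: t)) = c :: w by do 2!eexists.
  rewrite EW in H.
apply: sorted_cons => // h w' Eh.
have [_ /(_ h w' Eh) hc] := times_head lamS1 lamS2 (shuffle_le_trans (S := S)) rz gt oW EW.
move: H; rewrite /= pair_le_letter => /andP[ac _].
have bc : lam2 (f2 @: r) \bot (f2 z) < c.
  by case: (second_letter ss rr EW) => [[] //|[ca _]]; rewrite (lt_gtF ac) in ca.
by case: hc => [->|]; [exact: ltW|exact: le_trans (ltW bc)].
Qed.

Let bot_increasing_conv v z t r : saturated \bot v (z :: t) -> is_root \bot r ->
  sorted <=%O (word lam (g @: (z |: r)) (g z) (map g t)) ->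
  sorted <=%O (word lam1 (f1 @: r) \bot (proj f1 \bot (z :: t))) ->
  sorted <=%O (word lam2 (f2 @: r) \bot (proj f2 \bot (z :: t))) ->
  sorted <=%O (word lamQ r \bot (z :: t)).
Proof.
move=> ss rr oW; rewrite (bot_word ss rr) (bot_word1 ss rr) (bot_word2 ss rr) => o1 o2.
apply: (@sorted_cons _ (seqlexi L)); first by rewrite (sorted_map_le letter_le).
case: t ss oW o1 o2 => [|x t] // ss oW o1 o2 h w'.
have [Dz Dv bz st /andP[/= /andP[zx gt] _]] := bot_path ss.
have rz := rootedQ (root_covers bz rr).
have [c [w EW]] : exists c w,
      word lam (g @: (z |: r)) (g z) (map g (x :: t)) = c :: w by do 2!eexists.
have cE : lam (g @: (z |: r)) (g z) (g x) = c by case: EW.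
rewrite cE => -[<- _]; rewrite pair_le_letter.
case: (second_letter ss rr EW) => [[] //|[ca cb]].
have := times_head_part lam1 lam2 zx gt rz.
rewrite -/lam cE.
case=> -[w'' E].
  by move: o1; rewrite [map _ _]/= E => /andP[/le_lt_trans/(_ ca)]; rewrite ltxx.
by move: o2; rewrite [map _ _]/= E => /andP[/le_lt_trans/(_ cb)]; rewrite ltxx.
Qed.

Let bot_descending v z t r : saturated \bot v (z :: t) -> is_root \bot r ->
  sorted nle (word lamQ r \bot (z :: t)) ->
  [/\ sorted nle (word lam (g @: (z |: r)) (g z) (map g t)),
      sorted nle (word lam1 (f1 @: r) \bot (proj f1 \bot (z :: t)))
    & sorted nle (word lam2 (f2 @: r) \bot (proj f2 \bot (z :: t)))].
Proof.
move=> ss rr; have [Dz Dv bz st /andP[gt _]] := bot_path ss.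
have rz := rootedQ (root_covers bz rr).
rewrite (bot_word ss rr) (bot_word1 ss rr) (bot_word2 ss rr) => H.
have oW : sorted nle (word lam (g @: (z |: r)) (g z) (map g t)).
  by rewrite -(sorted_map_nle letter_le) (path_sorted H).
have [o1 o2] := times_sorted lamS1 lamS2 (shuffle_nle_trans Scmp) rz gt oW.
have lt_nle (x c h : L) : c < x -> h = c \/ nle c h -> nle x h.
  move=> cx [->|]; first by rewrite /nle lt_geF.
  by apply: contra; apply: le_trans (ltW cx).
have low x t' c w : t = x :: t' -> word lam (g @: (z |: r)) (g z) (map g t) = c :: w ->
    c < lam1 (f1 @: r) \bot (f1 z) /\ c < lam2 (f2 @: r) \bot (f2 z).
  move=> Et EW; rewrite EW in H; rewrite Et in ss EW.
  move: H; rewrite /= /nle pair_le_letter => /andP[/negP nac _].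
  by case: (second_letter ss rr EW) => [[]|].
split=> //; apply: sorted_cons => // h w' Eh.
  case: t low Eh gt oW {o1 o2 ss H st} => [|x t] // low Eh gt oW.
  have [c [w EW]] : exists c w,
      word lam (g @: (z |: r)) (g z) (map g (x :: t)) = c :: w by do 2!eexists.
  have [/(_ h w' Eh) hc _] := times_head lamS1 lamS2 (shuffle_nle_trans Scmp) rz gt oW EW.
  by apply: lt_nle hc; have [] := low _ _ _ _ erefl EW.
case: t low Eh gt oW {o1 o2 ss H st} => [|x t] // low Eh gt oW.
have [c [w EW]] : exists c w,
      word lam (g @: (z |: r)) (g z) (map g (x :: t)) = c :: w by do 2!eexists.
have [_ /(_ h w' Eh) hc] := times_head lamS1 lamS2 (shuffle_nle_trans Scmp) rz gt oW EW.
by apply: lt_nle hc; have [] := low _ _ _ _ erefl EW.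
Qed.

Let bot_desc_inj v z z' t t' r : is_root \bot r ->
  saturated \bot v (z :: t) -> saturated \bot v (z' :: t') ->
  sorted nle (word lamQ r \bot (z :: t)) -> sorted nle (word lamQ r \bot (z' :: t')) ->
  proj f1 \bot (z :: t) = proj f1 \bot (z' :: t') ->
  proj f2 \bot (z :: t) = proj f2 \bot (z' :: t') -> z :: t = z' :: t'.
Proof.
move=> rr ss ss'; have [Dz Dv bz st _] := bot_path ss.
have [Dz' _ bz' st' _] := bot_path ss'.
rewrite (bot_word ss rr) (bot_word ss' rr) => ds ds'.
have [bz1 bz2] := (check_cov_bot z).1 bz; have [bz1' bz2'] := (check_cov_bot z').1 bz'.
rewrite /= !ifN; try by rewrite lt_eqF // covers_lt.
move=> [E1 F1] [E2 F2].
have Ez : z = z' by exact: check_ext.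
rewrite -{}Ez {z' E1 E2 bz' bz1' bz2' Dz' ss'} in ds' F1 F2 st' *; congr (_ :: _).
have rz := rootedQ (root_covers bz rr).
have aD s : saturated z v s -> word lamQ (z |: r) z s =
    map letter (word lam (g @: (z |: r)) (g z) (map g s)).
  move=> sz; rewrite (emb_word lamQE) //.
  exact: (emb_path (@check_leE _ _ _ _) (@check_conv _ _ _ _)
    (@check_surj _ _ _ _) Dz Dv sz).2.
apply: (emb_descending_inj (@check_leE _ _ _ _) (@check_conv _ _ _ _)
  (@check_surj _ _ _ _) letter_le Scmp lamS1 lamS2 lamQE Dz Dv rz st st').
- by rewrite aD //; exact: path_sorted ds.
- by rewrite aD //; exact: path_sorted ds'.
- by rewrite -!proj1E.
- by rewrite -!proj2E.
Qed.

Let rk1 : has_rank [set: P1] k1. Proof. by case: ced1. Qed.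
Let rk2 : has_rank [set: P2] k2. Proof. by case: ced2. Qed.

Lemma CL_path_behead (d : Order.disp_t) (P : finTBPOrderType d) (mu : labeling P L)
    r x y z t : CL_labeling mu -> is_root x r -> CL_path mu r x y (z :: t) ->
  CL_path mu (z |: r) z y t.
Proof.
move=> /CL_labelingP C rx [/andP[/= /andP[xz pt] lt] o _ _].
have st : saturated z y t by rewrite /saturated pt.
have [t0 Ht0] := C _ _ _ (saturated_le st) (root_covers xz rx).
by have [_ _ /(_ t st (path_sorted o)) -> _] := Ht0.
Qed.

Let bot_CL v r : is_root \bot r -> v != \bot -> exists s, CL_path lamQ r \bot v s.
Proof.
move=> rr Dv; have [C1 _ _ _ _ _ _] := ced1; have [C2 _ _ _ _ _ _] := ced2.
have v1 : f1 v != \bot by rewrite -check_eq_bot.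
have v2 : f2 v != \bot by rewrite -check_bot12.
have r1 := root_imset (@check_cov1 _ _ _ _) erefl rr.
have r2 := root_imset (@check_cov2 _ _ _ _) erefl rr.
have [s1 H1] := (CL_labelingP lam1).1 C1 _ _ _ (le0x (f1 v)) r1.
have [s2 H2] := (CL_labelingP lam2).1 C2 _ _ _ (le0x (f2 v)) r2.
case: s1 H1 => [|z1 t1] H1.
  by case: H1 => /andP[_ /eqP /= E] _ _ _; rewrite -E eqxx in v1.
case: s2 H2 => [|z2 t2] H2.
  by case: H2 => /andP[_ /eqP /= E] _ _ _; rewrite -E eqxx in v2.
have [ss1 o1 u1 l1] := H1; have [ss2 o2 u2 l2] := H2.
have /andP[/= /andP[bz1 _] _] := ss1; have /andP[/= /andP[bz2 _] _] := ss2.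
have /check_of[z Ez] : (pr1 ((z1, z2) : P1 *p P2) == \bot) = (pr2 ((z1, z2) : P1 *p P2) == \bot).
  by rewrite /pr1 /pr2 /= !gt_eqF // covers_lt.
have Ez1 : f1 z = z1 by rewrite /f1 /check_pr1 Ez.
have Ez2 : f2 z = z2 by rewrite /f2 /check_pr2 Ez.
have bz : covers \bot z by apply/check_cov_bot; rewrite -/f1 -/f2 -/(f1 z) -/(f2 z) Ez1 Ez2.
have Dz : D z by rewrite /D gt_eqF // covers_lt.
have rz := rootedQ (root_covers bz rr).
have T1 := CL_path_behead C1 r1 H1; have T2 := CL_path_behead C2 r2 H2.
rewrite -Ez1 -imsetU1 imset1 in T1; rewrite -Ez2 -imsetU1 imset2 in T2.
have [t [Ht Et1 Et2]] := emb_CL_path (@check_leE _ _ _ _) (@check_conv _ _ _ _)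
  (@check_surj _ _ _ _) letter_le Sdisj Scmp lamS1 lamS2 lamQE rk1 rk2 Dz Dv rz T1 T2.
have [st ot ut lt] := Ht.
have ss : saturated \bot v (z :: t).
  by move: st; rewrite /saturated /= bz.
have F1 : proj f1 \bot (z :: t) = z1 :: t1.
  by rewrite /= ifN ?proj1E ?Et1 ?Ez1 // lt_eqF // covers_lt.
have F2 : proj f2 \bot (z :: t) = z2 :: t2.
  by rewrite /= ifN ?proj2E ?Et2 ?Ez2 // lt_eqF // covers_lt.
have wE s : saturated z v s -> word lamQ (z |: r) z s =
    map letter (word lam (g @: (z |: r)) (g z) (map g s)).
  move=> sz; rewrite (emb_word lamQE) //.
  exact: (emb_path (@check_leE _ _ _ _) (@check_conv _ _ _ _)
    (@check_surj _ _ _ _) Dz Dv sz).2.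
have oW : sorted <=%O (word lam (g @: (z |: r)) (g z) (map g t)).
  by rewrite -(sorted_map_le letter_le) -wE.
exists (z :: t); split; first exact: ss.
- by apply: (bot_increasing_conv ss rr oW); rewrite ?F1 ?F2.
- case=> [/andP[_ /eqP /= E]|z' t' ss' oQ]; first by rewrite -E eqxx in Dv.
  have [oW' o1' o2'] := bot_increasing ss' rr oQ.
  have q1 := proj_saturated (@check_cov1 _ _ _ _) ss'.
  have q2 := proj_saturated (@check_cov2 _ _ _ _) ss'.
  have G1 := u1 _ q1 o1'; have G2 := u2 _ q2 o2'.
  have [Dz' _ bz' st' _] := bot_path ss'.
  have [bz1' bz2'] := (check_cov_bot z').1 bz'.
  move: G1 G2; rewrite /= !ifN; try by rewrite lt_eqF // covers_lt.
  move=> [G1 _] [G2 _].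
  have Ezz : z' = z.
    by apply: check_ext; [exact: etrans G1 (esym Ez1)|exact: etrans G2 (esym Ez2)].
  rewrite Ezz in st' oW' *; congr (_ :: _); apply: ut => //.
  by rewrite wE // (sorted_map_le letter_le).
- case=> [/andP[_ /eqP /= E]|z' t' ss' ns]; first by rewrite -E eqxx in Dv.
  have q1 := proj_saturated (@check_cov1 _ _ _ _) ss'.
  have q2 := proj_saturated (@check_cov2 _ _ _ _) ss'.
  have [Dz' _ bz' st' gt'] := bot_path ss'.
  have rz' := rootedQ (root_covers bz' rr).
  have [_ _ _ _ gt] := bot_path ss.
  have le1 : (word lam1 (f1 @: r) \bot (z1 :: t1) : seqlexi L) <=
      word lam1 (f1 @: r) \bot (proj f1 \bot (z' :: t')).
    have [->|n1] := eqVneq (proj f1 \bot (z' :: t')) (z1 :: t1); first exact: lexx.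
    by apply: ltW; apply: l1.
  have le2 : (word lam2 (f2 @: r) \bot (z2 :: t2) : seqlexi L) <=
      word lam2 (f2 @: r) \bot (proj f2 \bot (z' :: t')).
    have [->|n2] := eqVneq (proj f2 \bot (z' :: t')) (z2 :: t2); first exact: lexx.
    by apply: ltW; apply: l2.
  have sz1 : size (proj f1 \bot (z' :: t')) = size (z1 :: t1) := graded rk1 q1 ss1.
  have sz2 : size (proj f2 \bot (z' :: t')) = size (z2 :: t2) := graded rk2 q2 ss2.
  have W1 := bot_word1 ss rr; have W2 := bot_word2 ss rr.
  have W1' := bot_word1 ss' rr; have W2' := bot_word2 ss' rr.
  have len1 : size (proj pr1 (g z) (map g t)) = size (proj pr1 (g z') (map g t')).
    have E := congr1 size W1; have E' := congr1 size W1'.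
    rewrite size_word F1 in E; rewrite size_word sz1 in E'.
    by have := etrans (esym E) E'; rewrite /= !size_word => -[].
  have len2 : size (proj pr2 (g z) (map g t)) = size (proj pr2 (g z') (map g t')).
    have E := congr1 size W2; have E' := congr1 size W2'.
    rewrite size_word F2 in E; rewrite size_word sz2 in E'.
    by have := etrans (esym E) E'; rewrite /= !size_word => -[].
  rewrite -F1 W1 W1' lexi_cons in le1; rewrite -F2 W2 W2' lexi_cons in le2.
  have {le1}[ha1 /implyP ht1] := andP le1; have {le2}[ha2 /implyP ht2] := andP le2.
  have /andP[pgt _] := gt; have /andP[pgt' _] := gt'.
  rewrite (bot_word ss rr) (bot_word ss' rr) lt_neqAle; apply/andP; split; last first.
    rewrite lexi_cons pair_le //=; apply/implyP; rewrite !lexi_cons => /andP[hb1].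
    rewrite ha1 /= => /andP[hb2 _]; rewrite (map_lexi letter_le).
    exact: (times_lexi_le Sdisj lamS1 lamS2 rz rz' pgt pgt' oW len1 len2
      (ht1 hb1) (ht2 hb2)).
  apply/eqP => -[Ea Eb /(inj_map letter_inj) Ew].
  have [Et V1 V2] := times_word_inj Sdisj lamS1 lamS2 rz rz' pgt pgt' Ew.
  have G1 : proj f1 \bot (z' :: t') = z1 :: t1.
    apply/eqP/negPn/negP => /(l1 _ q1).
    by rewrite -F1 W1 W1' Ea V1 ltxx.
  have G2 : proj f2 \bot (z' :: t') = z2 :: t2.
    apply/eqP/negPn/negP => /(l2 _ q2).
    by rewrite -F2 W2 W2' Eb V2 ltxx.
  case/eqP: ns; have [bz1' bz2'] := (check_cov_bot z').1 bz'.
  move: G1 G2; rewrite /= !ifN; try by rewrite lt_eqF // covers_lt.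
  move=> [G1 K1] [G2 K2].
  have Ezz : z' = z.
    by apply: check_ext; [exact: etrans G1 (esym Ez1)|exact: etrans G2 (esym Ez2)].
  rewrite Ezz in pgt' Et K1 K2 *; congr (_ :: _).
  apply: (inj_map (emb_inj (@check_leE _ _ _ _))).
  by apply: (tword_inj pgt' pgt (esym Et)); rewrite -?proj1E -?proj2E ?K1 ?K2 ?proj1E ?proj2E.
Qed.

Lemma check_ced : CL_ced R (check_labeling lam1 lam2)
  (fun st : I1 *l I2 => check_set (Sigma1 st.1) (Sigma2 st.2)).
Proof.
have [C1 _ rkS1 T1 _ _ _] := ced1; have [C2 _ rkS2 T2 _ _ _] := ced2.
have [t1 t2] := check_top12 nd1 nd2.
have b1 s : \bot \in Sigma1 s by have /andP[] := rank_bot_top rk1 (@rkS1 s).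
have b2 s : \bot \in Sigma2 s by have /andP[] := rank_bot_top rk2 (@rkS2 s).
have SE (st : I1 *l I2) (u : Q) : (u \in check_set (Sigma1 st.1) (Sigma2 st.2)) =
    (f1 u \in Sigma1 st.1) && (f2 u \in Sigma2 st.2) by exact: in_check_set.
have ndQ : \bot != \top :> Q by rewrite eq_sym check_eq_bot t1 eq_sym.
exists ((k1.-1 + k2.-1).+1).
apply: (ced_product (@check_le _ _ _ _) _ _ t1 t2 (@check_cov1 _ _ _ _)
  (@check_cov2 _ _ _ _) (@check_dense _ _ _ _) ced1 ced2 _ SE) => //.
- apply: path_rank => -[|z t] ss; first by case/andP: ss => _ ndQ'; rewrite (negPf ndQ) in ndQ'.
  have [Dz Dv bz st gt] := bot_path ss.
  have q1 := proj_saturated (@check_cov1 _ _ _ _) ss.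
  have q2 := proj_saturated (@check_cov2 _ _ _ _) ss.
  rewrite t1 in q1; rewrite t2 in q2.
  have := rank_path rk2 q2; have := rank_path rk1 q1.
  have [bz1 bz2] := (check_cov_bot z).1 bz.
  rewrite /= !ifN; try by rewrite lt_eqF // covers_lt.
  rewrite -/f1 -/f2 proj1E proj2E /= => <- <- /=.
  by have /andP[pgt _] := gt; rewrite -(size_projs pgt) size_map.
- apply/CL_labelingP => u v r uv ur.
  have [E|Du] := eqVneq u \bot.
    rewrite E in uv ur *; have [->|Dv] := eqVneq v \bot.
      by exists [::]; exact: CL_path_nil.
    exact: bot_CL.
  have Dv : D v by rewrite /D gt_eqF // (lt_le_trans _ uv) // lt0x.
  have rz := rootedQ ur; have [r1 r2] := rz.
  have := uv; rewrite check_le => /andP[uv1 uv2].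
  have [s1 H1] := (CL_labelingP lam1).1 C1 _ _ _ uv1 r1.
  have [s2 H2] := (CL_labelingP lam2).1 C2 _ _ _ uv2 r2.
  have [s [Hs _ _]] := emb_CL_path (@check_leE _ _ _ _) (@check_conv _ _ _ _)
    (@check_surj _ _ _ _) letter_le Sdisj Scmp lamS1 lamS2 lamQE rk1 rk2 Du Dv rz H1 H2.
  by exists s.
- move=> st; apply: (cartesian_polytope (@check_le _ _ _ _) _ (b1 st.1) (b2 st.2)
    (@check_bot12 _ _ _ _) _ (T1 st.1) (T2 st.2)).
    by move=> u; rewrite SE.
  move=> x1 x2 H1 H2 E12; have [u Eu] := @check_of _ _ _ _ (x1, x2) E12.
  have E1 : f1 u = x1 by rewrite /f1 /check_pr1 Eu.
  have E2 : f2 u = x2 by rewrite /f2 /check_pr2 Eu.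
  by exists u => //; rewrite SE E1 E2 H1.
- move=> u v r s ur ss ds; have [E|Du] := eqVneq u \bot.
    rewrite {}E in ur ss ds *; case: s ss ds => [|z t] ss ds; first by [].
    by have [_ o1 o2] := bot_descending ss ur ds.
  have Dv : D v by rewrite /D gt_eqF // (lt_le_trans _ (saturated_le ss)) // lt0x.
  rewrite -/f1 -/f2 imset1 imset2 proj1E proj2E.
  exact: (emb_descending (@check_leE _ _ _ _) (@check_conv _ _ _ _)
    (@check_surj _ _ _ _) letter_le Scmp lamS1 lamS2 lamQE Du Dv (rootedQ ur) ss ds).
- move=> u v r s s' ur ss ss' ds ds'; have [E|Du] := eqVneq u \bot.
    rewrite {}E in ur ss ss' ds ds' *.
    case: s ss ds => [|z t] ss ds; case: s' ss' ds' => [|z' t'] ss' ds' //.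
    + by move: ss => /andP[_ /eqP /= E]; rewrite -E in ss'; rewrite (saturated_refl ss').
    + by move: ss' => /andP[_ /eqP /= E]; rewrite -E in ss; rewrite (saturated_refl ss).
    + move=> E1 E2; exact: (bot_desc_inj ur ss ss' ds ds' E1 E2).
  have Dv : D v by rewrite /D gt_eqF // (lt_le_trans _ (saturated_le ss)) // lt0x.
  rewrite -/f1 -/f2 !proj1E !proj2E.
  exact: (emb_descending_inj (@check_leE _ _ _ _) (@check_conv _ _ _ _)
    (@check_surj _ _ _ _) letter_le Scmp lamS1 lamS2 lamQE Du Dv (rootedQ ur) ss ss' ds ds').
Qed.

End CheckCed.

Section HatProd.
Context {d1 d2 : Order.disp_t} {P1 : finTBPOrderType d1} {P2 : finTBPOrderType d2}.
Local Notation X := (P1 *p P2).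
Local Notation Q := (hat_prod P1 P2).
Implicit Types (u v w : Q) (x : X).

Definition hat_pr1 u : P1 := pr1 (val u).
Definition hat_pr2 u : P2 := pr2 (val u).

Lemma hat_leE u v : (u <= v) = (val u <= val v). Proof. by []. Qed.

Lemma hat_le u v : (u <= v) = (hat_pr1 u <= hat_pr1 v) && (hat_pr2 u <= hat_pr2 v).
Proof. by rewrite hat_leE leEprod. Qed.

Lemma hat_ext u v : hat_pr1 u = hat_pr1 v -> hat_pr2 u = hat_pr2 v -> u = v.
Proof. by move=> E1 E2; apply: le_anti; rewrite !hat_le E1 E2 !lexx. Qed.

Lemma hat_top12 u : (hat_pr1 u == \top) = (hat_pr2 u == \top).
Proof. case: u => x Hx; exact: (eqP Hx). Qed.

Lemma hat_eq_top u : (u == \top) = (hat_pr1 u == \top).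
Proof.
apply/eqP/idP => [->|E1]; first by rewrite /hat_pr1 eqxx.
have := E1; rewrite hat_top12 => /eqP E2; move/eqP: E1 => E1.
by apply: le_anti; rewrite !hat_le E1 E2 !lex1.
Qed.

Lemma hat_of x : (pr1 x == \top) = (pr2 x == \top) -> exists u, val u = x.
Proof. by move=> Hx; exists (exist _ x (introT eqP Hx)). Qed.

Lemma hat_conv u v w : u != \top -> v != \top -> u <= w -> w <= v -> w != \top.
Proof.
by move=> _ v1 _ wv; apply: contra v1 => /eqP E; rewrite E le1x in wv.
Qed.

Lemma hat_surj u v x : u != \top -> v != \top -> val u <= x -> x <= val v ->
  exists2 w : Q, w != \top & val w = x.
Proof.
move=> _ v1 _ xv; have := xv; rewrite leEprod => /andP[l1 l2].
have x1 : pr1 x != \top.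
  rewrite hat_eq_top in v1; apply: contra v1 => /eqP E.
  by rewrite -le1x -E.
have x2 : pr2 x != \top.
  rewrite hat_eq_top hat_top12 in v1; apply: contra v1 => /eqP E.
  by rewrite -le1x -E.
have /hat_of[w Ew] : (pr1 x == \top) = (pr2 x == \top).
  by rewrite (negPf x1) (negPf x2).
by exists w => //; rewrite hat_eq_top /hat_pr1 Ew.
Qed.

Lemma hat_cov_top v : covers v \top <->
  covers (hat_pr1 v) \top /\ covers (hat_pr2 v) \top.
Proof.
have p11 : hat_pr1 \top = \top by [].
have p21 : hat_pr2 \top = \top by [].
split=> [/coversP[lt H]|[/coversP[lt1 H1] /coversP[lt2 H2]]].
  have v0 : v != \top by rewrite lt_eqF.
  have v1 : hat_pr1 v != \top by rewrite -hat_eq_top.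
  have v2 : hat_pr2 v != \top by rewrite -hat_top12.
  split; apply/coversP; rewrite ltx1; split=> // z vz z1.
    have /hat_of[w Ew] : (pr1 ((z, hat_pr2 v) : X) == \top) = (pr2 ((z, hat_pr2 v) : X) == \top).
      by rewrite /pr1 /pr2 /= (negPf v2) lt_eqF.
    apply: (H w); last by rewrite ltx1 hat_eq_top /hat_pr1 Ew /pr1 lt_eqF.
    rewrite lt_neqAle hat_le /hat_pr1 /hat_pr2 Ew /pr1 /pr2 /= ltW // lexx !andbT.
    by apply: contraTneq vz => ->; rewrite /hat_pr1 Ew ltxx.
  have /hat_of[w Ew] : (pr1 ((hat_pr1 v, z) : X) == \top) = (pr2 ((hat_pr1 v, z) : X) == \top).
    by rewrite /pr1 /pr2 /= (negPf v1) lt_eqF.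
  apply: (H w); last by rewrite ltx1 hat_eq_top hat_top12 /hat_pr2 Ew /pr2 lt_eqF.
  rewrite lt_neqAle hat_le /hat_pr1 /hat_pr2 Ew /pr1 /pr2 /= lexx ltW // !andbT.
  by apply: contraTneq vz => ->; rewrite /hat_pr2 Ew ltxx.
apply/coversP; split; first by rewrite ltx1 hat_eq_top lt_eqF.
move=> w vw w0; have := ltW vw; rewrite hat_le => /andP[l1 l2].
have w1 : hat_pr1 w != \top by rewrite -hat_eq_top lt_eqF.
have w2 : hat_pr2 w != \top by rewrite -hat_top12.
have E1 : hat_pr1 w = hat_pr1 v.
  by apply: (@covers_eq _ _ _ \top); [apply/coversP| |rewrite ltx1].
have E2 : hat_pr2 w = hat_pr2 v.
  by apply: (@covers_eq _ _ _ \top); [apply/coversP| |rewrite ltx1].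
by move: vw; rewrite lt_leAnge !hat_le E1 E2 !lexx.
Qed.

Lemma hat_covers u v : u != \top -> v != \top -> covers u v = covers (val u) (val v).
Proof. exact: (emb_covers hat_leE hat_surj). Qed.

Lemma hat_cov1 u v : covers u v ->
  hat_pr1 u = hat_pr1 v \/ covers (hat_pr1 u) (hat_pr1 v).
Proof.
have [->|v0 uv] := eqVneq v \top; first by move=> /hat_cov_top[]; right.
have u0 : u != \top by rewrite lt_eqF // (lt_le_trans _ (lex1 v)) // covers_lt.
by apply: covers_pr1; rewrite -hat_covers.
Qed.

Lemma hat_cov2 u v : covers u v ->
  hat_pr2 u = hat_pr2 v \/ covers (hat_pr2 u) (hat_pr2 v).
Proof.
have [->|v0 uv] := eqVneq v \top; first by move=> /hat_cov_top[]; right.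
have u0 : u != \top by rewrite lt_eqF // (lt_le_trans _ (lex1 v)) // covers_lt.
by apply: covers_pr2; rewrite -hat_covers.
Qed.

Lemma hat_dense c1 c2 u v :
  maxchain [set: P1] c1 -> maxchain [set: P2] c2 ->
  hat_pr1 u \in c1 -> hat_pr2 u \in c2 ->
  hat_pr1 v \in c1 -> hat_pr2 v \in c2 ->
  u < v -> ~~ covers u v ->
  exists z, [/\ u < z, z < v, hat_pr1 z \in c1 & hat_pr2 z \in c2].
Proof.
move=> m1 m2 u1 u2 v1 v2 uv nc.
have u0 : u != \top by rewrite lt_eqF // (lt_le_trans uv) // lex1.
have u10 : hat_pr1 u != \top by rewrite -hat_eq_top.
have u20 : hat_pr2 u != \top by rewrite -hat_top12.
have [E|v0] := eqVneq v \top; last first.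
  have [|x [ux xv x1 x2]] := prod_dense m1 m2 u1 u2 v1 v2 uv.
    by rewrite -hat_covers.
  have [w _ Ew] := hat_surj u0 v0 (ltW ux) (ltW xv).
  exists w; rewrite /hat_pr1 /hat_pr2 Ew; split=> //.
    by rewrite (emb_lt hat_leE) Ew.
  by rewrite (emb_lt hat_leE) Ew.
have [z1 [z1c zt1 uz1]] := maxchain_coatom m1 u1 u10.
have [z2 [z2c zt2 uz2]] := maxchain_coatom m2 u2 u20.
have /hat_of[w Ew] : (pr1 ((z1, z2) : X) == \top) = (pr2 ((z1, z2) : X) == \top).
  by rewrite /pr1 /pr2 /= !lt_eqF // covers_lt.
have w1 : hat_pr1 w = z1 by rewrite /hat_pr1 Ew.
have w2 : hat_pr2 w = z2 by rewrite /hat_pr2 Ew.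
rewrite E in nc *; exists w; split; rewrite ?w1 ?w2 //; last first.
  by rewrite ltx1 hat_eq_top w1 lt_eqF // covers_lt.
rewrite lt_neqAle hat_le w1 w2 uz1 uz2 !andbT; apply: contra nc => /eqP ->.
by apply/hat_cov_top; rewrite w1 w2.
Qed.

Lemma hat_bot12 : \bot != \top :> P1 -> \bot != \top :> P2 ->
  hat_pr1 \bot = \bot /\ hat_pr2 \bot = \bot.
Proof.
move=> n1 n2; rewrite /hat_pr1 /hat_pr2.
have -> : val (\bot : Q) = \bot.
  rewrite -[\bot in LHS]/(hat_bot P1 P2) val_insubd ifT //=.
  by rewrite (negPf n1) (negPf n2).
by [].
Qed.

Lemma hat_point : \bot = \top :> P1 \/ \bot = \top :> P2 -> forall u v, u = v.
Proof.
move=> H; suff E w : w = \top by move=> u v; rewrite (E u) (E v).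
apply/eqP; rewrite hat_eq_top.
by case: H => H; [|rewrite hat_top12]; rewrite -le1x -H le0x.
Qed.

Lemma in_hat_set (A1 : {set P1}) (A2 : {set P2}) u : \top \in A1 -> \top \in A2 ->
  (u \in hat_set A1 A2) = (hat_pr1 u \in A1) && (hat_pr2 u \in A2).
Proof.
move=> b1 b2; rewrite !inE -/(pr1 _) -/(pr2 _) -/(hat_pr1 u) -/(hat_pr2 u).
rewrite -hat_top12 -hat_eq_top; case: eqVneq => [->|_]; last by rewrite orbF.
by rewrite /= [hat_pr1 _]/= b1 b2.
Qed.

End HatProd.

Lemma sorted_rcons2 (T : Type) (R : rel T) w c a :
  sorted R (rcons (rcons w c) a) = sorted R (rcons w c) && R c a.
Proof. by case: w => [|x w] /=; rewrite ?andbT // rcons_path last_rcons. Qed.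

Lemma sorted_rcons (T : Type) (R : rel T) w a : sorted R w ->
  (forall h w', w = rcons w' h -> R h a) -> sorted R (rcons w a).
Proof.
by case/lastP: w => // w h ow H; rewrite sorted_rcons2 ow (H h w).
Qed.

Lemma lexi_rcons (d : Order.disp_t) (L : porderType d) (w w' : seq L) x y :
  size w = size w' ->
  (rcons w x <= rcons w' y :> seqlexi L) =
  (w <= w' :> seqlexi L) && ((w' <= w :> seqlexi L) ==> (x <= y)).
Proof.
elim: w w' => [|a w IH] [|b w'] //=.
  by rewrite lexi_cons !lexi0s implybT andbT.
move=> [sz]; rewrite !lexi_cons IH //.
by case: (a <= b); case: (b <= a); rewrite ?andbF.
Qed.

Lemma imset_root (d dQ : Order.disp_t) (P : finTBPOrderType d) (Q : finTBPOrderType dQ)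
    (f : Q -> P) (u : Q) (r : {set Q}) (s : seq Q) : u \in r ->
  f @: (r :|: [set z in s]) = (f @: r) :|: [set z in proj f u s].
Proof.
move=> ur; have -> : r :|: [set z in s] = r :|: [set z in u :: s].
  apply/setP=> z; rewrite !inE; case: eqVneq => [->|//].
  by rewrite ur.
rewrite imsetU imset_proj; apply/setP=> z; rewrite !inE.
by case: eqVneq => [->|//]; rewrite imset_f.
Qed.

Section HatCed.
Context {R : realType} {d1 d2 e1 e2 dL : Order.disp_t} {P1 : finTBPOrderType d1}
  {P2 : finTBPOrderType d2} {I1 : finOrderType e1} {I2 : finOrderType e2}
  {L : porderType dL}.
Variables (k1 k2 : nat) (Sigma1 : I1 -> {set P1}) (Sigma2 : I2 -> {set P2}).
Variables (lam1 : labeling P1 L) (lam2 : labeling P2 L) (S : bool -> {pred L}).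
Hypotheses (ced1 : CL_ced_of_rank R k1 lam1 Sigma1)
           (ced2 : CL_ced_of_rank R k2 lam2 Sigma2).
Hypothesis Sdisj : forall i a, a \in S i -> a \in S (~~ i) -> False.
Hypothesis Scmp : forall i, {in S i & S (~~ i), forall a b, a >=< b}.
Hypotheses (lamS1 : labels_in lam1 (S true)) (lamS2 : labels_in lam2 (S false)).
Variables SA N : bool -> {pred L}.
Hypothesis AN_cmp : forall a b c, a \in SA true -> b \in SA false ->
  (c \in N true) || (c \in N false) -> a < c /\ b < c \/ c < a /\ c < b.
Hypothesis lamA1 : forall r x, is_root x r -> covers x \top -> lam1 r x \top \in SA true.
Hypothesis lamA2 : forall r x, is_root x r -> covers x \top -> lam2 r x \top \in SA false.
Hypothesis lamN1 : forall r x y, is_root x r -> covers x y -> y != \top ->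
  lam1 r x y \in N true.
Hypothesis lamN2 : forall r x y, is_root x r -> covers x y -> y != \top ->
  lam2 r x y \in N false.
Hypotheses (nd1 : \bot != \top :> P1) (nd2 : \bot != \top :> P2).

Local Notation Q := (hat_prod P1 P2).
Let g : Q -> P1 *p P2 := val.
Let D : pred Q := fun u => u != \top.
Let lamQ : labeling Q (seqlexi L) := hat_labeling lam1 lam2.
Let lam := times_labeling lam1 lam2.
Let f1 := @hat_pr1 _ _ P1 P2.
Let f2 := @hat_pr2 _ _ P1 P2.
Let nle {d} {T : porderType d} : rel T := fun a b => ~~ (a <= b).

Let lamQE r u v : D u -> D v -> lamQ r u v = letter (lam (g @: r) (g u) (g v)).
Proof. by move=> _ Dv; rewrite /lamQ /hat_labeling ifN. Qed.

Let imset1 (r : {set Q}) : f1 @: r = pr1 @: (g @: r).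
Proof. by rewrite -imset_comp. Qed.

Let imset2 (r : {set Q}) : f2 @: r = pr2 @: (g @: r).
Proof. by rewrite -imset_comp. Qed.

Let proj1E u s : proj f1 u s = proj pr1 (g u) (map g s).
Proof. by rewrite proj_map. Qed.

Let proj2E u s : proj f2 u s = proj pr2 (g u) (map g s).
Proof. by rewrite proj_map. Qed.

Let f1_bot : f1 \bot = \bot. Proof. by have [] := hat_bot12 nd1 nd2. Qed.
Let f2_bot : f2 \bot = \bot. Proof. by have [] := hat_bot12 nd1 nd2. Qed.

Let root1 u (r : {set Q}) : is_root u r -> is_root (f1 u) (f1 @: r).
Proof. exact: (root_imset (@hat_cov1 _ _ _ _) f1_bot). Qed.

Let root2 u (r : {set Q}) : is_root u r -> is_root (f2 u) (f2 @: r).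
Proof. exact: (root_imset (@hat_cov2 _ _ _ _) f2_bot). Qed.

Let rootedQ u (r : {set Q}) : is_root u r -> rooted (g u) (g @: r).
Proof. by move=> ur; rewrite /rooted -imset1 -imset2; split; [apply: root1|apply: root2]. Qed.

Let top_path u y t : saturated u \top (rcons t y) ->
  [/\ y = \top, D u, D (last u t), covers (last u t) \top & saturated u (last u t) t].
Proof.
rewrite saturated_rcons => /and3P[pt ly /eqP Ey].
rewrite {}Ey in ly *; have ss : saturated u (last u t) t by rewrite /saturated pt eqxx.
have Dl : D (last u t) by rewrite /D lt_eqF // covers_lt.
split=> //; rewrite /D lt_eqF //; apply: le_lt_trans (covers_lt ly).
exact: saturated_le ss.
Qed.

Let top_gpath u y t : saturated u \top (rcons t y) -> path covers (g u) (map g t).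
Proof.
move=> /top_path[_ Du Dl _ st].
by have [/andP[]] := emb_path (@hat_leE _ _ _ _) (@hat_conv _ _ _ _)
  (@hat_surj _ _ _ _) Du Dl st.
Qed.

Let a_of r u t := lam1 (f1 @: (r :|: [set z in t])) (f1 (last u t)) \top.
Let b_of r u t := lam2 (f2 @: (r :|: [set z in t])) (f2 (last u t)) \top.

Let top_word u y t r : saturated u \top (rcons t y) ->
  word lamQ r u (rcons t y) =
  rcons (map letter (word lam (g @: r) (g u) (map g t))) [:: a_of r u t; b_of r u t].
Proof.
move=> /top_path[-> Du Dl lt st].
have aD := (emb_path (@hat_leE _ _ _ _) (@hat_conv _ _ _ _)
  (@hat_surj _ _ _ _) Du Dl st).2.
rewrite -cats1 word_cat -cats1 (emb_word lamQE) //; congr (_ ++ [:: _]).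
by rewrite /lamQ /hat_labeling eqxx /pair_word /a_of /b_of imset1 imset2.
Qed.

Let top_word1 u y t r : saturated u \top (rcons t y) -> is_root u r ->
  word lam1 (f1 @: r) (f1 u) (proj f1 u (rcons t y)) =
  rcons (word lam1 (pr1 @: (g @: r)) (pr1 (g u)) (proj pr1 (g u) (map g t))) (a_of r u t).
Proof.
move=> /top_path[-> Du Dl lt st] ur.
have [lt1 _] := (hat_cov_top _).1 lt.
rewrite -cats1 proj_cat word_cat /= ifN; last first.
  by rewrite -[f1 \top]/(\top : P1) lt_eqF // covers_lt.
by rewrite /= last_proj -(imset_root f1 t (root_mem ur)) cats1 imset1 proj1E.
Qed.

Let top_word2 u y t r : saturated u \top (rcons t y) -> is_root u r ->
  word lam2 (f2 @: r) (f2 u) (proj f2 u (rcons t y)) =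
  rcons (word lam2 (pr2 @: (g @: r)) (pr2 (g u)) (proj pr2 (g u) (map g t))) (b_of r u t).
Proof.
move=> /top_path[-> Du Dl lt st] ur.
have [_ lt2] := (hat_cov_top _).1 lt.
rewrite -cats1 proj_cat word_cat /= ifN; last first.
  by rewrite -[f2 \top]/(\top : P2) lt_eqF // covers_lt.
by rewrite /= last_proj -(imset_root f2 t (root_mem ur)) cats1 imset2 proj2E.
Qed.

(* As for [check_labeling], the edge of the letter before the last one does not
   end at the top. *)
Let last_letter u y x t r : saturated u \top (rcons (rcons t x) y) -> is_root u r ->
  let c := lam ((g @: r) :|: [set z in map g t]) (last (g u) (map g t)) (g x) in
  let a := a_of r u (rcons t x) in let b := b_of r u (rcons t x) in
  a < c /\ b < c \/ c < a /\ c < b.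
Proof.
move=> ss ur c a b; have [_ Du Dx xt sx] := top_path ss.
have gp := top_gpath ss.
rewrite last_rcons in Dx xt sx; have [xt1 xt2] := (hat_cov_top x).1 xt.
have rx := root_saturated sx ur.
have st : saturated u (last u t) t.
  by move: sx => /andP[]; rewrite rcons_path => /andP[pt _] _; rewrite /saturated pt eqxx.
have rt := rootedQ (root_saturated st ur).
have Eg : g @: (r :|: [set z in t]) = (g @: r) :|: [set z in map g t].
  rewrite imsetU; congr (_ :|: _); apply/setP=> z; rewrite inE.
  by apply/imsetP/mapP => -[w wt ->]; exists w => //; move: wt; rewrite inE.
apply: AN_cmp.
- by rewrite /a /a_of last_rcons; apply: lamA1 => //; apply: root1.
- by rewrite /b /b_of last_rcons; apply: lamA2 => //; apply: root2.
- rewrite map_rcons rcons_path in gp; have /andP[_ lx] := gp.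
  rewrite -last_map Eg in rt.
  apply: times_label_in => // q yr yx; [apply: lamN1|apply: lamN2] => //.
    by rewrite -[pr1 _]/(hat_pr1 x) -hat_eq_top.
  by rewrite -[pr2 _]/(hat_pr2 x) -hat_top12 -hat_eq_top.
Qed.

Let word_last (u x : Q) (t : seq Q) (r : {set Q}) : word lam (g @: r) (g u) (map g (rcons t x)) =
  rcons (word lam (g @: r) (g u) (map g t))
    (lam ((g @: r) :|: [set z in map g t]) (last (g u) (map g t)) (g x)).
Proof. by rewrite map_rcons -cats1 word_cat /= cats1. Qed.

Let top_increasing u y t r : saturated u \top (rcons t y) -> is_root u r ->
  sorted <=%O (word lamQ r u (rcons t y)) ->
  [/\ sorted <=%O (word lam (g @: r) (g u) (map g t)),
      sorted <=%O (word lam1 (f1 @: r) (f1 u) (proj f1 u (rcons t y)))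
    & sorted <=%O (word lam2 (f2 @: r) (f2 u) (proj f2 u (rcons t y)))].
Proof.
move=> ss ur; have gp := top_gpath ss; have ru := rootedQ ur.
rewrite (top_word r ss) (top_word1 ss ur) (top_word2 ss ur) => H.
have oW : sorted <=%O (word lam (g @: r) (g u) (map g t)).
  rewrite -(sorted_map_le letter_le).
  case/lastP: (map letter _) H => // w c.
  by rewrite (@sorted_rcons2 (seqlexi L)) => /andP[].
have [o1 o2] := times_sorted lamS1 lamS2 (shuffle_le_trans (S := S)) ru gp oW.
have low t' x : t = rcons t' x -> exists c w,
    [/\ word lam (g @: r) (g u) (map g t) = rcons w c, c < a_of r u t & c < b_of r u t].
  move=> Et; rewrite Et in ss H *; move: H.
  rewrite word_last map_rcons (@sorted_rcons2 (seqlexi L)) letter_le_pair => /andP[_ ca].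
  do 2!eexists; split; first reflexivity.
    by case: (last_letter ss ur) => [[/lt_le_trans/(_ ca)]|[]//]; rewrite ltxx.
  by case: (last_letter ss ur) => [[/lt_le_trans/(_ ca)]|[]//]; rewrite ltxx.
split=> //; apply: sorted_rcons => // h w'.
  case/lastP: t low gp oW {ss H o1 o2} => [|t' x] low gp oW Eh; first by case: w' Eh.
  have [c [w [EW ca cb]]] := low _ _ erefl.
  have [/(_ h w' Eh) hc _] := times_last lamS1 lamS2 (shuffle_le_trans (S := S)) ru gp oW EW.
  by case: hc => [->|hc]; [exact: ltW|exact: le_trans hc (ltW ca)].
case/lastP: t low gp oW {ss H o1 o2} => [|t' x] low gp oW Eh; first by case: w' Eh.
have [c [w [EW ca cb]]] := low _ _ erefl.
have [_ /(_ h w' Eh) hc] := times_last lamS1 lamS2 (shuffle_le_trans (S := S)) ru gp oW EW.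
by case: hc => [->|hc]; [exact: ltW|exact: le_trans hc (ltW cb)].
Qed.

Let top_increasing_conv u y t r : saturated u \top (rcons t y) -> is_root u r ->
  sorted <=%O (word lam (g @: r) (g u) (map g t)) ->
  sorted <=%O (word lam1 (f1 @: r) (f1 u) (proj f1 u (rcons t y))) ->
  sorted <=%O (word lam2 (f2 @: r) (f2 u) (proj f2 u (rcons t y))) ->
  sorted <=%O (word lamQ r u (rcons t y)).
Proof.
move=> ss ur oW; have gp := top_gpath ss; have ru := rootedQ ur.
rewrite (top_word r ss) (top_word1 ss ur) (top_word2 ss ur) => o1 o2.
apply: (@sorted_rcons (seqlexi L)); first by rewrite (sorted_map_le letter_le).
case/lastP: t ss gp oW o1 o2 => [|t x] ss gp oW o1 o2 h w'; first by case: w'.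
rewrite word_last map_rcons => /rcons_inj[_ <-]; rewrite letter_le_pair.
case: (last_letter ss ur) => [[ac bc]|[/ltW//]].
rewrite map_rcons in gp; have := times_last_part lam1 lam2 gp ru.
rewrite -map_rcons => -[] [w'' E].
  move: o1; rewrite E sorted_rcons2 => /andP[_ /(lt_le_trans ac)].
  by rewrite ltxx.
move: o2; rewrite E sorted_rcons2 => /andP[_ /(lt_le_trans bc)].
by rewrite ltxx.
Qed.

Let top_descending u y t r : saturated u \top (rcons t y) -> is_root u r ->
  sorted nle (word lamQ r u (rcons t y)) ->
  [/\ sorted nle (word lam (g @: r) (g u) (map g t)),
      sorted nle (word lam1 (f1 @: r) (f1 u) (proj f1 u (rcons t y)))
    & sorted nle (word lam2 (f2 @: r) (f2 u) (proj f2 u (rcons t y)))].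
Proof.
move=> ss ur; have gp := top_gpath ss; have ru := rootedQ ur.
rewrite (top_word r ss) (top_word1 ss ur) (top_word2 ss ur) => H.
have oW : sorted nle (word lam (g @: r) (g u) (map g t)).
  rewrite -(sorted_map_nle letter_le).
  case/lastP: (map letter _) H => // w c.
  by rewrite (@sorted_rcons2 (seqlexi L)) => /andP[].
have [o1 o2] := times_sorted lamS1 lamS2 (shuffle_nle_trans Scmp) ru gp oW.
have lt_nle (x c h : L) : x < c -> h = c \/ nle h c -> nle h x.
  move=> xc [->|]; first by rewrite /nle lt_geF.
  by apply: contra => hx; apply: le_trans hx (ltW xc).
have high t' x : t = rcons t' x -> exists c w,
    [/\ word lam (g @: r) (g u) (map g t) = rcons w c, a_of r u t < c & b_of r u t < c].
  move=> Et; rewrite Et in ss H *; move: H.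
  rewrite word_last map_rcons (@sorted_rcons2 (seqlexi L)) /nle letter_le_pair.
  move=> /andP[_ /negP ca]; do 2!eexists; split; first reflexivity.
    by case: (last_letter ss ur) => [[]//|[/ltW]].
  by case: (last_letter ss ur) => [[]//|[/ltW]].
split=> //; apply: sorted_rcons => // h w'.
  case/lastP: t high gp oW {ss H o1 o2} => [|t' x] high gp oW Eh; first by case: w' Eh.
  have [c [w [EW ac bc]]] := high _ _ erefl.
  have [/(_ h w' Eh) hc _] := times_last lamS1 lamS2 (shuffle_nle_trans Scmp) ru gp oW EW.
  exact: lt_nle hc.
case/lastP: t high gp oW {ss H o1 o2} => [|t' x] high gp oW Eh; first by case: w' Eh.
have [c [w [EW ac bc]]] := high _ _ erefl.
have [_ /(_ h w' Eh) hc] := times_last lamS1 lamS2 (shuffle_nle_trans Scmp) ru gp oW EW.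
exact: lt_nle hc.
Qed.

Let proj1_rcons u y t : saturated u \top (rcons t y) ->
  proj f1 u (rcons t y) = rcons (proj f1 u t) \top.
Proof.
move=> /top_path[-> _ _ lt _]; have [lt1 _] := (hat_cov_top _).1 lt.
by rewrite -cats1 proj_cat /= ifN ?cats1 // lt_eqF // covers_lt.
Qed.

Let proj2_rcons u y t : saturated u \top (rcons t y) ->
  proj f2 u (rcons t y) = rcons (proj f2 u t) \top.
Proof.
move=> /top_path[-> _ _ lt _]; have [_ lt2] := (hat_cov_top _).1 lt.
by rewrite -cats1 proj_cat /= ifN ?cats1 // lt_eqF // covers_lt.
Qed.

Let last_eq u t t' : proj f1 u t = proj f1 u t' -> proj f2 u t = proj f2 u t' ->
  last u t = last u t'.
Proof.
move=> E1 E2; have F1 : f1 (last u t) = f1 (last u t') by rewrite -!(last_proj f1) E1.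
have F2 : f2 (last u t) = f2 (last u t') by rewrite -!(last_proj f2) E2.
exact: hat_ext.
Qed.

Let top_desc_inj u y y' t t' r : is_root u r ->
  saturated u \top (rcons t y) -> saturated u \top (rcons t' y') ->
  sorted nle (word lamQ r u (rcons t y)) -> sorted nle (word lamQ r u (rcons t' y')) ->
  proj f1 u (rcons t y) = proj f1 u (rcons t' y') ->
  proj f2 u (rcons t y) = proj f2 u (rcons t' y') -> rcons t y = rcons t' y'.
Proof.
move=> ur ss ss' ds ds'; rewrite !proj1_rcons // !proj2_rcons //.
move=> /rcons_inj[E1] /rcons_inj[E2].
have [oW _ _] := top_descending ss ur ds; have [oW' _ _] := top_descending ss' ur ds'.
have [-> Du Dl lt st] := top_path ss; have [-> _ Dl' _ st'] := top_path ss'.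
rewrite -(last_eq E1 E2) in st'; congr (rcons _ _).
have gp := top_gpath ss; have gp' := top_gpath ss'.
apply: (inj_map (emb_inj (@hat_leE _ _ _ _))).
apply: (times_sorted_inj lamS1 lamS2 (shuffle_nle_trans Scmp) _ (rootedQ ur) gp gp' oW oW').
- exact: shuffle_nle_asym.
- by rewrite -!proj1E.
- by rewrite -!proj2E.
Qed.

Let rk1 : has_rank [set: P1] k1. Proof. by case: ced1. Qed.
Let rk2 : has_rank [set: P2] k2. Proof. by case: ced2. Qed.

Lemma CL_path_belast (d : Order.disp_t) (P : finTBPOrderType d) (mu : labeling P L)
    r x y z t : CL_labeling mu -> is_root x r -> CL_path mu r x y (rcons t z) ->
  CL_path mu r x (last x t) t.
Proof.
move=> /CL_labelingP C rx [/andP[+ _] o _ _]; rewrite rcons_path => /andP[pt _].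
have st : saturated x (last x t) t by rewrite /saturated pt eqxx.
have ot : sorted <=%O (word mu r x t).
  move: o; rewrite -cats1 word_cat /= cats1.
  by case/lastP: (word _ _ _ _) => // w c; rewrite sorted_rcons2 => /andP[].
have [t0 Ht0] := C _ _ _ (saturated_le st) rx.
by have [_ _ /(_ t st ot) E _] := Ht0; rewrite {2}E.
Qed.

Let top_CL u r : is_root u r -> u != \top -> exists s, CL_path lamQ r u \top s.
Proof.
move=> ur Du; have [C1 _ _ _ _ _ _] := ced1; have [C2 _ _ _ _ _ _] := ced2.
have u1t : f1 u != \top by rewrite -hat_eq_top.
have u2t : f2 u != \top by rewrite -hat_top12.
have r1 := root1 ur; have r2 := root2 ur.
have [s1 H1] := (CL_labelingP lam1).1 C1 _ _ _ (lex1 (f1 u)) r1.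
have [s2 H2] := (CL_labelingP lam2).1 C2 _ _ _ (lex1 (f2 u)) r2.
case/lastP: s1 H1 => [|t1 y1] H1.
  by case: H1 => /andP[_ /eqP /= E] _ _ _; rewrite E eqxx in u1t.
case/lastP: s2 H2 => [|t2 y2] H2.
  by case: H2 => /andP[_ /eqP /= E] _ _ _; rewrite E eqxx in u2t.
have [ss1 o1 un1 l1] := H1; have [ss2 o2 un2 l2] := H2.
have Ey1 : y1 = \top by case/andP: ss1 => _; rewrite last_rcons => /eqP.
have Ey2 : y2 = \top by case/andP: ss2 => _; rewrite last_rcons => /eqP.
rewrite {}Ey1 {y1} in H1 ss1 o1 un1 l1; rewrite {}Ey2 {y2} in H2 ss2 o2 un2 l2.
have T1 := CL_path_belast C1 r1 H1; have T2 := CL_path_belast C2 r2 H2.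
have zt1 : covers (last (f1 u) t1) \top by case/andP: ss1; rewrite rcons_path => /andP[].
have zt2 : covers (last (f2 u) t2) \top by case/andP: ss2; rewrite rcons_path => /andP[].
pose z12 : P1 *p P2 := (last (f1 u) t1, last (f2 u) t2).
have /hat_of[z Ez] : (pr1 z12 == \top) = (pr2 z12 == \top).
  by rewrite /pr1 /pr2 /= !lt_eqF // covers_lt.
have Ez1 : f1 z = last (f1 u) t1 by rewrite /f1 /hat_pr1 Ez.
have Ez2 : f2 z = last (f2 u) t2 by rewrite /f2 /hat_pr2 Ez.
have zt : covers z \top by apply/hat_cov_top; rewrite -/(f1 z) -/(f2 z) Ez1 Ez2.
have Dz : D z by rewrite /D lt_eqF // covers_lt.
have ru := rootedQ ur.
rewrite -Ez1 imset1 in T1; rewrite -Ez2 imset2 in T2.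
have [t [Ht Et1 Et2]] := emb_CL_path (@hat_leE _ _ _ _) (@hat_conv _ _ _ _)
  (@hat_surj _ _ _ _) letter_le Sdisj Scmp lamS1 lamS2 lamQE rk1 rk2 Du Dz ru T1 T2.
have [st ot ut lt] := Ht.
have lz : last u t = z by case/andP: st => _ /eqP.
have ss : saturated u \top (rcons t \top).
  by case/andP: st => pt _; rewrite /saturated rcons_path pt lz zt last_rcons eqxx.
have F1 : proj f1 u (rcons t \top) = rcons t1 \top by rewrite proj1_rcons // proj1E Et1.
have F2 : proj f2 u (rcons t \top) = rcons t2 \top by rewrite proj2_rcons // proj2E Et2.
have wE s : saturated u z s -> word lamQ r u s =
    map letter (word lam (g @: r) (g u) (map g s)).
  move=> sz; rewrite (emb_word lamQE) //.
  exact: (emb_path (@hat_leE _ _ _ _) (@hat_conv _ _ _ _)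
    (@hat_surj _ _ _ _) Du Dz sz).2.
have oW : sorted <=%O (word lam (g @: r) (g u) (map g t)).
  by rewrite -(sorted_map_le letter_le) -wE.
have uniq_t t' : saturated u \top (rcons t' \top) -> proj f1 u t' = t1 ->
    proj f2 u t' = t2 -> last u t' = z.
  by move=> ss' G1 G2; rewrite -lz; apply: last_eq; rewrite ?G1 ?G2 ?proj1E ?proj2E.
exists (rcons t \top); split=> //.
- by apply: top_increasing_conv => //; rewrite ?F1 ?F2.
- case/lastP => [/andP[_ /eqP /= E]|t' y' ss' oQ]; first by rewrite E eqxx in Du.
  have [oW' o1' o2'] := top_increasing ss' ur oQ.
  have q1 := proj_saturated (@hat_cov1 _ _ _ _) ss'.
  have q2 := proj_saturated (@hat_cov2 _ _ _ _) ss'.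
  have G1 := un1 _ q1 o1'; have G2 := un2 _ q2 o2'.
  have [Ey' _ Dz' zt' st'] := top_path ss'; rewrite {}Ey' {y' oQ} in ss' o1' o2' q1 q2 G1 G2 *.
  move: G1 G2; rewrite -/f1 -/f2 proj1_rcons // proj2_rcons //.
  move=> /rcons_inj[G1] /rcons_inj[G2].
  rewrite (uniq_t _ ss' G1 G2) in st'.
  by congr (rcons _ _); apply: ut => //; rewrite wE // (sorted_map_le letter_le).
- case/lastP => [/andP[_ /eqP /= E]|t' y' ss' ns]; first by rewrite E eqxx in Du.
  have q1 := proj_saturated (@hat_cov1 _ _ _ _) ss'.
  have q2 := proj_saturated (@hat_cov2 _ _ _ _) ss'.
  have [Ey' _ Dz' zt' st'] := top_path ss'; rewrite {}Ey' {y'} in ss' ns q1 q2 *.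
  have pgt := top_gpath ss; have pgt' := top_gpath ss'.
  have le1 : (word lam1 (f1 @: r) (f1 u) (rcons t1 \top) : seqlexi L) <=
      word lam1 (f1 @: r) (f1 u) (proj f1 u (rcons t' \top)).
    have [->|n1] := eqVneq (proj f1 u (rcons t' \top)) (rcons t1 \top); first exact: lexx.
    by apply: ltW; apply: l1.
  have le2 : (word lam2 (f2 @: r) (f2 u) (rcons t2 \top) : seqlexi L) <=
      word lam2 (f2 @: r) (f2 u) (proj f2 u (rcons t' \top)).
    have [->|n2] := eqVneq (proj f2 u (rcons t' \top)) (rcons t2 \top); first exact: lexx.
    by apply: ltW; apply: l2.
  have sz1 : size (proj f1 u (rcons t' \top)) = size (rcons t1 \top) := graded rk1 q1 ss1.
  have sz2 : size (proj f2 u (rcons t' \top)) = size (rcons t2 \top) := graded rk2 q2 ss2.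
  have W1 := top_word1 ss ur; have W2 := top_word2 ss ur.
  have W1' := top_word1 ss' ur; have W2' := top_word2 ss' ur.
  have len1 : size (proj pr1 (g u) (map g t)) = size (proj pr1 (g u) (map g t')).
    have := congr1 size W1'; have := congr1 size W1.
    by rewrite !size_rcons !size_word sz1 F1 => -> [].
  have len2 : size (proj pr2 (g u) (map g t)) = size (proj pr2 (g u) (map g t')).
    have := congr1 size W2'; have := congr1 size W2.
    by rewrite !size_rcons !size_word sz2 F2 => -> [].
  have lenW : size (word lam (g @: r) (g u) (map g t)) =
      size (word lam (g @: r) (g u) (map g t')).
    by rewrite !size_word (size_projs pgt) (size_projs pgt') len1 len2.
  rewrite -F1 W1 W1' lexi_rcons ?size_word // in le1.
  rewrite -F2 W2 W2' lexi_rcons ?size_word // in le2.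
  have {le1}[ha1 /implyP ht1] := andP le1; have {le2}[ha2 /implyP ht2] := andP le2.
  have leW := times_lexi_le Sdisj lamS1 lamS2 ru ru pgt pgt' oW len1 len2 ha1 ha2.
  rewrite (top_word r ss) (top_word r ss') lt_neqAle; apply/andP; split; last first.
    rewrite lexi_rcons ?size_map // !(map_lexi letter_le) leW /=; apply/implyP => geW.
    have [|_ V1 V2] := times_word_inj Sdisj lamS1 lamS2 ru ru pgt pgt' _.
      by apply: (@le_anti _ (seqlexi L)); apply/andP; split; [exact: leW|exact: geW].
    by apply: pair_le; [apply: ht1; rewrite V1|apply: ht2; rewrite V2].
  apply/eqP => /rcons_inj[/(inj_map letter_inj) Ew Ea Eb].
  have [Et V1 V2] := times_word_inj Sdisj lamS1 lamS2 ru ru pgt pgt' Ew.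
  have G1 : proj f1 u (rcons t' \top) = rcons t1 \top.
    apply/eqP/negPn/negP => /(l1 _ q1).
    by rewrite -F1 W1 W1' Ea V1 ltxx.
  have G2 : proj f2 u (rcons t' \top) = rcons t2 \top.
    apply/eqP/negPn/negP => /(l2 _ q2).
    by rewrite -F2 W2 W2' Eb V2 ltxx.
  move: G1 G2; rewrite proj1_rcons // proj2_rcons // => /rcons_inj[K1] /rcons_inj[K2].
  case/eqP: ns; congr (rcons _ _).
  apply: (inj_map (emb_inj (@hat_leE _ _ _ _))).
  by apply: (tword_inj pgt' pgt (esym Et)); rewrite -?proj1E -?proj2E ?K1 ?K2 ?proj1E ?proj2E.
Qed.

Lemma hat_ced : CL_ced R (hat_labeling lam1 lam2)
  (fun st : I1 *l I2 => hat_set (Sigma1 st.1) (Sigma2 st.2)).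
Proof.
have [C1 _ rkS1 T1 _ _ _] := ced1; have [C2 _ rkS2 T2 _ _ _] := ced2.
have b1 s : \bot \in Sigma1 s by have /andP[] := rank_bot_top rk1 (@rkS1 s).
have b2 s : \bot \in Sigma2 s by have /andP[] := rank_bot_top rk2 (@rkS2 s).
have t1 s : \top \in Sigma1 s by have /andP[] := rank_bot_top rk1 (@rkS1 s).
have t2 s : \top \in Sigma2 s by have /andP[] := rank_bot_top rk2 (@rkS2 s).
have SE (st : I1 *l I2) (u : Q) : (u \in hat_set (Sigma1 st.1) (Sigma2 st.2)) =
    (f1 u \in Sigma1 st.1) && (f2 u \in Sigma2 st.2) by exact: in_hat_set.
have ndQ : \bot != \top :> Q by rewrite hat_eq_top -/f1 f1_bot.
exists ((k1.-1 + k2.-1).+1).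
apply: (ced_product (@hat_le _ _ _ _) f1_bot f2_bot _ _ (@hat_cov1 _ _ _ _)
  (@hat_cov2 _ _ _ _) (@hat_dense _ _ _ _) ced1 ced2 _ SE) => //.
- apply: path_rank => s; case/lastP: s => [|t y] ss.
    by case/andP: ss => _ ndQ'; rewrite (negPf ndQ) in ndQ'.
  have q1 := proj_saturated (@hat_cov1 _ _ _ _) ss.
  have q2 := proj_saturated (@hat_cov2 _ _ _ _) ss.
  rewrite -/f1 f1_bot in q1; rewrite -/f2 f2_bot in q2.
  have := rank_path rk2 q2; have := rank_path rk1 q1.
  rewrite proj1_rcons // proj2_rcons // !size_rcons => <- <- /=.
  by rewrite proj1E proj2E -(size_projs (top_gpath ss)) size_map.
- apply/CL_labelingP => u v r uv ur.
  have [E|Dv] := eqVneq v \top.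
    rewrite E in uv *; have [->|Du] := eqVneq u \top.
      by exists [::]; exact: CL_path_nil.
    exact: top_CL.
  have Du : D u by rewrite /D lt_eqF // (le_lt_trans uv) // ltx1.
  have rz := rootedQ ur; have [r1 r2] := rz.
  have := uv; rewrite hat_le => /andP[uv1 uv2].
  have [s1 H1] := (CL_labelingP lam1).1 C1 _ _ _ uv1 r1.
  have [s2 H2] := (CL_labelingP lam2).1 C2 _ _ _ uv2 r2.
  have [s [Hs _ _]] := emb_CL_path (@hat_leE _ _ _ _) (@hat_conv _ _ _ _)
    (@hat_surj _ _ _ _) letter_le Sdisj Scmp lamS1 lamS2 lamQE rk1 rk2 Du Dv rz H1 H2.
  by exists s.
- move=> st; apply: (free_sum_polytope (@hat_le _ _ _ _) _ (t1 st.1) (t2 st.2)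
    (b1 st.1) (b2 st.2) nd1 nd2 (@hat_top12 _ _ _ _) _ (T1 st.1) (T2 st.2)).
    by move=> u; rewrite SE.
  move=> x1 x2 H1 H2 E12; have [u Eu] := @hat_of _ _ _ _ (x1, x2) E12.
  have E1 : f1 u = x1 by rewrite /f1 /hat_pr1 Eu.
  have E2 : f2 u = x2 by rewrite /f2 /hat_pr2 Eu.
  by exists u => //; rewrite SE E1 E2 H1.
- move=> u v r s ur ss ds; have [E|Dv] := eqVneq v \top.
    rewrite {}E in ss; case/lastP: s ss ds => [|t y] ss ds; first by [].
    by have [_ o1 o2] := top_descending ss ur ds.
  have Du : D u by rewrite /D lt_eqF // (le_lt_trans (saturated_le ss)) // ltx1.
  rewrite -/f1 -/f2 imset1 imset2 proj1E proj2E.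
  exact: (emb_descending (@hat_leE _ _ _ _) (@hat_conv _ _ _ _)
    (@hat_surj _ _ _ _) letter_le Scmp lamS1 lamS2 lamQE Du Dv (rootedQ ur) ss ds).
- move=> u v r s s' ur ss ss' ds ds'; have [E|Dv] := eqVneq v \top.
    rewrite {}E in ss ss'.
    case/lastP: s ss ds => [|t y] ss ds; case/lastP: s' ss' ds' => [|t' y'] ss' ds' //.
    + by move: ss => /andP[_ /eqP /= E]; rewrite E in ss'; rewrite (saturated_refl ss').
    + by move: ss' => /andP[_ /eqP /= E]; rewrite E in ss; rewrite (saturated_refl ss).
    + move=> E1 E2; exact: (top_desc_inj ur ss ss' ds ds' E1 E2).
  have Du : D u by rewrite /D lt_eqF // (le_lt_trans (saturated_le ss)) // ltx1.
  rewrite -/f1 -/f2 !proj1E !proj2E.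
  exact: (emb_descending_inj (@hat_leE _ _ _ _) (@hat_conv _ _ _ _)
    (@hat_surj _ _ _ _) letter_le Scmp lamS1 lamS2 lamQE Du Dv (rootedQ ur) ss ss' ds ds').
Qed.

End HatCed.

Unset Implicit Arguments.

Theorem theorem5p13 (R : realType) (d1 d2 dL e1 e2 : Order.disp_t)
    (P1 : finTBPOrderType d1) (P2 : finTBPOrderType d2) (L : porderType dL)
    (S1 S2 : {pred L}) (lam1 : labeling P1 L) (lam2 : labeling P2 L)
    (I1 : finOrderType e1) (I2 : finOrderType e2)
    (Sigma1 : I1 -> {set P1}) (Sigma2 : I2 -> {set P2}) :
  labels_in lam1 S1 -> labels_in lam2 S2 -> [predI S1 & S2] =i pred0 ->
  CL_ced R lam1 Sigma1 -> CL_ced R lam2 Sigma2 ->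
  [/\ {in S1 & S2, forall a b, a >=< b} ->
      CL_ced R (times_labeling lam1 lam2)
        (fun st : I1 *l I2 => times_set (Sigma1 st.1) (Sigma2 st.2)),
      forall S1m S1A S1p S2m S2A S2p : {pred L},
      orderly lam1 S1 S1m S1A S1p -> orderly lam2 S2 S2m S2A S2p ->
      increasing_blocks [:: S1m; S2m; S1A; S2A; S1p; S2p] ->
      CL_ced R (check_labeling lam1 lam2)
        (fun st : I1 *l I2 => check_set (Sigma1 st.1) (Sigma2 st.2))
    & forall S1m S1A S1p S2m S2A S2p : {pred L},
      co_orderly lam1 S1 S1m S1A S1p -> co_orderly lam2 S2 S2m S2A S2p ->
      increasing_blocks [:: S1m; S2m; S1A; S2A; S1p; S2p] ->
      CL_ced R (hat_labeling lam1 lam2)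
        (fun st : I1 *l I2 => hat_set (Sigma1 st.1) (Sigma2 st.2))].
Proof.
move=> lS1 lS2 S12 [k1 ced1] [k2 ced2].
pose S (i : bool) : {pred L} := if i then S1 else S2.
have Sdisj i a : a \in S i -> a \in S (~~ i) -> False.
  by have := S12 a; rewrite !inE; case: i => /= /negP H a1 a2; case: H; apply/andP.
have symS : {in S1 & S2, forall a b, a >=< b} ->
    forall i, {in S i & S (~~ i), forall a b, a >=< b}.
  by move=> H [] a b aS bS; [|rewrite comparable_sym]; apply: H.
have [i0 _] : exists i, (set0 : {set P1}) \subset Sigma1 i.
  by apply: (ced_union ced1); apply/chainP=> x; rewrite inE.
have [j0 _] : exists j, (set0 : {set P2}) \subset Sigma2 j.
  by apply: (ced_union ced2); apply/chainP=> x; rewrite inE.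
split=> [/symS Scmp|S1m S1A S1p S2m S2A S2p|S1m S1A S1p S2m S2A S2p].
- exact: (times_ced ced1 ced2 Sdisj Scmp lS1 lS2).
- move=> [[_ E1 _] o1] [[_ E2 _] o2] inc.
  have Scmp := symS (fun a b aS bS => block_total inc (etrans (esym (E1 a)) aS)
                                                  (etrans (esym (E2 b)) bS)).
  have point : \bot = \top :> P1 \/ \bot = \top :> P2 ->
      CL_ced R (check_labeling lam1 lam2)
        (fun st : I1 *l I2 => check_set (Sigma1 st.1) (Sigma2 st.2)).
    move=> H; refine (ced_point _ _ ((i0, j0) : I1 *l I2) (@check_point _ _ P1 P2 H) _) => st.
    by apply/setUP; right; rewrite inE.
  have [E|nd1] := eqVneq (\bot : P1) \top; first by apply: point; left.
  have [E|nd2] := eqVneq (\bot : P2) \top; first by apply: point; right.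
  apply: (check_ced ced1 ced2 Sdisj Scmp lS1 lS2
    (SA := fun i => if i then S1A else S2A)
    (N := fun i => if i then [predU S1m & S1p] else [predU S2m & S2p])) => //.
  + by move=> a b c; apply: block_cmp.
  + by move=> r x rx xy; have := o1 r _ _ rx xy; rewrite eqxx.
  + by move=> r x rx xy; have := o2 r _ _ rx xy; rewrite eqxx.
  + by move=> r x y rx xy x0; have := o1 r _ _ rx xy; rewrite (negPf x0).
  + by move=> r x y rx xy x0; have := o2 r _ _ rx xy; rewrite (negPf x0).
- move=> [[_ E1 _] o1] [[_ E2 _] o2] inc.
  have Scmp := symS (fun a b aS bS => block_total inc (etrans (esym (E1 a)) aS)
                                                  (etrans (esym (E2 b)) bS)).
  have point : \bot = \top :> P1 \/ \bot = \top :> P2 ->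
      CL_ced R (hat_labeling lam1 lam2)
        (fun st : I1 *l I2 => hat_set (Sigma1 st.1) (Sigma2 st.2)).
    move=> H; have Qpt := @hat_point _ _ P1 P2 H.
    refine (ced_point _ _ ((i0, j0) : I1 *l I2) Qpt _) => st.
    by rewrite (Qpt \bot \top); apply/setUP; right; rewrite inE.
  have [E|nd1] := eqVneq (\bot : P1) \top; first by apply: point; left.
  have [E|nd2] := eqVneq (\bot : P2) \top; first by apply: point; right.
  apply: (hat_ced ced1 ced2 Sdisj Scmp lS1 lS2
    (SA := fun i => if i then S1A else S2A)
    (N := fun i => if i then [predU S1m & S1p] else [predU S2m & S2p])) => //.
  + by move=> a b c; apply: block_cmp.
  + by move=> r x rx xy; have := o1 r _ _ rx xy; rewrite eqxx.
  + by move=> r x rx xy; have := o2 r _ _ rx xy; rewrite eqxx.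
  + by move=> r x y rx xy y1; have := o1 r _ _ rx xy; rewrite (negPf y1).
  + by move=> r x y rx xy y1; have := o2 r _ _ rx xy; rewrite (negPf y1).
Qed.
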